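(* Let $D(X|Y)=\operatorname{tr}(X\log X-X\log Y)$ be the quantum relative entropy function defined for positive semidefinite matrices $X,Y\in\mathbf{H}^n_+$ such that $X\ll Y$, and consider its epigraph $$\operatorname{epi}(D)=\{(X,Y,z)\in\mathbf{H}^n_+\times\mathbf{H}^n_+\times\mathbb{R}:X\ll Y\text{ and }D(X|Y)\le z\}.$$ Then the function $(X,Y,z)\mapsto-\log(z-D(X|Y))-\log\det X-\log\det Y$ defined on $\mathbf{H}^n_{++}\times\mathbf{H}^n_{++}\times\mathbb{R}$ is a $(2n+1)$-logarithmically homogeneous self-concordant barrier for $\operatorname{epi}(D)$. Moreover, this barrier is optimal in the sense that any self-concordant barrier for $\operatorname{epi}(D)$ has parameter at least $2n+1$.
   Context: $\mathbf{H}^n$ is the real vector space of $n\times n$ complex Hermitian matrices; $\mathbf{H}^n_+$ and $\mathbf{H}^n_{++}$ are the sets of positive semidefinite and positive definite ones. For positive semidefinite $X,Y$, $X\ll Y$ means $\ker(Y)\subset\ker(X)$. $\log$ is the matrix logarithm. For singular $X,Y\in\mathbf{H}^n_+$ with $X\ll Y$, $D(X|Y)$ is understood as $\lim_{\epsilon\downarrow0}D(X+\epsilon I|Y+\epsilon I)$. For $f$ defined on a subset of a finite-dimensional real vector space $E$, $D^kf(x)[h]=\frac{d^k}{dt^k}f(x+th)|_{t=0}$. A convex function $f:E\to\mathbb{R}\cup\{+\infty\}$ is self-concordant if $\operatorname{dom}f=\{x:f(x)<+\infty\}$ is open, its epigraph $\{(x,t)\in E\times\mathbb{R}:f(x)\le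 t\}$ is closed, and $f$ is $C^3$ on $\operatorname{dom}f$ with $|D^3f(x)[h]|\le2(D^2f(x)[h])^{3/2}$ for all $x\in\operatorname{dom}f$, $h\in E$. It is a self-concordant barrier for a closed convex set $Q$ if moreover $\operatorname{cl}(\operatorname{dom}f)=Q$; it has parameter $\nu$ (is a $\nu$-self-concordant barrier) if moreover $2Df(x)[h]-D^2f(x)[h]\le\nu$ for all $x\in\operatorname{dom}f$, $h\in E$. When $\operatorname{dom}f$ is a convex cone, $f$ is $\nu$-logarithmically homogeneous if $f(\tau x)=f(x)-\nu\log\tau$ for all $x\in\operatorname{dom}f$, $\tau>0$; a $\nu$-logarithmically homogeneous self-concordant barrier is automatically a $\nu$-self-concordant barrier. Convention: $-\log t=+\infty$ for $t\le0$, and the barrier function takes the value $+\infty$ when $X$ or $Y$ is not positive definite. *)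

(* Defs.v *)
From HB Require Import structures.
From mathcomp Require Import all_boot all_order all_algebra.
From mathcomp Require Import complex.
From mathcomp Require Import all_classical all_reals all_analysis.

Set Implicit Arguments.
Unset Strict Implicit.
Unset Printing Implicit Defensive.

Import Order.TTheory GRing.Theory Num.Theory.
Import numFieldNormedType.Exports.

Local Open Scope classical_set_scope.
Local Open Scope ring_scope.
Local Open Scope sesquilinear_scope.

(* The real normed space H^n of complex Hermitian matrices. MathComp only makes
   'M[R[i]]_n a module over R[i], and H^n is not closed under complex scaling,
   so the real vector space structure is declared here. *)
Section HermitianMatrices.
Variables (R : realType) (n : nat).

Definition hermitian_pred : {pred 'M[R[i]]_n} :=
  [pred A : 'M[R[i]]_n | A \is hermsymmx].

Lemma hermitian_predE (A : 'M[R[i]]_n) :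
  (A \in hermitian_pred) = (A == A ^t*).
Proof. by rewrite inE is_hermitianmxE expr0 scale1r. Qed.

Fact hermitian_zmod_closed : zmod_closed hermitian_pred.
Proof.
split; first by rewrite hermitian_predE trmx0 map_mx0.
move=> A B; rewrite !hermitian_predE => /eqP hA /eqP hB.
by rewrite linearB /= map_mxB -hA -hB.
Qed.

HB.instance Definition _ :=
  GRing.isZmodClosed.Build 'M[R[i]]_n hermitian_pred hermitian_zmod_closed.

Record hermmx := HermMx {
  hermmx_val :> 'M[R[i]]_n;
  hermmx_valP : hermmx_val \in hermitian_pred }.

HB.instance Definition _ := [isSub for hermmx_val].
HB.instance Definition _ := [Choice of hermmx by <:].
HB.instance Definition _ := [SubChoice_isSubZmodule of hermmx by <:].

Fact hermmx_scale_subproof (a : R) (A : hermmx) :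
  (a%:C)%C *: (A : 'M[R[i]]_n) \in hermitian_pred.
Proof.
have := hermmx_valP A; rewrite !hermitian_predE => /eqP hA; apply/eqP.
rewrite {1}hA; apply/matrixP => i j; rewrite !mxE rmorphM /=; congr (_ * _).
by apply/esym/CrealP; rewrite complex_real.
Qed.

Definition hermmx_scale (a : R) (A : hermmx) : hermmx :=
  HermMx (hermmx_scale_subproof a A).

Fact hermmx_scaleA (a b : R) (A : hermmx) :
  hermmx_scale a (hermmx_scale b A) = hermmx_scale (a * b) A.
Proof. by apply: val_inj; rewrite /= scalerA rmorphM. Qed.

Fact hermmx_scale1 : left_id 1 hermmx_scale.
Proof. by move=> A; apply: val_inj; rewrite /= rmorph1 scale1r. Qed.

Fact hermmx_scaleDr : right_distributive hermmx_scale +%R.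
Proof. by move=> a A B; apply: val_inj; rewrite /= scalerDr. Qed.

Fact hermmx_scaleDl (A : hermmx) :
  {morph hermmx_scale^~ A : a b / a + b}.
Proof. by move=> a b; apply: val_inj; rewrite /= rmorphD scalerDl. Qed.

HB.instance Definition _ := GRing.Zmodule_isLmodule.Build R hermmx
  hermmx_scaleA hermmx_scale1 hermmx_scaleDr hermmx_scaleDl.

(* The largest modulus of an entry. H^n being finite-dimensional, the choice of
   norm is irrelevant to the notions below, which depend on the topology only. *)
Definition hermmx_norm (A : hermmx) : R := complex.Re `|(A : 'M[R[i]]_n)|.

Lemma hermmx_normE (A : hermmx) :
  (hermmx_norm A)%:C%C = `|(A : 'M[R[i]]_n)|.
Proof. by rewrite /hermmx_norm RRe_real// ger0_real. Qed.

Fact hermmx_normD (A B : hermmx) :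
  hermmx_norm (A + B) <= hermmx_norm A + hermmx_norm B.
Proof. by rewrite -lecR rmorphD /= !hermmx_normE ler_normD. Qed.

Fact hermmx_normZ (a : R) (A : hermmx) :
  hermmx_norm (a *: A) = `|a| * hermmx_norm A.
Proof.
apply: complexI; rewrite rmorphM /= !hermmx_normE mx_normZ.
by rewrite normc_def /= expr0n /= addr0 sqrtr_sqr.
Qed.

Fact hermmx_norm0_eq0 (A : hermmx) : hermmx_norm A = 0 -> A = 0.
Proof.
move=> A0; apply: val_inj; apply/eqP.
by rewrite /= -normr_eq0 -hermmx_normE A0.
Qed.

HB.instance Definition _ := Lmodule_isNormed.Build R hermmx
  hermmx_normD hermmx_normZ hermmx_norm0_eq0.

End HermitianMatrices.

(* Applied below to the finite-dimensional space H^n x H^n x R. *)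
Section SelfConcordance.
Variables (R : realType) (E : normedModType R).
Implicit Types (f : E -> \bar R) (A Q : set E) (nu : R).

Definition dom f : set E := [set x | (f x < +oo)%E].

Definition epigraph f : set (E * R^o) := [set p | (f p.1 <= (p.2 : R)%:E)%E].

(* Convexity of a function with values in R U {+oo}; 0 * +oo = 0 in \bar R, so
   the end points t = 0, 1 are harmless. *)
Definition convex_ereal f : Prop :=
  (forall x, f x != -oo%E) /\
  (forall (x y : E) (t : R), 0 <= t <= 1 ->
    (f (t *: x + (1 - t) *: y)%R <= t%:E * f x + (1 - t)%:E * f y)%E).

(* D^k f(x)[h]; on the open set dom f, only the values of f near x, which are
   finite, matter. *)
Definition Dk (k : nat) f (x h : E) : R :=
  derive1n k (fun t : R => fine (f (x + t *: h)) : R^o) 0.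

(* C^k on an open set of a finite-dimensional space: all the iterated
   directional derivatives of order at most k exist and are continuous. *)
Fixpoint continuously_derivable (k : nat) (A : set E) (g : E -> R^o) : Prop :=
  (forall x, A x -> {for x, continuous g}) /\
  if k is k'.+1 then
    forall v : E, (forall x, A x -> derivable g x v) /\
                  continuously_derivable k' A ('D_v g)
  else True.

Definition self_concordant f : Prop :=
  [/\ convex_ereal f,
      open (dom f),
      closed (epigraph f),
      continuously_derivable 3 (dom f) (fun x => fine (f x)) &
      forall x h, dom f x -> `|Dk 3 f x h| <= 2 * (Dk 2 f x h) `^ (3 / 2)].

Definition self_concordant_barrier f Q : Prop :=
  [/\ closed Q, convex_set Q, self_concordant f & closure (dom f) = Q].

Definition has_parameter f nu : Prop :=
  forall x h, dom f x -> 2 * Dk 1 f x h - Dk 2 f x h <= nu.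

Definition convex_cone A : Prop :=
  convex_set A /\ (forall (x : E) (tau : R), A x -> 0 < tau -> A (tau *: x)).

Definition log_homogeneous f nu : Prop :=
  convex_cone (dom f) /\
  (forall (x : E) (tau : R), dom f x -> 0 < tau ->
    f (tau *: x) = (f x - (nu * ln tau)%R%:E)%E).

Definition log_homogeneous_barrier f nu Q : Prop :=
  self_concordant_barrier f Q /\ log_homogeneous f nu.

End SelfConcordance.

Section QuantumRelativeEntropy.
Variables (R : realType) (n : nat).
Local Notation H := (hermmx R n).
Implicit Types X Y : H.

Definition quad_form X (v : 'cV[R[i]]_n) : R[i] := (v ^t* *m X *m v) 0 0.

(* In R[i], 0 <= z means that z is real and nonnegative. *)
Definition psd X : Prop := forall v : 'cV[R[i]]_n, 0 <= quad_form X v.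

Definition pd X : Prop := forall v : 'cV[R[i]]_n, v != 0 -> 0 < quad_form X v.

Definition abs_cont X Y : Prop :=
  forall v : 'cV[R[i]]_n, (Y : 'M[R[i]]_n) *m v = 0 -> (X : 'M[R[i]]_n) *m v = 0.

(* log (U^* diag(lambda) U) = U^* diag(log lambda) U; spectralmx X is unitary. *)
Definition logmx X : 'M[R[i]]_n :=
  invmx (spectralmx X)
  *m diag_mx (map_mx (fun z => (ln (complex.Re z))%:C%C) (spectral_diag X))
  *m spectralmx X.

(* tr (X log X - X log Y) is real for positive definite X and Y. *)
Definition qre_pd X Y : R :=
  complex.Re (\tr ((X : 'M[R[i]]_n) *m logmx X - (X : 'M[R[i]]_n) *m logmx Y)).

Fact idmx_hermitian : (1%:M : 'M[R[i]]_n) \in @hermitian_pred R n.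
Proof. by rewrite hermitian_predE trmx1 map_mx1. Qed.

Definition hermmx1 : H := HermMx idmx_hermitian.

(* D(X|Y), meaningful when X and Y are positive semidefinite with X << Y. *)
Definition qre X Y : R :=
  if `[< pd X /\ pd Y >] then qre_pd X Y
  else lim (qre_pd (X + eps *: hermmx1) (Y + eps *: hermmx1)
            @[eps --> (0 : R)^'+]).

Definition qre_epi : set (H * H * R^o) :=
  [set w | [/\ psd w.1.1, psd w.1.2, abs_cont w.1.1 w.1.2
             & qre w.1.1 w.1.2 <= w.2]].

Definition log_det X : \bar R := lne (complex.Re (\det (X : 'M[R[i]]_n)))%:E.

(* lne t = -oo for t <= 0, so - lne t = +oo there. *)
Definition qre_barrier (w : H * H * R^o) : \bar R :=
  if `[< pd w.1.1 /\ pd w.1.2 >] then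
    (- lne (w.2 - qre w.1.1 w.1.2)%:E - log_det w.1.1 - log_det w.1.2)%E
  else +oo%E.

End QuantumRelativeEntropy.

(* Main.v *)
Require Import Defs.
From HB Require Import structures.
From mathcomp Require Import all_boot all_order all_algebra.
From mathcomp Require Import complex.
From mathcomp Require Import all_classical all_reals all_analysis.
From mathcomp Require Import ring lra.

(** The barrier is the sum of the negative logarithm of the slack
    [z - D(X|Y)] and of the logarithmic barriers of the two cones. Two facts make
    it self-concordant.

    - The scalar identity [a (ln a - ln b) = int_0^1 a (a - b) / ((1-s) a + s b) ds]
      gives [D(X|Y) = int_0^1 Re tr (X B_s^-1 (X - Y)) ds] with
      [B_s Z = (1-s) X Z + s Z Y] ([qre_integral]). Since [s (X - Y) = X - B_s 1],
      each integrand is, up to a factor and a linear term, the matrix-fractional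
      function [tr (X B_s^-1 X)] of data that are affine along a line. Its
      expansion to third order is algebraic ([frac_expansion]): the coefficients
      of order two and three are [<u, B_s u>] and [- <u, B'_s u>] for one and the
      same matrix [u], where [B'_s] is built from the direction. If the direction
      has relative eigenvalues at most [c] in modulus, then the third derivative
      of [D] along it is at most [3 c] times the second ([qre_compatible]).
    - When [c ^ 2] is the sum of the squares of all relative eigenvalues of the
      direction, it is the second derivative of [- ln det X - ln det Y]. The
      inequality [|f'''| <= 2 f'' ^ (3/2)] for the whole barrier is then an
      inequality between a few real numbers ([compatible_cubic]).

    The function [D] is therefore convex; being homogeneous of degree one it is
    subadditive, and so [e |-> D(X + e 1|Y + e 1)] is nonincreasing. Hence a point
    belongs to the epigraph of [D] exactly when all its shifts by [e > 0] satisfy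
    the inequality for positive definite matrices ([qre_epiP]), and this
    identifies the epigraph with the closure of the domain ([closure_epi_int]).
    Closedness of the epigraph of the barrier follows from Klein's inequality,
    which bounds the slack near the boundary ([epigraph_barrier_closed]). The
    degree of homogeneity is read off from the formula ([barrier_re_scale]).

    For the lower bound on the parameter [nu] of any self-concordant barrier [g],
    two facts about slopes are used. If the segment of length [T] in a direction
    [h] stays in the domain, then [T Dg(x)[h] <= nu] ([gradient_le_parameter]). If
    [p] is a recession direction and the domain is left at distance at most [b] in
    the direction [- p], then [Dg(x)[p] <= - 1 / b] ([recession_gradient_le_inv]).
    Now [(1, 1, z)] is the sum of [(z - n L) (0, 0, 1)], of the [n] directions
    [(0, (1 - e^-L) E_i, 0)] and of the [n] recession directions
    [(E_i, e^-L E_i, L)]. The second fact applies to [(0, 0, 1)] with [b = z] and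
    to the others, without the factor [1 - e^-L], with [b = 1]; the first fact
    applies to [h = - (1, 1, z)] with [T < 1]. Together they give
    [nu >= T (1 - n L / z + n (1 - e^-L) + n)] ([optimality_estimate]).
    Letting [z], then [L] tend to infinity and [T] to one yields [2 n + 1]. *)

Set Implicit Arguments.
Unset Strict Implicit.
Unset Printing Implicit Defensive.
Import Order.TTheory GRing.Theory Num.Theory.
Import numFieldNormedType.Exports.
Local Open Scope classical_set_scope.
Local Open Scope ring_scope.

(** * Functions of class C^k *)

Section Lines.
Variables (R : realType) (E : normedModType R).
Implicit Types (g : E -> R^o) (x v : E).

Lemma line_quotient g x v (t : R) :
  (fun h : R => h^-1 *: ((g \o shift (x + t *: v)) (h *: v) - g (x + t *: v))) =
  (fun h : R => h^-1 *: (((fun u : R => g (x + u *: v) : R^o) \o shift t)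
      (h *: (1 : R^o)) - g (x + t *: v))).
Proof.
apply/funext => h /=; congr (_ *: (g _ - _)).
by rewrite /shift /= scalerDl [h *: 1]mulr1 addrCA.
Qed.

(** Directional derivatives are derivatives of restrictions to lines; the chain rule
    is only ever applied to functions of one variable. *)
Lemma is_derive_line g x v (t d : R) :
  is_derive (x + t *: v) v g d <->
  is_derive t 1 (fun u : R => g (x + u *: v) : R^o) d.
Proof.
have eqF := line_quotient g x v t.
split=> -[dg dgE]; split.
- by move: dg; rewrite /derivable eqF.
- by move: dgE; rewrite /derive eqF.
- by move: dg; rewrite /derivable -eqF.
- by move: dgE; rewrite /derive -eqF.
Qed.

Lemma continuous_line x v (t : R) :
  {for t, continuous (fun u : R => x + u *: v)}.
Proof.
by apply: cvgD; [exact: cvg_cst|apply: cvgZr_tmp; exact: cvg_id].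
Qed.

Lemma continuous_at_line g x v (t : R) :
  {for x + t *: v, continuous g} ->
  {for t, continuous (fun u : R => g (x + u *: v))}.
Proof. by move=> cg; apply: continuous_comp; [exact: continuous_line|exact: cg]. Qed.

End Lines.

Section CkClosure.
Variables (R : realType) (E : normedModType R) (A : set E).
Hypothesis oA : open A.
Implicit Types (f g : E -> R^o).

Lemma cd_cont k f x : continuously_derivable k A f -> A x -> {for x, continuous f}.
Proof. by case: k => [|k] [+ _]; apply. Qed.

Lemma cd_derivable k f x v :
  continuously_derivable k.+1 A f -> A x -> derivable f x v.
Proof. by move=> [_ /(_ v)[+ _]]; apply. Qed.

Lemma cd_derive k f v :
  continuously_derivable k.+1 A f -> continuously_derivable k A ('D_v f).
Proof. by move=> [_ /(_ v)[_ +]]. Qed.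

Lemma cd_eq k f g : (forall x, A x -> f x = g x) ->
  continuously_derivable k A f -> continuously_derivable k A g.
Proof.
elim: k f g => [|k IH] f g fg.
  move=> [cf _]; split=> // x Ax.
  change (g @ x --> g x); rewrite -(fg _ Ax).
  apply: cvg_trans (cf _ Ax); apply: near_eq_cvg.
  by near=> y; apply: fg; near: y; exact: open_nbhs_nbhs.
have nfg x : A x -> {near x, f =1 g}.
  move=> Ax; near=> y; apply: fg; near: y; exact: open_nbhs_nbhs.
move=> [cf df]; split=> [x Ax|v].
  change (g @ x --> g x); rewrite -(fg _ Ax).
  apply: cvg_trans (cf _ Ax); apply: near_eq_cvg.
  by near=> y; apply: fg; near: y; exact: open_nbhs_nbhs.
have [dfv cdf] := df v; split=> [x Ax|].
  exact: (near_eq_derivable (nfg _ Ax) (dfv _ Ax)).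
apply: IH cdf => x Ax; apply: near_eq_derive; exact: nfg.
Unshelve. all: by end_near. Qed.

Lemma cdW k f : continuously_derivable k.+1 A f -> continuously_derivable k A f.
Proof.
elim: k f => [|k IH] f [cf df]; split=> // v.
by have [dfv cdf] := df v; split=> //; exact: IH.
Qed.

Lemma cd_cst k (c : R) : continuously_derivable k A (fun=> c : R^o).
Proof.
elim: k c => [|k IH] c; (split; first by move=> x _; exact: cvg_cst) => // v.
split=> [x _|]; first exact: derivable_cst.
apply: cd_eq (IH 0) => x _; by rewrite derive_cst.
Qed.

Lemma cdD k f g : continuously_derivable k A f -> continuously_derivable k A g ->
  continuously_derivable k A (fun x => f x + g x).
Proof.
elim: k f g => [|k IH] f g cf cg;
  (split; first by move=> x Ax; apply: cvgD;
   [exact: cd_cont cf Ax|exact: cd_cont cg Ax]) => // v.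
split=> [x Ax|].
  by apply: derivableD; [exact: cd_derivable cf Ax|exact: cd_derivable cg Ax].
apply: cd_eq (IH _ _ (cd_derive v cf) (cd_derive v cg)) => x Ax.
by rewrite deriveD//; [exact: cd_derivable cf Ax|exact: cd_derivable cg Ax].
Qed.

Lemma cdM k f g : continuously_derivable k A f -> continuously_derivable k A g ->
  continuously_derivable k A (fun x => f x * g x).
Proof.
elim: k f g => [|k IH] f g cf cg;
  (split; first by move=> x Ax; apply: cvgM;
   [exact: cd_cont cf Ax|exact: cd_cont cg Ax]) => // v.
split=> [x Ax|].
  by apply: derivableM; [exact: cd_derivable cf Ax|exact: cd_derivable cg Ax].
have h1 := IH _ _ (cdW cf) (cd_derive v cg).
have h2 := IH _ _ (cdW cg) (cd_derive v cf).
apply: cd_eq (cdD h1 h2) => x Ax.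
by rewrite deriveM//; [exact: cd_derivable cf Ax|exact: cd_derivable cg Ax].
Qed.

Lemma cdN k f : continuously_derivable k A f ->
  continuously_derivable k A (fun x => - f x).
Proof.
move=> cf; apply: cd_eq (cdM (cd_cst k (-1)) cf) => x _.
by rewrite mulN1r.
Qed.

Lemma cdB k f g : continuously_derivable k A f -> continuously_derivable k A g ->
  continuously_derivable k A (fun x => f x - g x).
Proof. by move=> cf cg; apply: cdD => //; exact: cdN. Qed.

Lemma cdV k f : (forall x, A x -> f x != 0) -> continuously_derivable k A f ->
  continuously_derivable k A (fun x => (f x)^-1).
Proof.
move=> f0; elim: k => [|k IH] cf;
  (split; first by move=> x Ax; apply: cvgV; [exact: f0|exact: cd_cont cf Ax])
  => // v.
split=> [x Ax|].
  by apply: derivableV; [exact: f0|exact: cd_derivable cf Ax].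
have h := IH (cdW cf).
apply: cd_eq (cdN (cdM (cdM h h) (cd_derive v cf))) => x Ax.
rewrite deriveV ?f0//; last exact: cd_derivable cf Ax.
by rewrite [RHS]mulNr -exprVn expr2.
Qed.

Lemma cd_ln k f : (forall x, A x -> 0 < f x) -> continuously_derivable k A f ->
  continuously_derivable k A (fun x => ln (f x)).
Proof.
move=> f0 cf; case: k cf => [|k] cf.
  split=> // x Ax; apply: continuous_comp; first exact: cd_cont cf Ax.
  exact/continuous_ln/f0.
have der x v : A x -> is_derive x v (fun x => ln (f x) : R^o) ((f x)^-1 * 'D_v f x).
  move=> Ax; rewrite -{1}[x]addr0 -(scale0r v); apply/is_derive_line.
  have := @is_derive1_comp R (@ln R) (fun u => f (x + u *: v)) 0.
  rewrite /= scale0r addr0; apply; first exact/is_derive1_ln/f0.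
  apply/(is_derive_line f x v 0); rewrite scale0r addr0.
  by apply: DeriveDef; [exact: cd_derivable cf Ax|reflexivity].
split=> [x Ax|v].
  apply: continuous_comp; first exact: cd_cont cf Ax.
  exact/continuous_ln/f0.
split=> [x Ax|]; first by have [] := der x v Ax.
have fn0 x : A x -> f x != 0 by move=> /f0 /lt0r_neq0.
apply: cd_eq (cdM (cdV fn0 (cdW cf)) (cd_derive v cf)) => x Ax.
by have [_ ->] := der x v Ax.
Qed.

Lemma cd_linear k f : continuous f -> (forall x y (a : R), f (a *: x + y) = a * f x + f y) ->
  continuously_derivable k A f.
Proof.
move=> cf lf.
have f0 : f 0 = 0 by apply: (addIr (f 0)); rewrite add0r -{1}(mul1r (f 0)) -lf scaler0 addr0.
have der x v : is_derive x v f (f v).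
  rewrite -{1}[x]addr0 -(scale0r v); apply/is_derive_line.
  have -> : (fun u : R => f (x + u *: v) : R^o) = (fun u => f x + (f v *: u)).
    by apply/funext => u; rewrite addrC lf addrC [f v *: u]mulrC.
  have dZ := is_deriveZ (f v) (is_derive_id (0 : R^o) (1 : R^o)).
  have := is_deriveD (is_derive_cst (f x : R^o) (0 : R^o) (1 : R^o)) dZ.
  by rewrite add0r [f v *: 1]mulr1.
case: k => [|k]; (split; first by move=> x _; exact: cf) => // v.
split=> [x _|]; first by have [] := der x v.
apply: cd_eq (cd_cst k (f v)) => x _; by have [_ ->] := der x v.
Qed.

End CkClosure.

Lemma cd_comp_linear (R : realType) (E F : normedModType R) (A : set F) (B : set E)
    (L : E -> F) k (g : F -> R^o) :
  open A -> open B -> continuous L ->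
  (forall x y (a : R), L (a *: x + y) = a *: L x + L y) ->
  (forall x, B x -> A (L x)) ->
  continuously_derivable k A g -> continuously_derivable k B (fun x => g (L x)).
Proof.
move=> oA oB cL lL BA; elim: k g => [|k IH] g cg;
  (split; first by move=> x Bx; apply: continuous_comp;
   [exact: cL|apply: (cd_cont cg); exact: BA]) => // v.
have der x : B x -> is_derive x v (fun x => g (L x)) ('D_(L v) g (L x)).
  move=> Bx; rewrite -{1}[x]addr0 -(scale0r v); apply/is_derive_line.
  have -> : (fun u : R => g (L (x + u *: v))) = (fun u => g (L x + u *: L v)).
    by apply/funext => u; rewrite addrC lL addrC.
  apply/(is_derive_line g (L x) (L v) 0); rewrite scale0r addr0.
  by apply: DeriveDef; [exact: (@cd_derivable _ _ A k g _ (L v) cg (BA _ Bx))|reflexivity].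
split=> [x Bx|]; first by have [] := der x Bx.
apply: cd_eq (IH _ (cd_derive (L v) cg)) => // x Bx.
by have [_ ->] := der x Bx.
Qed.

(** * Integrals over the unit interval depending on a parameter *)

Section UnitIntegral.
Variable R : realType.
Implicit Types h k : R -> R.

Definition unit_int h : R :=
  Rintegral (@lebesgue_measure R) `[0, 1]%classic h.

(** Two-sided continuity, also at the end points: the functions of interest extend
    beyond the interval, and this form composes without subspace topologies. *)
Definition continuous01 h :=
  forall s : R, 0 <= s <= 1 -> h u @[u --> s] --> h s.

Lemma continuous01_within h : continuous01 h -> {within `[0, 1], continuous h}.
Proof.
move=> ch; apply: continuous_in_subspaceT => s.
by rewrite inE /= in_itv /=; exact: ch.
Qed.

Lemma continuous01_integrable h : continuous01 h ->
  (@lebesgue_measure R).-integrable `[0, 1]%classic (EFin \o h).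
Proof.
move=> /continuous01_within ch.
by apply: continuous_compact_integrable => //; exact: segment_compact.
Qed.

Lemma eq_unit_int h k : (forall s, 0 <= s <= 1 -> h s = k s) ->
  unit_int h = unit_int k.
Proof.
by move=> hk; apply: eq_Rintegral => s; rewrite inE /= in_itv /=; exact: hk.
Qed.

Lemma unit_intB h k : continuous01 h -> continuous01 k ->
  unit_int (fun s => h s - k s) = unit_int h - unit_int k.
Proof.
by move=> ch ck; apply: RintegralB => //; exact: continuous01_integrable.
Qed.

Lemma unit_intD h k : continuous01 h -> continuous01 k ->
  unit_int (fun s => h s + k s) = unit_int h + unit_int k.
Proof.
by move=> ch ck; apply: RintegralD => //; exact: continuous01_integrable.
Qed.

Lemma unit_intZ (c : R) h : continuous01 h ->
  unit_int (fun s => c * h s) = c * unit_int h.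
Proof. by move=> ch; apply: RintegralZl => //; exact: continuous01_integrable. Qed.

Lemma continuous01D h k : continuous01 h -> continuous01 k ->
  continuous01 (fun s => h s + k s).
Proof. by move=> ch ck s s01; apply: cvgD; [exact: ch|exact: ck]. Qed.

Lemma continuous01B h k : continuous01 h -> continuous01 k ->
  continuous01 (fun s => h s - k s).
Proof. by move=> ch ck s s01; apply: cvgB; [exact: ch|exact: ck]. Qed.

Lemma continuous01Z (c : R) h : continuous01 h -> continuous01 (fun s => c * h s).
Proof. by move=> ch s s01; apply: cvgMr; exact: ch. Qed.

Lemma continuous01_cst (c : R) : continuous01 (fun=> c).
Proof. by move=> s _; exact: cvg_cst. Qed.

Lemma continuous01_sum (I : Type) (r : seq I) (F : I -> R -> R) :
  (forall i, continuous01 (F i)) -> continuous01 (fun s => \sum_(i <- r) F i s).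
Proof.
move=> cF; elim: r => [|i r IH].
  by under [X in continuous01 X]eq_fun do rewrite big_nil; exact: continuous01_cst.
by under [X in continuous01 X]eq_fun do rewrite big_cons; exact: continuous01D.
Qed.

Lemma unit_int_cst (c : R) : unit_int (fun=> c) = c.
Proof.
by rewrite /unit_int Rintegral_cst//= lebesgue_measure_itv/= lte_fin ltr01 oppr0 adde0 mulr1.
Qed.

Lemma unit_int_sum (I : Type) (r : seq I) (F : I -> R -> R) :
  (forall i, continuous01 (F i)) ->
  unit_int (fun s => \sum_(i <- r) F i s) = \sum_(i <- r) unit_int (F i).
Proof.
move=> cF; elim: r => [|i r IH].
  rewrite big_nil -[RHS](unit_int_cst 0).
  by apply: eq_unit_int => s _; rewrite big_nil.
rewrite big_cons -IH -unit_intD//; last exact: continuous01_sum.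
by apply: eq_unit_int => s _; rewrite big_cons.
Qed.

Lemma le_unit_int h k : continuous01 h -> continuous01 k ->
  (forall s, 0 <= s <= 1 -> h s <= k s) -> unit_int h <= unit_int k.
Proof.
by move=> ch ck hk; apply: le_Rintegral => //; exact: continuous01_integrable.
Qed.

Lemma unit_int_norm_le (c : R) h : continuous01 h ->
  (forall s, 0 <= s <= 1 -> `|h s| <= c) -> `|unit_int h| <= c.
Proof.
move=> ch hc; rewrite ler_norml -{1}(unit_int_cst c) -[- unit_int _]mulN1r.
rewrite -unit_intZ; last exact: continuous01_cst.
apply/andP; split.
  apply: le_unit_int => //; first by apply: continuous01Z; exact: continuous01_cst.
  by move=> s /hc; rewrite ler_norml mulN1r => /andP[].
rewrite -[leRHS](unit_int_cst c); apply: le_unit_int => //.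
  exact: continuous01_cst.
by move=> s /hc; rewrite ler_norml => /andP[].
Qed.

Lemma unit_int_FTC h (F : R -> R) : continuous01 h ->
  (forall s : R, 0 <= s <= 1 -> is_derive s 1 (F : R -> R^o) (h s)) ->
  unit_int h = F 1 - F 0.
Proof.
move=> ch dF; rewrite /unit_int /Rintegral.
have cF (s : R) : 0 <= s <= 1 -> F u @[u --> s] --> F s.
  move=> s01; apply: differentiable_continuous.
  by apply/derivable1_diffP; have [] := dF s s01.
rewrite (@continuous_FTC2 R h F 0 1)//.
- exact: continuous01_within.
- split.
  + move=> s /[!in_itv]/= /andP[s0 s1].
    by apply: (@ex_derive _ _ _ _ _ _ _ (dF s _)); rewrite !ltW.
  + by apply: cvg_at_right_filter; apply: cF; rewrite lexx ler01.
  + by apply: cvg_at_left_filter; apply: cF; rewrite lexx ler01.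
- move=> s /[!in_itv]/= /andP[s0 s1]; rewrite derive1E.
  by apply: (@derive_val _ _ _ _ _ _ _ (dF s _)); rewrite !ltW.
Qed.

End UnitIntegral.

Lemma continuous_at_pair (T U V : topologicalType) (f : T -> U) (g : T -> V)
    (x : T) :
  {for x, continuous f} -> {for x, continuous g} ->
  {for x, continuous (fun y => (f y, g y) : (U * V)%type)}.
Proof. by move=> cf cg P HP; exact: (cvg_pair cf cg HP). Qed.

Lemma MVT_closed (R : realType) (f df : R -> R) (a b : R) : a < b ->
  (forall t, a <= t <= b -> is_derive t 1 (f : R -> R^o) (df t)) ->
  exists2 t, a < t < b & f b - f a = df t * (b - a).
Proof.
move=> ab dF; have [||t] := @MVT R f df _ _ ab.
- by move=> t; rewrite in_itv /= => /andP[/ltW at_ /ltW tb]; apply: dF; rewrite at_ tb.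
- apply: continuous_in_subspaceT => t; rewrite inE /= in_itv /= => tab.
  apply: differentiable_continuous; apply/derivable1_diffP.
  by have [] := dF t tab.
- by rewrite in_itv /= => tab ->; exists t.
Qed.

Lemma MVT_between (R : realType) (f df : R -> R) (a b : R) :
  (forall t, Order.min a b <= t <= Order.max a b ->
     is_derive t 1 (f : R -> R^o) (df t)) ->
  exists2 t, Order.min a b <= t <= Order.max a b & f b - f a = df t * (b - a).
Proof.
case: (ltgtP a b) => [ab|ba|->] dF.
- by have [t /andP[t1 t2] e] := MVT_closed ab dF; exists t; rewrite ?(ltW t1) ?(ltW t2).
- have [t /andP[t1 t2] e] := MVT_closed ba dF; exists t; first by rewrite (ltW t1) (ltW t2).
  by rewrite -opprB e -mulrN opprB.
- by exists b; rewrite ?lexx// !subrr mulr0.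
Qed.

(** The integrand lives on an open set [B] that contains [0, 1] x [A], so that it
    has full neighbourhoods at the end points of the interval. *)
Section ParameterIntegral.
Variables (R : realType) (E : normedModType R) (A : set E)
  (B : set (R^o * E)%type).
Hypotheses (oA : open A) (oB : open B)
  (AB : forall (s : R) x, 0 <= s <= 1 -> A x -> B (s, x)).
Implicit Types G : (R^o * E)%type -> R^o.

Lemma slice_continuous01 G x : (forall w, B w -> {for w, continuous G}) -> A x ->
  continuous01 (fun s => G (s, x)).
Proof.
move=> cG Ax s s01.
apply: (@continuous_comp _ _ _ (fun u : R^o => (u, x) : (R^o * E)%type) G).
  by apply: continuous_at_pair; [exact: cvg_id|exact: cvg_cst].
by apply: cG; exact: AB.
Qed.

(** By compactness of the interval, continuity on [B] is continuity in the parameter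
    that is uniform in [s]. *)
Lemma slice_unif_continuous G x (e : R) :
  (forall w, B w -> {for w, continuous G}) -> A x -> 0 < e ->
  \forall y \near x, forall s : R, 0 <= s <= 1 -> `|G (s, y) - G (s, x)| < e.
Proof.
move=> cG Ax e0.
have e20 : 0 < e / 2 by rewrite divr_gt0.
have := (@segment_compact R 0 1); rewrite compact_near_coveringP.
move=> /(_ E (nbhs x) (fun y s => `|G (s, y) - G (s, x)| < e)) nc.
have {}nc : \forall y \near x, `[0, 1]%classic `<=`
    (fun s : R => `|G (s, y) - G (s, x)| < e).
  apply: nc => s; rewrite /= in_itv /= => s01.
  have /cvgrPdist_lt /(_ _ e20) h1 := cG _ (AB s01 Ax).
  have /cvgrPdist_lt /(_ _ e20) h2 := slice_continuous01 cG Ax s01.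
  have h2' : filter_prod (nbhs s) (nbhs x)
      [set p | `|G (s, x) - G (p.1, x)| < e / 2].
    exists ([set u | `|G (s, x) - G (u, x)| < e / 2], setT).
      by split=> //; exact: filterT.
    by move=> [u y] /= [].
  have h1' : filter_prod (nbhs s) (nbhs x)
      [set p | `|G (s, x) - G p| < e / 2] := h1.
  apply: filterS2 h1' h2' => -[u y] /= Gy Gx.
  rewrite (le_lt_trans (ler_distD (G (s, x)) _ _))// [e]splitr ltrD//.
  by rewrite distrC.
by apply: filterS nc => y Py s s01; apply: (Py s); rewrite /= in_itv.
Qed.

Lemma continuous_unit_int G x : (forall w, B w -> {for w, continuous G}) -> A x ->
  {for x, continuous (fun y => unit_int (fun s => G (s, y)) : R^o)}.
Proof.
move=> cG Ax; apply/cvgrPdist_le => /= e e0.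
have := slice_unif_continuous cG Ax e0.
have nA : \forall y \near x, A y by exact: open_nbhs_nbhs.
apply: filterS2 nA => y Ay Gy.
rewrite distrC -unit_intB; try exact: slice_continuous01.
apply: unit_int_norm_le => [|s s01]; last exact/ltW/Gy.
by apply: continuous01B; exact: slice_continuous01.
Qed.

(** Differentiation under the integral: by the mean value theorem the difference
    quotient at [s] is a value of the derivative at a nearby parameter, uniformly
    close to the derivative at [x]. *)
Lemma derive_unit_int k G x v : continuously_derivable k.+1 B G -> A x ->
  is_derive x v (fun y => unit_int (fun s => G (s, y)) : R^o)
    (unit_int (fun s => 'D_((0, v) : (R^o * E)%type) G (s, x))).
Proof.
move=> cG Ax; pose v' := (0, v) : (R^o * E)%type.
pose G' := 'D_v' G; pose I := fun y : E => unit_int (fun s => G (s, y)) : R^o.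
have cG0 w : B w -> {for w, continuous G} by exact: cd_cont cG.
have cG1 w : B w -> {for w, continuous G'}.
  exact: cd_cont (cd_derive _ cG).
suff lim : h^-1 *: ((I \o shift x) (h *: v) - I x) @[h --> (0 : R)^'] -->
    (unit_int (fun s => G' (s, x)) : R^o).
  by split; [apply/cvg_ex; eexists; exact: lim|exact: cvg_lim lim].
apply/cvgrPdist_le => /= e e0.
have unif := slice_unif_continuous cG1 Ax e0.
have nA : \forall y \near x, A y by exact: open_nbhs_nbhs.
have := @continuous_line R E x v 0; rewrite /prop_for /continuous_at scale0r addr0.
move=> /(_ _ (filterI nA unif)) [d /= d0 dH].
exists d => //= h /= hd h0.
have hA (t : R) : Order.min 0 h <= t <= Order.max 0 h -> A (x + t *: v) /\
    forall s : R, 0 <= s <= 1 -> `|G' (s, x + t *: v) - G' (s, x)| < e.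
  move=> t0h; apply: (dH t); rewrite /ball_ /= sub0r normrN.
  move: hd t0h; rewrite /ball_ /= sub0r normrN.
  case: (ltrP 0 h) => h0' hd /andP[t1 t2].
    by rewrite ger0_norm// (le_lt_trans t2)// -(gtr0_norm h0').
  by rewrite ler0_norm// (le_lt_trans _ hd)// ler0_norm// lerN2.
have Axh : A (x + h *: v) by apply: (hA h _).1; rewrite ge_min le_max !lexx !orbT.
rewrite (addrC (h *: v)) -unit_intB; try exact: slice_continuous01.
rewrite [_ *: _]mulrC -[_ * h^-1]mulrC -unit_intZ; last first.
  by apply: continuous01B; exact: slice_continuous01.
rewrite -unit_intB.
- apply: unit_int_norm_le => [|s s01].
    apply: continuous01B; first exact: slice_continuous01.
    by apply: continuous01Z; apply: continuous01B; exact: slice_continuous01.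
  have [t t0h] : exists2 t, Order.min 0 h <= t <= Order.max 0 h &
      G (s, x + h *: v) - G (s, x) = G' (s, x + t *: v) * (h - 0).
    have dG t : Order.min 0 h <= t <= Order.max 0 h ->
        is_derive t 1 (fun t : R => G (s, x + t *: v) : R^o) (G' (s, x + t *: v)).
      move=> /hA[At _].
      have lineE u : (s, x + u *: v) = ((s, x) + u *: v' : (R^o * E)%type).
        by congr pair; rewrite /= [u *: 0]mulr0 addr0.
      have -> : (fun t : R => G (s, x + t *: v) : R^o) =
                (fun t => G (((s, x) : (R^o * E)%type) + t *: v')).
        by apply/funext => u; rewrite lineE.
      apply/(is_derive_line G (s, x) v' t); rewrite -lineE.
      apply: DeriveDef; last reflexivity.
      exact: (@cd_derivable _ _ B k G _ v' cG (AB s01 At)).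
    have := MVT_between dG.
    by rewrite scale0r addr0.
  rewrite subr0 => ->; rewrite mulrCA mulVf// mulr1 distrC; apply/ltW.
  exact: (hA t t0h).2.
- exact: slice_continuous01.
- by apply: continuous01Z; apply: continuous01B; exact: slice_continuous01.
Qed.

Lemma cd_unit_int k G : continuously_derivable k B G ->
  continuously_derivable k A (fun y => unit_int (fun s => G (s, y)) : R^o).
Proof.
elim: k G => [|k IH] G cG; (split; first by move=> x Ax;
  apply: continuous_unit_int => // w; exact: cd_cont cG) => // v.
split=> [x Ax|]; first by have [] := derive_unit_int v cG Ax.
apply: cd_eq (IH _ (cd_derive (0, v) cG)) => // x Ax.
by have [_ ->] := derive_unit_int v cG Ax.
Qed.

End ParameterIntegral.

Lemma unit_int_compatible (R : realType) (g2 g3 : R -> R) (c : R) :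
  continuous01 g2 -> continuous01 g3 ->
  (forall s, 0 <= s <= 1 -> 0 <= g2 s /\ `|g3 s| <= c * g2 s) ->
  0 <= unit_int g2 /\ `|unit_int g3| <= c * unit_int g2.
Proof.
move=> c2 c3 key; split.
  rewrite -[leLHS](unit_int_cst (0 : R)); apply: le_unit_int => //.
    exact: continuous01_cst.
  by move=> s /key[].
rewrite ler_norml -mulNr -!unit_intZ//.
apply/andP; split; apply: le_unit_int => //; try exact: continuous01Z.
  by move=> s /key[_]; rewrite ler_norml -mulNr => /andP[].
by move=> s /key[_]; rewrite ler_norml => /andP[].
Qed.

(** * Derivatives of a barrier along lines *)

Section LineDerivatives.
Variables (R : realType) (E : normedModType R) (A : set E).
Hypothesis oA : open A.
Implicit Types F : E -> R^o.

Definition iter_derive k (h : E) F : E -> R^o := iter k (fun G => 'D_h G) F.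

Lemma derive_line F x h (t : R) :
  'D_1 (fun u : R => F (x + u *: h) : R^o) t = 'D_h F (x + t *: h).
Proof.
by rewrite /derive -line_quotient.
Qed.

Lemma near_line x h (t : R) : A (x + t *: h) ->
  \forall u \near t, A (x + u *: h).
Proof.
move=> At; exact: (@continuous_line R E x h t _ (open_nbhs_nbhs (conj oA At))).
Qed.

Lemma derive1n_line k F x h (t : R) : A (x + t *: h) ->
  derive1n k (fun u : R => F (x + u *: h) : R^o) t = iter_derive k h F (x + t *: h).
Proof.
elim: k t => [//|k IH] t At.
rewrite derive1nS derive1E /iter_derive iterS -derive_line.
apply: near_eq_derive; have := near_line At; apply: filterS => u Au.
exact: IH.
Qed.

Lemma cd_iter_derive k j h F : continuously_derivable (k + j) A F ->
  continuously_derivable j A (iter_derive k h F).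
Proof.
elim: k j F => [//|k IH] j F; rewrite addSnnS => /IH cF.
by rewrite /iter_derive iterS; exact: cd_derive.
Qed.

Lemma is_derive_iter_line k j h F x (t : R) :
  continuously_derivable k A F -> (j < k)%N -> A (x + t *: h) ->
  is_derive t 1 (fun u : R => iter_derive j h F (x + u *: h) : R^o)
    (iter_derive j.+1 h F (x + t *: h)).
Proof.
move=> cF jk At; apply/(is_derive_line (iter_derive j h F) x h t).
apply: DeriveDef; last by rewrite /iter_derive iterS.
have : continuously_derivable (j + (k - j.+1).+1) A F by rewrite addnS -addSn subnKC.
by move=> /cd_iter_derive => /(_ h)/cd_derivable; exact.
Qed.

Lemma deriveZ_direction F x h (c : R) : derivable F x h ->
  is_derive x (c *: h) F (c * 'D_h F x).
Proof.
move=> dF.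
have dFl : is_derive (0 : R) 1 (fun u : R => F (x + u *: h) : R^o) ('D_h F x).
  apply/(is_derive_line F x h 0); rewrite scale0r addr0.
  by apply: DeriveDef.
have dl : is_derive (0 : R) 1 (fun u : R => u * c : R^o) c.
  have := is_deriveZ c (is_derive_id (0 : R^o) (1 : R^o)).
  rewrite [c *: 1]mulr1; congr (is_derive _ _ _ _); apply/funext => u.
  by rewrite /= [_ *: _]mulrC.
rewrite -[x in is_derive x]addr0 -(scale0r (c *: h)).
apply/(is_derive_line F x (c *: h) 0).
have -> : (fun u : R => F (x + u *: (c *: h)) : R^o) =
    (fun u : R => F (x + u *: h) : R^o) \o (fun u : R => u * c).
  by apply/funext => u /=; rewrite scalerA.
rewrite mulrC; apply: is_derive1_comp => //.
by rewrite mul0r.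
Qed.

Lemma iter_derive2Z F x h (c : R) : continuously_derivable 2 A F -> A x ->
  iter_derive 2 (c *: h) F x = c ^+ 2 * iter_derive 2 h F x.
Proof.
move=> cF Ax; rewrite /iter_derive /=.
have -> : 'D_(c *: h) ('D_(c *: h) F) x = 'D_(c *: h) (c \*: 'D_h F) x.
  apply: near_eq_derive; have : nbhs x A by exact: open_nbhs_nbhs.
  apply: filterS => y Ay /=; have [_ ->] := deriveZ_direction c (@cd_derivable _ _ A _ F _ h cF Ay).
  by [].
have dd : derivable ('D_h F) x h.
  exact: (@cd_derivable _ _ A 0 ('D_h F) x h (cd_derive h cF) Ax).
rewrite deriveZ; last by have [] := deriveZ_direction c dd.
have [_ ->] := deriveZ_direction c dd.
by rewrite [LHS]mulrA -expr2.
Qed.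

(** The increment along [h + k] is the increment along [h] followed by one along [k]
    from a displaced point; the mean value theorem and the continuity of the
    derivative along [k] absorb the displacement. *)
Lemma derive_additive F x h k : continuously_derivable 1 A F -> A x ->
  'D_(h + k) F x = 'D_h F x + 'D_k F x.
Proof.
move=> cF Ax.
suff lim : u^-1 *: ((F \o shift x) (u *: (h + k)) - F x) @[u --> (0 : R)^'] -->
    ('D_h F x + 'D_k F x : R^o) by exact: cvg_lim lim.
have -> : (fun u : R => u^-1 *: ((F \o shift x) (u *: (h + k)) - F x)) =
  (fun u => u^-1 *: ((F \o shift x) (u *: h) - F x) +
            u^-1 *: (F (x + u *: h + u *: k) - F (x + u *: h))).
  apply/funext => u; rewrite -scalerDr /=; congr (_ *: _).
  by rewrite /shift /= !(addrC _ x) scalerDr addrA [RHS]addrC addrA subrK.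
apply: cvgD; first exact: (@cd_derivable _ _ A _ F _ h cF Ax).
apply/cvgrPdist_le => /= e e0.
have cD := @cd_cont _ _ A 0 ('D_k F) x (cd_derive k cF) Ax.
have /cvgrPdist_le /(_ e e0) unif := cD.
have nA : \forall y \near x, A y by exact: open_nbhs_nbhs.
have cl : continuous (fun p : (R^o * R^o)%type => x + p.1 *: h + p.2 *: k).
  move=> p; apply: cvgD; first apply: cvgD; first exact: cvg_cst.
    by apply: cvgZr_tmp; exact: cvg_fst.
  by apply: cvgZr_tmp; exact: cvg_snd.
have := cl (0, 0); rewrite /continuous_at /= !scale0r !addr0.
move=> /(_ _ (filterI nA unif)) [[/= P1 P2]]/= [[d1 /= d10 dP1] [d2 /= d20 dP2]] dH.
exists (Num.min d1 d2); first by rewrite /= lt_min d10.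
move=> u /=; rewrite sub0r normrN lt_min => /andP[ud1 ud2] u0.
have hA (t : R) : Order.min 0 u <= t <= Order.max 0 u ->
    A (x + u *: h + t *: k) /\ `|'D_k F x - 'D_k F (x + u *: h + t *: k)| <= e.
  move=> t0u; apply: (dH (u, t)); split => /=.
    by apply: dP1; rewrite /ball_ /= sub0r normrN.
  apply: dP2; rewrite /ball_ /= sub0r normrN; apply: le_lt_trans ud2.
  move: t0u; case: (ltrP 0 u) => u0' /andP[t1 t2].
    by rewrite ger0_norm// gtr0_norm.
  by rewrite ler0_norm// ler0_norm// lerN2.
have dFt t : Order.min 0 u <= t <= Order.max 0 u ->
    is_derive t 1 (fun t : R => F (x + u *: h + t *: k) : R^o)
      ('D_k F (x + u *: h + t *: k)).
  move=> /hA[At _]; apply/(is_derive_line F (x + u *: h) k t).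
  apply: DeriveDef; last reflexivity.
  exact: (@cd_derivable _ _ A 0 F _ k cF At).
have [t t0u] := MVT_between dFt.
rewrite scale0r addr0 => ->; rewrite subr0 [_ *: _]mulrCA mulVf// mulr1.
exact: (hA t t0u).2.
Qed.

Lemma iter_derive1Z F x h (c : R) : continuously_derivable 1 A F -> A x ->
  iter_derive 1 (c *: h) F x = c * iter_derive 1 h F x.
Proof.
move=> cF Ax; rewrite /iter_derive /=.
by have [_ ->] := deriveZ_direction c (@cd_derivable _ _ A _ F _ h cF Ax).
Qed.

Lemma iter_derive1D F x h k : continuously_derivable 1 A F -> A x ->
  iter_derive 1 (h + k) F x = iter_derive 1 h F x + iter_derive 1 k F x.
Proof. exact: derive_additive. Qed.

End LineDerivatives.

Lemma iter_derive_eq (R : realType) (E : normedModType R) (A : set E) k (F G : E -> R^o) h x :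
  open A -> (forall y, A y -> F y = G y) -> A x -> iter_derive k h F x = iter_derive k h G x.
Proof.
move=> oA; elim: k x => [|k IH] x FG Ax; first exact: FG.
rewrite /iter_derive !iterS; apply: near_eq_derive.
have : nbhs x A by exact: open_nbhs_nbhs.
by apply: filterS => y Ay; exact: IH.
Qed.

Lemma iter_derive_unit_int (R : realType) (E : normedModType R) (A : set E)
    (B : set (R^o * E)%type) k (G : (R^o * E)%type -> R^o) x h :
  open A -> open B -> (forall (s : R) y, 0 <= s <= 1 -> A y -> B (s, y)) ->
  continuously_derivable k B G -> A x ->
  iter_derive k h (fun y => unit_int (fun s => G (s, y)) : R^o) x =
  unit_int (fun s => iter_derive k ((0, h) : (R^o * E)%type) G (s, x)).
Proof.
move=> oA oB AB; elim: k x => [//|k IH] x cG Ax.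
rewrite /iter_derive iterS.
have -> : 'D_h (iter k (fun G => 'D_h G) (fun y => unit_int (fun s => G (s, y)))) x =
  'D_h (fun y => unit_int (fun s => iter_derive k ((0, h) : (R^o * E)%type) G (s, y)) : R^o) x.
  apply: near_eq_derive; have : nbhs x A by exact: open_nbhs_nbhs.
  by apply: filterS => y Ay; apply: IH => //; exact: cdW.
have cG' : continuously_derivable 1 B (iter_derive k ((0, h) : (R^o * E)%type) G).
  by apply: (@cd_iter_derive _ _ _ k 1); rewrite addn1.
by have [_ ->] := derive_unit_int oA AB h cG' Ax.
Qed.

(** Iterated derivatives along a line are found by exhibiting functions of one
    variable, each the derivative of the previous one. *)
Lemma iter_derive_of_chain (R : realType) (E : normedModType R) (F : E -> R^o) x h
    (f : nat -> R -> R) (d : R) m :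
  0 < d ->
  (forall t : R, `|t| < d -> F (x + t *: h) = f 0%N t) ->
  (forall j (t : R), (j < m)%N -> `|t| < d -> is_derive t 1 (f j : R -> R^o) (f j.+1 t)) ->
  forall j, (j <= m)%N -> iter_derive j h F x = f j 0.
Proof.
move=> d0 Ff df j jm.
suff : forall t : R, `|t| < d -> iter_derive j h F (x + t *: h) = f j t.
  by move=> /(_ 0); rewrite normr0 scale0r addr0; exact.
elim: j jm => [_ t td|j IH jm t td]; first exact: Ff.
rewrite /iter_derive iterS -derive_line.
have [_ <-] := df j t jm td.
apply: near_eq_derive.
have td' : 0 < d - `|t| by rewrite subr_gt0.
exists (d - `|t|) => //= u /=; rewrite distrC => ut.
apply: IH; first exact: ltnW.
rewrite -[u](subrK t); apply: le_lt_trans (ler_normD _ _) _.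
by rewrite -ltrBrDr.
Qed.

Lemma Dk_line (R : realType) (E : normedModType R) (f : E -> \bar R) k x h :
  open (dom f) -> dom f x -> Dk k f x h = iter_derive k h (fun x => fine (f x) : R^o) x.
Proof.
move=> oA Ax; have A0 : dom f (x + 0 *: h) by rewrite scale0r addr0.
have := @derive1n_line R E (dom f) oA k (fun x => fine (f x)) x h 0 A0.
by rewrite scale0r addr0.
Qed.

#[local] Opaque iter_derive.

(** * Barriers along recession directions *)

Lemma nondecreasing_MVT (R : realType) (f df : R -> R) (a b : R) :
  a <= b -> (forall t, a <= t <= b -> is_derive t 1 (f : R -> R^o) (df t)) ->
  (forall t, a <= t <= b -> 0 <= df t) -> f a <= f b.
Proof.
move=> ab df_ df0; have [|t] := @MVT_between R f df a b.
  by move=> t; rewrite minEle maxEle ab; exact: df_.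
rewrite minEle maxEle ab => tab fab.
by rewrite -subr_ge0 fab mulr_ge0 ?df0// subr_ge0.
Qed.

(** The self-concordance inequality says that [p ^ (-1/2)], for [p] the second
    derivative along a line, has slope at most one; [e] keeps the reciprocal defined
    where [p] vanishes. *)
Lemma inv_sqrt_lipschitz (R : realType) (p dp : R -> R) (e a b : R) :
  0 < e -> a <= b ->
  (forall t, a <= t <= b -> is_derive t 1 (p : R -> R^o) (dp t)) ->
  (forall t, a <= t <= b -> 0 <= p t) ->
  (forall t, a <= t <= b -> `|dp t| <= 2 * (p t) `^ (3 / 2)) ->
  (Num.sqrt (p b + e))^-1 - (b - a) <= (Num.sqrt (p a + e))^-1.
Proof.
move=> e0 ab ddp p0 pSC.
pose s t := Num.sqrt (p t + e).
pose f t := (s t)^-1 - t.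
pose df t := - (s t ^- 2 * ((2 * s t)^-1 * dp t)) - 1.
have s0 t : a <= t <= b -> 0 < s t.
  by move=> /p0 pt; rewrite sqrtr_gt0 ltr_wpDl.
have dft t : a <= t <= b -> is_derive t 1 (f : R -> R^o) (df t).
  move=> tab; rewrite /f /df.
  have d1 : is_derive t 1 (fun t => p t + e : R^o) (dp t).
    rewrite -[dp t]addr0.
    exact: (is_deriveD (ddp t tab) (is_derive_cst (e : R^o) (t : R^o) (1 : R^o))).
  have d2 : is_derive t 1 (s : R -> R^o) ((2 * s t)^-1 * dp t).
    have pe0 : 0 < p t + e by rewrite ltr_wpDl// p0.
    exact: (@is_derive1_comp R Num.sqrt (fun t => p t + e) t _ _ (is_derive1_sqrt pe0) d1).
  have d3 := @is_deriveV R s t _ 1 (lt0r_neq0 (s0 t tab)) d2.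
  have d4 := is_deriveB d3 (is_derive_id (t : R^o) (1 : R^o)).
  by move: d4; rewrite [_ *: _]mulNr.
suff : - f a <= - f b by rewrite /f; lra.
apply: (@nondecreasing_MVT R (fun t => - f t) (fun t => - df t)) => // t tab.
  exact: (is_deriveN (dft t tab)).
rewrite oppr_ge0 /df subr_le0 lerNl.
have st := s0 t tab; have pt := p0 t tab.
have h : `|dp t| <= 2 * s t ^+ 3.
  apply: le_trans (pSC t tab) _; rewrite ler_pM2l//.
  have -> : s t ^+ 3 = (p t + e) `^ (3 / 2).
    rewrite mulrC powRrM powR12_sqrt; last by rewrite addr_ge0// ltW.
    by rewrite -/(s t) -[3]/(3%:R) powR_mulrn// ltW.
  apply: ge0_ler_powR; rewrite ?nnegrE ?divr_ge0//; first by rewrite addr_ge0// ltW.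
  by rewrite lerDl ltW.
have : `|s t ^- 2 * ((2 * s t)^-1 * dp t)| <= 1.
  rewrite !normrM !normfV !normrX (ger0_norm (ltW st)) normrM normr_nat (ger0_norm (ltW st)).
  rewrite mulrA -invfM ler_pdivrMl ?mulr1; last by rewrite !mulr_gt0// exprn_gt0.
  by apply: le_trans h _; rewrite le_eqVlt; apply/orP; left; apply/eqP; ring.
by rewrite ler_norml => /andP[].
Qed.

Lemma limit_to_nonpos (R : realType) (a nu : R) :
  (forall T, 0 < T -> T * a <= nu) -> a <= 0.
Proof.
move=> h; rewrite leNgt; apply/negP => a0.
have nu0 : 0 < nu by have := h 1 ltr01; rewrite mul1r; exact: lt_le_trans.
have := h (2 * nu / a); rewrite !mulr_gt0 ?invr_gt0// => /(_ isT).
by rewrite divfK ?gt_eqF//; lra.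
Qed.


Section BarrierLines.
Variables (R : realType) (E : normedModType R) (f : E -> \bar R).
Hypothesis sc : self_concordant f.
Let A : set E := dom f.
Let F : E -> R^o := fun x => fine (f x).

Let oA : open A. Proof. by case: sc. Qed.

Let cF : continuously_derivable 3 A F. Proof. by case: sc. Qed.

Lemma dom_fin_num x : dom f x -> f x \is a fin_num.
Proof.
rewrite /dom /= => fx; case: sc => -[fNy _] _ _ _ _.
by rewrite fin_numE fNy lt_eqF.
Qed.

Lemma dom_segment x y t : dom f x -> dom f y -> 0 <= t <= 1 ->
  dom f (t *: x + (1 - t) *: y).
Proof.
move=> Ax Ay t01; have [[_ cvx] _ _ _ _] := sc.
rewrite /dom /=; apply: le_lt_trans (cvx x y t t01) _.
have /fineK <- := dom_fin_num Ax; have /fineK <- := dom_fin_num Ay.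
by rewrite -!EFinM -EFinD ltry.
Qed.

Lemma dom_line_convex x h a b t : dom f (x + a *: h) -> dom f (x + b *: h) ->
  a <= t <= b -> dom f (x + t *: h).
Proof.
move=> Aa Ab /andP[at_ tb].
have [ab|ba] := ltP a b; last first.
  by have -> : t = a by apply/le_anti; rewrite at_ (le_trans tb ba).
pose l := (b - t) / (b - a).
have l01 : 0 <= l <= 1.
  rewrite divr_ge0 ?subr_ge0//=; last exact: ltW.
  by rewrite ler_pdivrMr ?subr_gt0// mul1r lerB.
have -> : x + t *: h = l *: (x + a *: h) + (1 - l) *: (x + b *: h).
  rewrite !scalerDr addrACA -scalerDl (_ : l + (1 - l) = 1); last by lra.
  rewrite scale1r !scalerA -scalerDl; congr (_ + _ *: _).
  by rewrite /l; field; rewrite subr_eq0 gt_eqF.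
exact: dom_segment.
Qed.

Lemma midpoint_line x h t u : dom f (x + (t - u) *: h) -> dom f (x + (t + u) *: h) ->
  2 * F (x + t *: h) <= F (x + (t - u) *: h) + F (x + (t + u) *: h).
Proof.
move=> A1 A2; have [[_ cvx] _ _ _ _] := sc.
have half01 : 0 <= (2^-1 : R) <= 1 by lra.
have := cvx _ _ _ half01.
move=> /(_ (x + (t - u) *: h) (x + (t + u) *: h)).
have A0 := dom_segment A1 A2 half01.
have E0 : 2^-1 *: (x + (t - u) *: h) + (1 - 2^-1) *: (x + (t + u) *: h) =
    x + t *: h.
  rewrite !scalerDr addrACA -scalerDl (_ : 2^-1 + (1 - 2^-1) = 1 :> R); last by lra.
  by rewrite scale1r !scalerA -scalerDl; congr (_ + _ *: _); lra.
rewrite E0 in A0 *.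
have /fineK <- := dom_fin_num A1; have /fineK <- := dom_fin_num A2.
have /fineK <- := dom_fin_num A0.
rewrite -!EFinM -EFinD lee_fin /F; lra.
Qed.

Lemma neg_of_close (a b : R) : `|a - b| < - a -> b < 0.
Proof. rewrite ltr_norml; lra. Qed.

Lemma second_difference_contra (u Fm F0 Fp d1 d2 : R) : 0 < u ->
  F0 - Fm = d1 * u -> Fp - F0 = d2 * u -> d2 < d1 -> 2 * F0 <= Fm + Fp -> False.
Proof.
move=> u0 e1 e2 d12 mid; have : d2 * u < d1 * u by rewrite ltr_pM2r.
lra.
Qed.

(** A negative second derivative would persist near [x], and applying the mean value
    theorem twice would contradict convexity at a midpoint. *)
Lemma second_derivative_ge0 x h : dom f x -> 0 <= iter_derive 2 h F x.
Proof.
move=> Ax; rewrite leNgt; apply/negP => neg.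
have c2 : continuously_derivable 1 A (iter_derive 2 h F).
  exact: (@cd_iter_derive _ _ _ 2 1).
have A0 : A (x + 0 *: h) by rewrite scale0r addr0.
have : {for (0 : R), continuous (fun u : R => iter_derive 2 h F (x + u *: h) : R^o)}.
  by apply: continuous_at_line; exact: cd_cont c2 A0.
rewrite /prop_for /continuous_at scale0r addr0 => /cvgrPdist_lt.
move=> /(_ (- iter_derive 2 h F x)); rewrite oppr_gt0 => /(_ neg) near_neg.
have [d /= d0 dH] := filterI (near_line oA A0) near_neg.
pose u := d / 2.
have u0 : 0 < u by rewrite divr_gt0.
have ball t : - u <= t <= u -> A (x + t *: h) /\ iter_derive 2 h F (x + t *: h) < 0.
  move=> tu; have td : ball_ [eta Num.Def.normr] 0 d t.
    rewrite /ball_ /= sub0r normrN ltr_norml; rewrite /u in tu; lra.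
  have [At nt] := dH t td; split; first exact: At.
  exact: neg_of_close nt.
have cF1 j t : (j < 3)%N -> - u <= t <= u ->
    is_derive t 1 (fun u : R => iter_derive j h F (x + u *: h) : R^o)
    (iter_derive j.+1 h F (x + t *: h)).
  by move=> j3 /ball[At _]; exact: (@is_derive_iter_line R E A 3 j h F x t cF j3 At).
have umm : - u <= - u <= u by lra.
have uuu : - u <= u <= u by lra.
have uN0 t : - u <= t <= 0 -> - u <= t <= u by lra.
have u0N t : 0 <= t <= u -> - u <= t <= u by lra.
have mid : 2 * F (x + 0 *: h) <= F (x + (0 - u) *: h) + F (x + (0 + u) *: h).
  apply: (@midpoint_line x h 0 u).
    by rewrite sub0r; exact: (ball _ umm).1.
  by rewrite add0r; exact: (ball _ uuu).1.
rewrite sub0r add0r in mid.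
have [|t tu|t1 t1u F1] := @MVT_closed R (fun t => F (x + t *: h))
    (fun t => iter_derive 1 h F (x + t *: h)) (- u) 0; first by rewrite oppr_lt0.
  exact: (@cF1 0%N t isT (uN0 t tu)).
have [|t tu|t2 t2u F2] := @MVT_closed R (fun t => F (x + t *: h))
    (fun t => iter_derive 1 h F (x + t *: h)) 0 u; first by [].
  exact: (@cF1 0%N t isT (u0N t tu)).
have /andP[t1a t1b] := t1u; have /andP[t2a t2b] := t2u.
have t12u t : t1 <= t <= t2 -> - u <= t <= u.
  by move=> /andP[t1t tt2]; rewrite (le_trans (ltW t1a) t1t) (le_trans tt2 (ltW t2b)).
have [|t tt|t3 /andP[t3a t3b] F3] := @MVT_closed R (fun t => iter_derive 1 h F (x + t *: h))
    (fun t => iter_derive 2 h F (x + t *: h)) t1 t2; first exact: lt_trans t2a.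
  exact: (@cF1 1%N t isT (t12u t tt)).
have t3neg : iter_derive 2 h F (x + t3 *: h) < 0.
  by apply: (ball t3 _).2; apply: t12u; rewrite !ltW.
have F12 : iter_derive 1 h F (x + t2 *: h) < iter_derive 1 h F (x + t1 *: h).
  by rewrite -subr_lt0 F3 nmulr_rlt0// subr_gt0 (lt_trans t1b t2a).
rewrite subr0 in F2; rewrite sub0r opprK in F1.
exact: second_difference_contra u0 F1 F2 F12 mid.
Qed.

End BarrierLines.

Section BarrierParameter.
Variables (R : realType) (E : normedModType R) (f : E -> \bar R) (nu : R).
Hypotheses (sc : self_concordant f) (par : has_parameter f nu).
Let A : set E := dom f.
Let F : E -> R^o := fun x => fine (f x).

Let oA : open A. Proof. by case: sc. Qed.

Let cF : continuously_derivable 3 A F. Proof. by case: sc. Qed.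

Lemma Dk_iter_derive k x h : dom f x -> Dk k f x h = iter_derive k h F x.
Proof. exact: Dk_line. Qed.

Lemma parameter_ge0 x : dom f x -> 0 <= nu.
Proof.
move=> Ax; have := par 0 Ax; rewrite !Dk_iter_derive// -(scale0r 0).
rewrite (@iter_derive2Z R E A oA F x 0 0 (cdW cF) Ax).
rewrite (@iter_derive1Z R E A F x 0 0 (cdW (cdW cF)) Ax).
by rewrite expr2 !mul0r mulr0 subr0.
Qed.

Lemma sqr_le_of_quadratic (a b : R) : 0 <= b ->
  (forall c, 2 * (c * a) - c ^+ 2 * b <= nu) -> a ^+ 2 <= nu * b.
Proof.
move=> b0 h; have [b00|bn0] := eqVneq b 0.
  have [->|a0] := eqVneq a 0; first by rewrite b00 mulr0 expr2 mul0r.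
  have := h ((nu + 1) / (2 * a)); rewrite b00 mulr0 subr0.
  have -> : 2 * ((nu + 1) / (2 * a) * a) = nu + 1 by field.
  lra.
have bp : 0 < b by rewrite lt_def bn0.
have := h (a / b).
have -> : 2 * (a / b * a) - (a / b) ^+ 2 * b = a ^+ 2 / b by field.
by rewrite ler_pdivrMr.
Qed.

(** The inequality defining the parameter, written for all the multiples of [h], is a
    quadratic inequality in the multiplier. *)
Lemma gradient_sqr_le x h : dom f x ->
  (iter_derive 1 h F x) ^+ 2 <= nu * iter_derive 2 h F x.
Proof.
move=> Ax; apply: sqr_le_of_quadratic => [|c].
  exact: (second_derivative_ge0 sc).
have := par (c *: h) Ax; rewrite !Dk_iter_derive//.
rewrite (@iter_derive2Z R E A oA F x h c (cdW cF) Ax).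
by rewrite (@iter_derive1Z R E A F x h c (cdW (cdW cF)) Ax).
Qed.

Lemma is_derive_F_line j x h (t : R) : (j < 3)%N -> A (x + t *: h) ->
  is_derive t 1 (fun u : R => iter_derive j h F (x + u *: h) : R^o)
    (iter_derive j.+1 h F (x + t *: h)).
Proof. by move=> j3; exact: (@is_derive_iter_line R E A 3 j h F x t cF j3). Qed.

(** Along a segment of the domain the reciprocal of the slope decreases at rate
    at least [1 / nu], so a positive slope cannot exceed [nu] per unit length. *)
Lemma gradient_le_parameter x h (T : R) : 0 < T ->
  (forall t, 0 <= t <= T -> dom f (x + t *: h)) -> T * iter_derive 1 h F x <= nu.
Proof.
move=> T0 AT.
pose d1 t := iter_derive 1 h F (x + t *: h).
pose d2 t := iter_derive 2 h F (x + t *: h).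
have d1E : iter_derive 1 h F x = d1 0 by rewrite /d1 scale0r addr0.
have dd1 t : 0 <= t <= T -> is_derive t 1 (d1 : R -> R^o) (d2 t).
  by move=> tT; exact: (@is_derive_F_line 1%N x h t isT (AT t tT)).
have d2_ge0 t : 0 <= t <= T -> 0 <= d2 t.
  by move=> tT; exact: (second_derivative_ge0 sc h (AT t tT)).
have sq t : 0 <= t <= T -> d1 t ^+ 2 <= nu * d2 t.
  by move=> tT; exact: (gradient_sqr_le h (AT t tT)).
rewrite d1E; clearbody d1 d2; clear d1E.
have nu0 : 0 <= nu by apply: (@parameter_ge0 (x + 0 *: h)); apply: AT; lra.
clear AT.
have t00 : (0 : R) <= 0 <= T by rewrite lexx ltW.
have [d0|d0] := leP (d1 0) 0.
  by apply: le_trans nu0; rewrite pmulr_rle0.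
have d1_gt0 t : 0 <= t <= T -> 0 < d1 t.
  move=> /andP[t0 tT]; apply: lt_le_trans d0 _.
  have sub u : 0 <= u <= t -> 0 <= u <= T.
    by move=> /andP[-> ut]; exact: le_trans ut tT.
  by apply: (@nondecreasing_MVT R d1 d2) => // u /sub; [exact: dd1|exact: d2_ge0].
have {}nu0 : 0 < nu.
  rewrite lt_def nu0 andbT; apply/eqP => nu00; have := sq 0 t00.
  by rewrite nu00 mul0r leNgt exprn_gt0.
have T0' : 0 <= T by exact: ltW.
pose g t := - (d1 t)^-1 - nu^-1 * t.
pose dg t := d1 t ^- 2 * d2 t - nu^-1.
have dgt t : 0 <= t <= T -> is_derive t 1 (g : R -> R^o) (dg t).
  move=> tT; have e1 := is_deriveN (@is_deriveV R d1 t _ 1 (lt0r_neq0 (d1_gt0 t tT)) (dd1 t tT)).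
  have e2 := is_deriveB e1 (is_deriveZ nu^-1 (is_derive_id (t : R^o) (1 : R^o))).
  by move: e2; rewrite [nu^-1 *: 1]mulr1 scaleNr opprK.
have dg_ge0 t : 0 <= t <= T -> 0 <= dg t.
  move=> tT; have d1t := d1_gt0 t tT; have st := sq t tT.
  by rewrite subr_ge0 ler_pdivlMl ?exprn_gt0// ler_pdivrMr// mulrC.
have := nondecreasing_MVT T0' dgt dg_ge0; rewrite /g mulr0 subr0.
have iT : 0 < (d1 T)^-1 by rewrite invr_gt0 d1_gt0// lexx andbT.
have -> : (T * d1 0 <= nu) = (nu^-1 * T <= (d1 0)^-1).
  by rewrite ler_pdivrMl// ler_pdivlMr.
lra.
Qed.

Lemma recession_gradient_le0 x p : (forall t, 0 <= t -> dom f (x + t *: p)) ->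
  iter_derive 1 p F x <= 0.
Proof.
move=> Ap; apply: (@limit_to_nonpos R _ nu) => T T0.
by apply: gradient_le_parameter => // t /andP[t0 _]; exact: Ap.
Qed.

End BarrierParameter.

Section BoundaryBlowup.
Variables (R : realType) (E : normedModType R) (f : E -> \bar R).
Hypotheses (sc : self_concordant f).
Let A : set E := dom f.
Let F : E -> R^o := fun x => fine (f x).

Lemma open_dom_line x p t : dom f (x + t *: p) ->
  exists2 d : R, 0 < d & forall u, `|t - u| < d -> dom f (x + u *: p).
Proof.
have oA : open A by case: sc.
move=> /(near_line oA)[d /= d0 dH]; exists d => //.
Qed.

(** The epigraph being closed, a line cannot leave the domain at a finite time
    while the values of the function stay bounded. *)
Lemma dom_line_bounded_limit x p (a b K : R) : a < b ->
  (forall t, a < t <= b -> dom f (x + t *: p) /\ F (x + t *: p) <= K) ->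
  dom f (x + a *: p).
Proof.
move=> ab fK; have [_ _ cl _ _] := sc.
suff : epigraph f (x + a *: p, K : R^o).
  by rewrite /epigraph /dom /= => /le_lt_trans; apply; rewrite ltry.
apply: cl => B nB.
have cl : {for a, continuous (fun t : R => (x + t *: p, K : R^o) : (E * R^o)%type)}.
  by apply: continuous_at_pair; [exact: continuous_line|exact: cvg_cst].
have [d /= d0 dB] := cl _ nB.
pose t := Num.min b (a + d / 2).
have at_ : a < t by rewrite lt_min ab ltrDl divr_gt0.
have tb : t <= b by rewrite ge_min lexx.
have td : t <= a + d / 2 by rewrite ge_min lexx orbT.
exists (x + t *: p, K : R^o); split.
  have [|At Ft] := fK t; first by rewrite at_.
  by rewrite /epigraph /= -(fineK (dom_fin_num sc At)) lee_fin.
apply: dB; rewrite /ball_ /= ltr_norml; lra.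
Qed.

(** The exit time is the supremum of the times spent in the domain; openness of the
    domain excludes the exit point. *)
Lemma exit_time x p (b : R) : 0 < b -> dom f x -> ~ dom f (x - b *: p) ->
  exists2 tau, 0 < tau <= b & ~ dom f (x + (- tau) *: p) /\
    forall t, - tau < t <= 0 -> dom f (x + t *: p).
Proof.
move=> b0 Ax nAb.
have A0 : dom f (x + 0 *: p) by rewrite scale0r addr0.
pose S := [set r : R | 0 <= r /\ dom f (x + (- r) *: p)].
have S0 : S 0 by split => //; rewrite oppr0.
have Sb r : S r -> r <= b.
  move=> [r0 Ar]; rewrite leNgt; apply/negP => br; apply: nAb; rewrite -scaleNr.
  by apply: (dom_line_convex sc Ar A0); rewrite lerN2 oppr_le0 !ltW.
have hS : has_sup S by split; [exists 0|exists b].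
pose tau := sup S.
have tauS t : 0 <= t < tau -> S t.
  move=> /andP[t0 tt]; split => //.
  have [r Sr] : exists2 r, S r & t < r.
    have tt' : 0 < tau - t by rewrite subr_gt0.
    have [r Sr] := sup_adherent tt' hS; rewrite -/tau subKr => tr.
    by exists r.
  move=> tr; have [r0 Ar] := Sr.
  by apply: (dom_line_convex sc Ar A0); rewrite lerN2 oppr_le0 t0 ltW.
have nS : ~ dom f (x + (- tau) *: p).
  move=> At; have [d d0 dH] := open_dom_line At.
  have : S (tau + d / 2).
    split; first by rewrite addr_ge0 ?divr_ge0 ?(ltW d0) ?(ub_le_sup hS.2 S0).
    by apply: dH; rewrite opprK addrA addNr add0r ger0_norm; lra.
  move=> /(ub_le_sup hS.2); rewrite -/tau gerDl => d2.
  have : 0 < d / 2 by rewrite divr_gt0.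
  lra.
exists tau.
  apply/andP; split; last by apply: ge_sup; [exists 0|exact: Sb].
  rewrite lt_neqAle (ub_le_sup hS.2 S0) andbT; apply/eqP => tau0.
  by apply: nS; rewrite -tau0 oppr0.
split=> // t /andP[tt t0].
have [|_] := tauS (- t); first by rewrite oppr_ge0 t0/= ltrNl.
by rewrite opprK.
Qed.

(** Otherwise [(d2 + e) ^ (-1/2)] exceeds, for a small [e], the distance [t0 + tau] to
    the exit by some [m > 0]; being Lipschitz it stays above [m] up to the exit, so
    that the Hessian, the slope and finally the value of the function are bounded,
    and the exit point belongs to the domain. *)
Lemma hessian_ge_exit x p (tau t0 : R) : - tau < t0 ->
  ~ dom f (x + (- tau) *: p) ->
  (forall t, - tau < t <= t0 -> dom f (x + t *: p)) ->
  ((t0 + tau) ^+ 2)^-1 <= iter_derive 2 p F (x + t0 *: p).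
Proof.
move=> tt0 nA At; rewrite leNgt; apply/negP => small; apply: nA.
pose d0 t := iter_derive 0 p F (x + t *: p).
pose d1 t := iter_derive 1 p F (x + t *: p).
pose d2 t := iter_derive 2 p F (x + t *: p).
pose d3 t := iter_derive 3 p F (x + t *: p).
pose I t := - tau < t <= t0.
have cF : continuously_derivable 3 A F by case: sc.
have e0 t : I t -> is_derive t 1 (d0 : R -> R^o) (d1 t).
  by move=> /At; exact: (@is_derive_iter_line R E A 3 0 p F x t cF isT).
have e1 t : I t -> is_derive t 1 (d1 : R -> R^o) (d2 t).
  by move=> /At; exact: (@is_derive_iter_line R E A 3 1 p F x t cF isT).
have e2 t : I t -> is_derive t 1 (d2 : R -> R^o) (d3 t).
  by move=> /At; exact: (@is_derive_iter_line R E A 3 2 p F x t cF isT).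
have d2_ge0 t : I t -> 0 <= d2 t.
  by move=> /At; exact: (second_derivative_ge0 sc p).
have d3_le t : I t -> `|d3 t| <= 2 * (d2 t) `^ (3 / 2).
  move=> /At Axt; have [_ _ _ _ /(_ (x + t *: p) p Axt)] := sc.
  by rewrite !Dk_iter_derive.
suff [K HK] : exists K, forall t, I t -> d0 t <= K.
  by apply: (@dom_line_bounded_limit _ _ _ t0 K) => // t It; split; [exact: At|exact: HK].
move: small; rewrite -/(d2 t0); clearbody d0 d1 d2 d3; clear At.
set T := t0 + tau => small.
have T0 : 0 < T by rewrite /T; lra.
have It0 : I t0 by rewrite /I tt0 lexx.
(* Small enough for [(d2 t0 + e) ^ (-1/2)] to exceed [T]. *)
pose e := (T ^- 2 - d2 t0) / 2.
have ep : 0 < e by rewrite divr_gt0// subr_gt0.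
pose s t := (Num.sqrt (d2 t + e))^-1.
pose m := s t0 - T.
have m0 : 0 < m.
  rewrite subr_gt0 /s -[ltLHS]invrK ltf_pV2 ?posrE ?invr_gt0 ?sqrtr_gt0//; last first.
    by rewrite ltr_wpDl// d2_ge0.
  rewrite -[ltRHS]ger0_norm ?invr_ge0 ?ltW// -sqrtr_sqr ltr_sqrt ?exprn_gt0 ?invr_gt0//.
  by rewrite exprVn /e; move: small; lra.
have d2M t : I t -> d2 t <= m ^- 2.
  move=> /andP[t1 t2]; have It u : t <= u <= t0 -> I u.
    by move=> /andP[tu ut]; rewrite /I ut (lt_le_trans t1 tu).
  have := @inv_sqrt_lipschitz R d2 d3 e t t0 ep t2 (fun u h => e2 u (It u h))
    (fun u h => d2_ge0 u (It u h)) (fun u h => d3_le u (It u h)).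
  rewrite -/(s t) -/(s t0) => st.
  have {}st : m <= s t by apply: le_trans st; rewrite /m /T; lra.
  have rho0 : 0 < d2 t + e by rewrite ltr_wpDl// d2_ge0// /I t1.
  have rhom : Num.sqrt (d2 t + e) <= m^-1.
    by rewrite -[leLHS]invrK lef_pV2 ?posrE ?invr_gt0 ?sqrtr_gt0.
  apply: (@le_trans _ _ (d2 t + e)); first by rewrite lerDl ltW.
  rewrite -(sqr_sqrtr (ltW rho0)) -exprVn.
  by rewrite ler_pXn2r// nnegrE ?sqrtr_ge0// invr_ge0 ltW.
have sub t c : I t -> t <= c <= t0 -> I c.
  by move=> /andP[t1 _] /andP[tc ct]; rewrite /I ct (lt_le_trans t1 tc).
have tT t : I t -> 0 <= t0 - t <= T.
  by move=> /andP[t1 t2]; rewrite subr_ge0 t2 /T; lra.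
have M0 : 0 <= m ^- 2 by rewrite invr_ge0 exprn_ge0// ltW.
have d1C t : I t -> d1 t0 - m ^- 2 * T <= d1 t.
  move=> It; have /andP[_ t2] := It; have [|c] := @MVT_between R d1 d2 t t0.
    by move=> u; rewrite minEle maxEle t2 => /(sub _ _ It); exact: e1.
  rewrite minEle maxEle t2 => /(sub _ _ It) Ic d1E.
  rewrite lerBlDr -lerBlDl d1E.
  have /andP[t3 t4] := tT t It.
  by apply: ler_pM => //; [exact: d2_ge0|exact: d2M].
exists (d0 t0 + `|d1 t0 - m ^- 2 * T| * T) => t It.
have /andP[_ t2] := It; have [|c] := @MVT_between R d0 d1 t t0.
  by move=> u; rewrite minEle maxEle t2 => /(sub _ _ It); exact: e0.
rewrite minEle maxEle t2 => /(sub _ _ It) Ic d0E.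
have /andP[t3 t4] := tT t It.
rewrite -lerBlDl -opprB d0E -mulNr.
apply: (@le_trans _ _ (`|d1 t0 - m ^- 2 * T| * (t0 - t))); last exact: ler_wpM2l.
apply: ler_wpM2r => //; rewrite lerNl; apply: le_trans (d1C c Ic).
by rewrite lerNl -normrN ler_norm.
Qed.

(** A line that leaves the domain within time [b] in the direction [- p] and
    never leaves it in the direction [p] has Hessian at least [(t + b)^-2], and
    its slope at infinity is nonpositive; integrating gives the bound. *)
Lemma recession_gradient_le_inv x p (b nu : R) : has_parameter f nu -> 0 < b ->
  (forall t, 0 <= t -> dom f (x + t *: p)) -> ~ dom f (x - b *: p) ->
  iter_derive 1 p F x <= - b^-1.
Proof.
move=> par b0 Ap nAb.
have Ax : dom f x by have := Ap 0 (lexx _); rewrite scale0r addr0.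
have [tau /andP[tau0 taub] [nA At]] := exit_time b0 Ax nAb.
have cF : continuously_derivable 3 A F by case: sc.
have Atall t : - tau < t -> dom f (x + t *: p).
  by move=> tt; have [t0|t0] := leP t 0; [apply: At; rewrite tt|exact/Ap/ltW].
pose d1 t := iter_derive 1 p F (x + t *: p).
pose d2 t := iter_derive 2 p F (x + t *: p).
have d1E : iter_derive 1 p F x = d1 0 by rewrite /d1 scale0r addr0.
have e1 t : - tau < t -> is_derive t 1 (d1 : R -> R^o) (d2 t).
  by move=> /Atall; exact: (@is_derive_iter_line R E A 3 1 p F x t cF isT).
have d2_ge t : - tau < t -> ((t + tau) ^+ 2)^-1 <= d2 t.
  move=> tt; apply: hessian_ge_exit => // u /andP[ut _]; exact: Atall.
have d1_le0 t : 0 <= t -> d1 t <= 0.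
  move=> t0; apply: (recession_gradient_le0 sc par) => u u0.
  by rewrite -addrA -scalerDl; apply: Ap; rewrite addr_ge0.
rewrite d1E; clearbody d1 d2.
apply: (@le_trans _ _ (- tau^-1)); last first.
  by rewrite lerN2 lef_pV2 ?posrE.
pose g (t : R) := d1 t + (t + tau)^-1.
pose dg (t : R) := d2 t - (t + tau) ^- 2.
have eg (t : R) : 0 <= t -> is_derive t 1 (g : R -> R^o) (dg t).
  move=> t0; have tt : - tau < t by rewrite (lt_le_trans _ t0)// oppr_lt0.
  have ttau : t + tau != 0 by rewrite gt_eqF// ltr_wpDl.
  have i1 := is_deriveD (is_derive_id (t : R^o) (1 : R^o)) (is_derive_cst (tau : R^o) (t : R^o) (1 : R^o)).
  have i2 := @is_deriveV R (fun t : R => t + tau) t _ 1 ttau i1.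
  have := is_deriveD (e1 t tt) i2.
  by rewrite addr0 [_ *: 1]mulr1.
have gT (T : R) : 0 < T -> d1 0 + tau^-1 <= (T + tau)^-1.
  move=> T0; have : g 0 <= g T.
    apply: (@nondecreasing_MVT R g dg) => [|t /andP[t0 _]|t /andP[t0 _]].
    - exact: ltW.
    - exact: eg.
    - by rewrite subr_ge0; apply: d2_ge; rewrite (lt_le_trans _ t0)// oppr_lt0.
  rewrite /g add0r => /le_trans; apply; rewrite gerDr; exact/d1_le0/ltW.
rewrite -subr_le0 opprK; apply: (@limit_to_nonpos R _ 1) => T T0.
apply: (@le_trans _ _ (T * (T + tau)^-1)); first by rewrite ler_pM2l// gT.
by rewrite ler_pdivrMr ?addr_gt0// mul1r lerDl ltW.
Qed.

End BoundaryBlowup.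

Local Open Scope sesquilinear_scope.

(** * Complex and matrix valued functions of class C^k *)

Section ComplexCk.
Variables (R : realType) (E : normedModType R) (A : set E) (k : nat).
Hypothesis oA : open A.
Local Notation C := R[i].
Implicit Types f g : E -> C.

Definition cdC f : Prop :=
  continuously_derivable k A (fun x => complex.Re (f x) : R^o) /\
  continuously_derivable k A (fun x => complex.Im (f x) : R^o).

Lemma cdC_eq f g : (forall x, A x -> f x = g x) -> cdC f -> cdC g.
Proof.
by move=> fg [cr ci]; split; [apply: cd_eq cr|apply: cd_eq ci] => // x /fg ->.
Qed.

Lemma cdC_cst (c : C) : cdC (fun=> c).
Proof. by split; exact: cd_cst. Qed.

Lemma cdCD f g : cdC f -> cdC g -> cdC (fun x => f x + g x).
Proof.
move=> [fr fi] [gr gi]; split.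
  by apply: cd_eq (cdD oA fr gr) => // x _; case: (f x) (g x) => ? ? [].
by apply: cd_eq (cdD oA fi gi) => // x _; case: (f x) (g x) => ? ? [].
Qed.

Lemma cdCM f g : cdC f -> cdC g -> cdC (fun x => f x * g x).
Proof.
move=> [fr fi] [gr gi]; split.
  apply: cd_eq (cdB oA (cdM oA fr gr) (cdM oA fi gi)) => // x _.
  by case: (f x) (g x) => ? ? [].
apply: cd_eq (cdD oA (cdM oA fr gi) (cdM oA fi gr)) => // x _.
by case: (f x) (g x) => ? ? [].
Qed.

Lemma cdC_real (h : E -> R^o) : continuously_derivable k A h -> cdC (fun x => (h x)%:C%C).
Proof. by move=> ch; split => //; exact: cd_cst. Qed.

Lemma cdC_conj f : cdC f -> cdC (fun x => (f x)^*).
Proof.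
move=> [fr fi]; split; first by apply: cd_eq fr => // x _; case: (f x).
by apply: cd_eq (cdN oA fi) => // x _; case: (f x).
Qed.

Lemma cdCV f : (forall x, A x -> f x != 0) -> cdC f -> cdC (fun x => (f x)^-1).
Proof.
move=> f0 [fr fi].
have nc : continuously_derivable k A
    (fun x => (complex.Re (f x) * complex.Re (f x) + complex.Im (f x) * complex.Im (f x))^-1 : R^o).
  apply: cdV => //; last by apply: cdD => //; exact: cdM.
  move=> x /f0; apply: contraNneq => /eqP.
  rewrite -!expr2 paddr_eq0 ?sqr_ge0// !sqrf_eq0.
  by case: (f x) => a b /= /andP[/eqP -> /eqP ->].
split.
  by apply: cd_eq (cdM oA fr nc) => // x _; case: (f x) => a b /=; rewrite !expr2.
by apply: cd_eq (cdN oA (cdM oA fi nc)) => // x _; case: (f x) => a b /=; rewrite !expr2.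
Qed.

Lemma cdC_sum (I : Type) (r : seq I) (P : pred I) (F : I -> E -> C) :
  (forall i, P i -> cdC (F i)) -> cdC (fun x => \sum_(i <- r | P i) F i x).
Proof.
move=> cF; elim: r => [|i r IH].
  by apply: cdC_eq (cdC_cst 0) => x _; rewrite big_nil.
have [Pi|Pi] := boolP (P i).
  by apply: cdC_eq (cdCD (cF _ Pi) IH) => x _; rewrite big_cons Pi.
by apply: cdC_eq IH => x _; rewrite big_cons (negbTE Pi).
Qed.

Lemma cdC_prod (I : Type) (r : seq I) (P : pred I) (F : I -> E -> C) :
  (forall i, P i -> cdC (F i)) -> cdC (fun x => \prod_(i <- r | P i) F i x).
Proof.
move=> cF; elim: r => [|i r IH].
  by apply: cdC_eq (cdC_cst 1) => x _; rewrite big_nil.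
have [Pi|Pi] := boolP (P i).
  by apply: cdC_eq (cdCM (cF _ Pi) IH) => x _; rewrite big_cons Pi.
by apply: cdC_eq IH => x _; rewrite big_cons (negbTE Pi).
Qed.

Definition cdMx m n (M : E -> 'M[C]_(m, n)) : Prop :=
  forall i j, cdC (fun x => M x i j).

Lemma cdMx_cst m n (M : 'M[C]_(m, n)) : cdMx (fun=> M).
Proof. by move=> i j; exact: cdC_cst. Qed.

Lemma cdMxD m n (M N : E -> 'M[C]_(m, n)) : cdMx M -> cdMx N ->
  cdMx (fun x => M x + N x).
Proof.
by move=> cM cN i j; apply: cdC_eq (cdCD (cM i j) (cN i j)) => x _; rewrite !mxE.
Qed.

Lemma cdMxZ m n f (M : E -> 'M[C]_(m, n)) : cdC f -> cdMx M ->
  cdMx (fun x => f x *: M x).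
Proof.
by move=> cf cM i j; apply: cdC_eq (cdCM cf (cM i j)) => x _; rewrite !mxE.
Qed.

Lemma cdMxB m n (M N : E -> 'M[C]_(m, n)) : cdMx M -> cdMx N ->
  cdMx (fun x => M x - N x).
Proof.
move=> cM cN; have := cdMxD cM (cdMxZ (cdC_cst (-1)) cN) => h i j.
by apply: cdC_eq (h i j) => x _; rewrite scaleN1r.
Qed.

Lemma cdMxM m n p (M : E -> 'M[C]_(m, n)) (N : E -> 'M[C]_(n, p)) :
  cdMx M -> cdMx N -> cdMx (fun x => M x *m N x).
Proof.
move=> cM cN i j.
apply: cdC_eq (@cdC_sum _ (index_enum _) xpredT (fun l x => M x i l * N x l j) _).
  by move=> x _; rewrite mxE.
by move=> l _; exact: cdCM.
Qed.

Lemma cdC_det n (M : E -> 'M[C]_n) : cdMx M -> cdC (fun x => \det (M x)).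
Proof.
move=> cM; apply: cdC_sum => s _; apply: cdCM; first exact: cdC_cst.
by apply: cdC_prod => i _; exact: cM.
Qed.

Lemma cdC_trace n (M : E -> 'M[C]_n) : cdMx M -> cdC (fun x => \tr (M x)).
Proof. by move=> cM; apply: cdC_sum => i _; exact: cM. Qed.

(** By Cramer's rule. *)
Lemma cdMx_invmx n (M : E -> 'M[C]_n) : (forall x, A x -> \det (M x) != 0) ->
  cdMx M -> cdMx (fun x => invmx (M x)).
Proof.
move=> d0 cM i j.
have cdet := cdCV d0 (cdC_det cM).
have ccof : cdC (fun x => cofactor (M x) j i).
  apply: cdCM; first exact: cdC_cst.
  by apply: cdC_det => a b; apply: cdC_eq (cM (lift j a) (lift i b)) => x _; rewrite !mxE.
apply: cdC_eq (cdCM cdet ccof) => x Ax.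
by rewrite /invmx unitmxE unitfE d0// !mxE.
Qed.

Lemma cdMx_mxvec m n (M : E -> 'M[C]_(m, n)) : cdMx M -> cdMx (fun x => mxvec (M x)).
Proof.
move=> cM i l; case/mxvec_indexP: l => a b.
by apply: cdC_eq (cM a b) => x _; rewrite ord1 mxvecE.
Qed.

Lemma cdMx_adj m n (M : E -> 'M[C]_(m, n)) : cdMx M -> cdMx (fun x => (M x) ^t*).
Proof.
by move=> cM i j; apply: cdC_eq (cdC_conj (cM j i)) => x _; rewrite !mxE.
Qed.

Lemma cdMx_vec_mx m n (M : E -> 'rV[C]_(m * n)) : cdMx M -> cdMx (fun x => vec_mx (M x)).
Proof. by move=> cM i j; apply: cdC_eq (cM 0 (mxvec_index i j)) => x _; rewrite mxE. Qed.

Lemma cdMx_lin_mx m n p q (L : E -> 'M[C]_(m, n) -> 'M[C]_(p, q)) :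
  (forall M, cdMx (fun x => L x M)) -> cdMx (fun x => lin_mx (L x)).
Proof.
move=> cL i j; have := cdMx_mxvec (cL (vec_mx (delta_mx 0 i))) 0 j.
by apply: cdC_eq => x _; rewrite !mxE/= .
Qed.

End ComplexCk.

Section HermitianEntries.
Variables (R : realType) (n : nat).
Local Notation C := R[i].
Local Notation H := (hermmx R n).

Lemma hermmx_entry_norm (X : H) i j :
  `|complex.Re ((X : 'M[C]_n) i j)| <= `|X| /\
  `|complex.Im ((X : 'M[C]_n) i j)| <= `|X|.
Proof.
have le : `|(X : 'M[C]_n) i j| <= (`|X|)%:C%C.
  have -> : (`|X|)%:C%C = `|(X : 'M[C]_n)| :> C by exact: hermmx_normE.
  rewrite [leRHS]/Num.norm/= /mx_norm -[leLHS]nngE num_le.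
  by have := @le_bigmax _ _ _ 0%:nng (fun ij => `|(X : 'M[C]_n) ij.1 ij.2|%:nng) (i, j).
split; rewrite -lecR; apply: le_trans le; first exact: normc_ge_Re.
rewrite normc_def lecR -sqrtr_sqr ler_sqrt ?lerDr ?sqr_ge0//.
by rewrite addr_ge0 ?sqr_ge0.
Qed.

Lemma hermmx_ReD (X Y : H) (a : R) i j :
  complex.Re (((a *: X + Y : H) : 'M[C]_n) i j) =
  a * complex.Re ((X : 'M[C]_n) i j) + complex.Re ((Y : 'M[C]_n) i j).
Proof.
rewrite /= !mxE.
by case: ((X : 'M[C]_n) i j) ((Y : 'M[C]_n) i j) => ? ? [? ?] /=; rewrite mul0r subr0.
Qed.

Lemma hermmx_ImD (X Y : H) (a : R) i j :
  complex.Im (((a *: X + Y : H) : 'M[C]_n) i j) =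
  a * complex.Im ((X : 'M[C]_n) i j) + complex.Im ((Y : 'M[C]_n) i j).
Proof.
rewrite /= !mxE.
by case: ((X : 'M[C]_n) i j) ((Y : 'M[C]_n) i j) => ? ? [? ?] /=; rewrite mul0r addr0.
Qed.

Lemma linear_contraction_continuous (E : normedModType R) (f : E -> R^o) :
  (forall x y (a : R), f (a *: x + y) = a * f x + f y) ->
  (forall x, `|f x| <= `|x|) -> continuous f.
Proof.
move=> lf bf x; apply/cvgrPdist_le => /= e e0.
near=> y.
have -> : f x - f y = f (x - y).
  by have := lf y x (-1); rewrite scaleN1r mulN1r addrC => ->; rewrite addrC.
apply: le_trans (bf _) _; near: y.
by have /cvgrPdist_le /(_ e e0) := @cvg_id _ (nbhs x).
Unshelve. all: by end_near. Qed.

Lemma cdMx_hermmx (E : normedModType R) (A : set E) k (L : E -> H) :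
  open A -> continuous L -> (forall x y (a : R), L (a *: x + y) = a *: L x + L y) ->
  cdMx A k (fun w => (L w : 'M[C]_n)).
Proof.
move=> oA cL lL i j.
split; apply: cd_linear => //.
- move=> x; apply: (@continuous_comp _ _ _ L (fun X : H => complex.Re ((X : 'M[C]_n) i j) : R^o)).
    exact: cL.
  apply: linear_contraction_continuous => [X Y a|X]; first exact: hermmx_ReD.
  exact: (hermmx_entry_norm X i j).1.
- by move=> x y a; rewrite lL hermmx_ReD.
- move=> x; apply: (@continuous_comp _ _ _ L (fun X : H => complex.Im ((X : 'M[C]_n) i j) : R^o)).
    exact: cL.
  apply: linear_contraction_continuous => [X Y a|X]; first exact: hermmx_ImD.
  exact: (hermmx_entry_norm X i j).2.
- by move=> x y a; rewrite lL hermmx_ImD.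
Qed.

End HermitianEntries.

(** * Spectral decompositions *)

Section Spectral.
Variables (R : realType).
Local Notation C := R[i].

Definition rdiag n (l : 'rV[R]_n) : 'M[C]_n := diag_mx (map_mx (fun x => x%:C%C) l).

Definition csqr (z : C) : R := complex.Re z ^+ 2 + complex.Im z ^+ 2.

Lemma csqrE (z : C) : z^* * z = (csqr z)%:C%C.
Proof. by rewrite /csqr add_Re2_Im2 normCK mulrC. Qed.

Lemma csqr_ge0 z : 0 <= csqr z.
Proof. by rewrite addr_ge0 ?sqr_ge0. Qed.

Lemma csqr_eq0 z : (csqr z == 0) = (z == 0).
Proof.
rewrite paddr_eq0 ?sqr_ge0// !sqrf_eq0.
by case: z => a b; rewrite eq_complex.
Qed.

Lemma adjmxM m n p (A : 'M[C]_(m, n)) (B : 'M[C]_(n, p)) :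
  (A *m B) ^t* = B ^t* *m A ^t*.
Proof. by rewrite trmx_mul map_mxM. Qed.

Lemma adjmxK m n (A : 'M[C]_(m, n)) : (A ^t*) ^t* = A.
Proof. by apply/matrixP => i j; rewrite !mxE conjCK. Qed.

Lemma rdiag1 n : rdiag (const_mx 1) = 1%:M :> 'M[C]_n.
Proof. by rewrite /rdiag map_const_mx diag_const_mx. Qed.

Lemma adjmx_rdiag n (l : 'rV[R]_n) : (rdiag l) ^t* = rdiag l.
Proof.
apply/matrixP => i j; rewrite !mxE eq_sym; case: eqP => [->|_].
  by rewrite !mulr1n; apply/CrealP; rewrite complex_real.
by rewrite !mulr0n conjC0.
Qed.

Lemma rdiagM n (l m : 'rV[R]_n) :
  rdiag l *m rdiag m = rdiag (\row_i (l 0 i * m 0 i)).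
Proof.
rewrite /rdiag mulmx_diag; congr diag_mx; apply/rowP => i.
by rewrite !mxE rmorphM.
Qed.

Lemma mul_rdiag_mx m n (l : 'rV[R]_m) (M : 'M[C]_(m, n)) i j :
  (rdiag l *m M) i j = (l 0 i)%:C%C * M i j.
Proof. by rewrite mul_diag_mx !mxE. Qed.

Lemma mul_mx_rdiag m n (l : 'rV[R]_n) (M : 'M[C]_(m, n)) i j :
  (M *m rdiag l) i j = M i j * (l 0 j)%:C%C.
Proof. by rewrite mul_mx_diag !mxE. Qed.

Lemma sum_realC (I : Type) (r : seq I) (P : pred I) (F : I -> R) :
  \sum_(i <- r | P i) (F i)%:C%C = (\sum_(i <- r | P i) F i)%:C%C :> C.
Proof. by rewrite rmorph_sum. Qed.

Lemma trace_rdiag_form m n (l : 'rV[R]_m) (M : 'M[C]_(m, n)) :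
  \tr (M ^t* *m rdiag l *m M) = (\sum_j \sum_i l 0 i * csqr (M i j))%:C%C.
Proof.
rewrite -sum_realC; apply: eq_bigr => j _; rewrite -mulmxA mxE -sum_realC.
apply: eq_bigr => i _.
by rewrite mul_rdiag_mx !mxE mulrCA csqrE rmorphM.
Qed.

Lemma hermmxP n (X : hermmx R n) : (X : 'M[C]_n) ^t* = X.
Proof. by have := hermmx_valP X; rewrite hermitian_predE => /eqP <-. Qed.

Lemma hermmx_of_adj n (A : 'M[C]_n) : A ^t* = A -> exists X : hermmx R n, X = A :> 'M[C]_n.
Proof.
move=> hA; have h : A \in @hermitian_pred R n by rewrite hermitian_predE hA.
by exists (HermMx h).
Qed.

Definition spectral_dec n (X : 'M[C]_n) (U : 'M[C]_n) (l : 'rV[R]_n) : Prop :=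
  U \is unitarymx /\ X = U ^t* *m rdiag l *m U.

Lemma unitary_adjmx n (U : 'M[C]_n) : U \is unitarymx -> U *m U ^t* = 1%:M /\ U ^t* *m U = 1%:M.
Proof.
move=> hU; split; first exact/unitarymxP.
by rewrite -(invmx_unitary hU) mulVmx// unitarymx_unit.
Qed.

Lemma spectral_dec_spectralmx n (X : hermmx R n) :
  spectral_dec X (spectralmx X) (map_mx (@complex.Re R) (spectral_diag X)).
Proof.
split; first exact: spectral_unitarymx.
have hX : (X : 'M[C]_n) \is hermsymmx by have := hermmx_valP X.
have -> : rdiag (map_mx (@complex.Re R) (spectral_diag X)) = diag_mx (spectral_diag X).
  congr diag_mx; apply/rowP => i; rewrite !mxE; apply: RRe_real.
  by have /mxOverP/(_ 0 i) := hermitian_spectral_diag_real hX.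
rewrite -invmx_unitary ?spectral_unitarymx//.
exact/orthomx_spectralP/hermitian_normalmx.
Qed.

Lemma spectral_exists n (X : hermmx R n) : exists U l, spectral_dec X U l.
Proof. by exists (spectralmx X); eexists; exact: spectral_dec_spectralmx. Qed.

Lemma intertwine_rdiag m n (W : 'M[C]_(m, n)) (l : 'rV[R]_m) (k : 'rV[R]_n) (f : R -> R) :
  rdiag l *m W = W *m rdiag k ->
  rdiag (map_mx f l) *m W = W *m rdiag (map_mx f k).
Proof.
move=> comm; apply/matrixP => i j; rewrite mul_rdiag_mx mul_mx_rdiag !mxE.
have := congr1 (fun M : 'M[C]_(m, n) => M i j) comm.
rewrite mul_rdiag_mx mul_mx_rdiag mulrC.
have [->|W0] := eqVneq (W i j) 0; first by rewrite !(mulr0, mul0r).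
by move=> /(mulfI W0) /complexI ->; rewrite mulrC.
Qed.

(** Functional calculus does not depend on the diagonalisation: the unitary matrix
    [U V^*] intertwines the two diagonal matrices, hence their images under [f]. *)
Lemma spectral_map_uniq n (X U V : 'M[C]_n) (l m : 'rV[R]_n) (f : R -> R) :
  spectral_dec X U l -> spectral_dec X V m ->
  U ^t* *m rdiag (map_mx f l) *m U = V ^t* *m rdiag (map_mx f m) *m V.
Proof.
move=> [hU XU] [hV XV].
have [UU' U'U] := unitary_adjmx hU; have [VV' V'V] := unitary_adjmx hV.
pose W := U *m V ^t*.
have comm : rdiag l *m W = W *m rdiag m.
  have : U *m X *m V ^t* = U *m X *m V ^t* by [].
  rewrite {1}XU XV !mulmxA UU' mul1mx -!mulmxA VV' mulmx1 => ->.
  by rewrite /W !mulmxA.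
have commf := intertwine_rdiag f comm.
have -> : U ^t* *m rdiag (map_mx f l) *m U = U ^t* *m (rdiag (map_mx f l) *m W) *m V.
  by rewrite /W !mulmxA mulmxKtV.
by rewrite commf /W !mulmxA U'U mul1mx.
Qed.

Lemma logmx_spectral n (X : hermmx R n) U l : spectral_dec X U l ->
  logmx X = U ^t* *m rdiag (map_mx (@ln R) l) *m U.
Proof.
move=> dX; rewrite -(spectral_map_uniq (@ln R) (spectral_dec_spectralmx X) dX).
have -> : rdiag (map_mx (@ln R) (map_mx (@complex.Re R) (spectral_diag X))) =
    diag_mx (map_mx (fun z => (ln (complex.Re z))%:C%C) (spectral_diag X)).
  by congr diag_mx; apply/rowP => i; rewrite !mxE.
by rewrite -invmx_unitary ?spectral_unitarymx.
Qed.

Lemma quad_form_factor n (X : hermmx R n) (S : 'M[C]_n) l (v : 'cV[C]_n) :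
  X = S ^t* *m rdiag l *m S :> 'M[C]_n ->
  quad_form X v = (\sum_i l 0 i * csqr ((S *m v) i 0))%:C%C.
Proof.
move=> XS; rewrite /quad_form XS.
have -> : v ^t* *m (S ^t* *m rdiag l *m S) *m v = (S *m v) ^t* *m rdiag l *m (S *m v).
  by rewrite adjmxM !mulmxA.
have := trace_rdiag_form l (S *m v); rewrite /mxtrace !big_ord1 => ->.
by [].
Qed.

Lemma pd_spectral n (X : hermmx R n) U l : spectral_dec X U l ->
  pd X <-> forall i, 0 < l 0 i.
Proof.
move=> [hU XU]; have [UU' U'U] := unitary_adjmx hU; split=> [pX i|l0 v v0].
  have := pX (U ^t* *m delta_mx i 0); rewrite (quad_form_factor _ XU) mulmxA UU' mul1mx.
  rewrite (bigD1 i)//= big1 => [|j ji]; last first.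
    by rewrite mxE (negbTE ji) /csqr /= expr0n/= addr0 mulr0.
  rewrite addr0 mxE !eqxx /csqr /= expr0n expr1n /= addr0 mulr1 ltcR; apply.
  apply/eqP => /(congr1 (fun v => (U *m v) i 0)).
  by rewrite mulmxA UU' mul1mx mulmx0 !mxE !eqxx => /eqP; rewrite oner_eq0.
rewrite (quad_form_factor _ XU) ltcR lt_neqAle eq_sym sumr_ge0 ?andbT; last first.
  by move=> i _; rewrite mulr_ge0 ?csqr_ge0// ltW.
rewrite psumr_eq0 => [|i _]; last by rewrite mulr_ge0 ?csqr_ge0// ltW.
apply: contra v0 => /allP h; rewrite -[v]mul1mx -U'U -mulmxA.
suff -> : U *m v = 0 by rewrite mulmx0.
apply/colP => i; rewrite [RHS]mxE; apply/eqP; rewrite -csqr_eq0.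
by have := h i (mem_index_enum _); rewrite mulf_eq0 gt_eqF.
Qed.

Lemma psd_spectral n (X : hermmx R n) U l : spectral_dec X U l ->
  psd X <-> forall i, 0 <= l 0 i.
Proof.
move=> [hU XU]; have [UU' U'U] := unitary_adjmx hU; split=> [pX i|l0 v].
  have := pX (U ^t* *m delta_mx i 0); rewrite (quad_form_factor _ XU) mulmxA UU' mul1mx.
  rewrite (bigD1 i)//= big1 => [|j ji]; last first.
    by rewrite mxE (negbTE ji) /csqr /= expr0n/= addr0 mulr0.
  by rewrite addr0 mxE !eqxx /csqr /= expr0n expr1n /= addr0 mulr1 lecR.
rewrite (quad_form_factor _ XU) lecR; apply: sumr_ge0 => i _.
by rewrite mulr_ge0 ?csqr_ge0.
Qed.

Lemma pd_psd n (X : hermmx R n) : pd X -> psd X.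
Proof.
have [U [l d]] := spectral_exists X.
by move=> /(pd_spectral d) l0; apply/(psd_spectral d) => i; exact: ltW.
Qed.

Lemma det_rdiag n (l : 'rV[R]_n) : \det (rdiag l) = (\prod_i l 0 i)%:C%C.
Proof.
by rewrite det_diag rmorph_prod; apply: eq_bigr => i _; rewrite mxE.
Qed.

Lemma det_adjmx n (S : 'M[C]_n) : \det (S ^t*) = (\det S)^*.
Proof. by rewrite -det_tr -map_trmx trmxK det_map_mx. Qed.

Lemma det_factor n (S : 'M[C]_n) (l : 'rV[R]_n) :
  \det (S ^t* *m rdiag l *m S) = (csqr (\det S) * \prod_i l 0 i)%:C%C.
Proof.
by rewrite !det_mulmx det_adjmx det_rdiag mulrAC csqrE rmorphM.
Qed.

Lemma det_spectral n (X U : 'M[C]_n) l : spectral_dec X U l ->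
  \det X = (\prod_i l 0 i)%:C%C.
Proof.
move=> [hU ->]; rewrite det_factor -det_factor.
have [_ U'U] := unitary_adjmx hU.
by rewrite !det_mulmx mulrAC -det_mulmx U'U det1 mul1r det_rdiag.
Qed.

(** Congruence by the inverse square root of [X] reduces the pencil to a single
    Hermitian matrix, which is then diagonalised by a unitary. *)
Lemma simultaneous_diag n (X H : hermmx R n) : pd X ->
  exists S (d : 'rV[R]_n), [/\ S \in unitmx, X = S ^t* *m S :> 'M[C]_n &
    H = S ^t* *m rdiag d *m S :> 'M[C]_n].
Proof.
have [U [l dX]] := spectral_exists X; move=> /(pd_spectral dX) l0.
have [hU XU] := dX.
pose q : 'rV[R]_n := map_mx Num.sqrt l.
pose S0 := rdiag q *m U.
have uS0 : S0 \in unitmx.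
  rewrite unitmx_mul (unitarymx_unit hU) andbT unitmxE unitfE det_rdiag.
  rewrite -[X in _ != X]/((0 : R)%:C%C) (inj_eq (@complexI R)).
  by apply/prodf_neq0 => i _; rewrite mxE gt_eqF// sqrtr_gt0.
have XS0 : X = S0 ^t* *m S0 :> 'M[C]_n.
  rewrite XU /S0 adjmxM adjmx_rdiag !mulmxA; congr (_ *m _).
  rewrite -mulmxA rdiagM; congr (_ *m rdiag _).
  by apply/rowP => i; rewrite !mxE -expr2 sqr_sqrtr// ltW.
clearbody S0; pose K := (invmx S0) ^t* *m H *m invmx S0.
have [K' K'E] : exists K' : hermmx R n, K' = K :> 'M[C]_n.
  by apply: hermmx_of_adj; rewrite /K !adjmxM adjmxK hermmxP mulmxA.
have [V [d [hV KV]]] := spectral_exists K'.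
have [VV' V'V] := unitary_adjmx hV.
exists (V *m S0), d; split.
- by rewrite unitmx_mul uS0 (unitarymx_unit hV).
- by rewrite adjmxM -mulmxA [V ^t* *m _]mulmxA V'V mul1mx.
have -> : (V *m S0) ^t* *m rdiag d *m (V *m S0) = S0 ^t* *m K *m S0.
  by rewrite -K'E KV adjmxM !mulmxA.
by rewrite /K !mulmxA -adjmxM mulVmx// mulmxKV// trmx1 map_mx1 mul1mx.
Qed.

End Spectral.

(** * The relative entropy as an integral of matrix-fractional functions *)

Section Overlap.
Variables (R : realType) (n : nat).
Local Notation C := R[i].
Local Notation M := 'M[C]_n.

Lemma ReD (x y : C) : complex.Re (x + y) = complex.Re x + complex.Re y.
Proof. by case: x y => ? ? []. Qed.

Lemma ReB (x y : C) : complex.Re (x - y) = complex.Re x - complex.Re y.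
Proof. by case: x y => ? ? []. Qed.

Lemma ReZ (a : R) (x : C) : complex.Re (a%:C%C * x) = a * complex.Re x.
Proof. by case: x => ? ? /=; rewrite mul0r subr0. Qed.

(** The squared modulus of the scalar product of an eigenvector of [X] and one of [Y],
    when [U] and [V] diagonalise [X] and [Y]. *)
Definition overlap (U V : M) i j : R := csqr ((U *m V ^t*) i j).

Lemma trace_diag2 (W : M) (a b : 'rV[R]_n) :
  \tr (W ^t* *m (rdiag a *m W *m rdiag b)) =
  (\sum_i \sum_j csqr (W i j) * (a 0 i * b 0 j))%:C%C.
Proof.
rewrite mxtrace_mulC -sum_realC; apply: eq_bigr => i _; rewrite mxE -sum_realC.
apply: eq_bigr => j _; rewrite mul_mx_rdiag mul_rdiag_mx !mxE.
by rewrite !rmorphM /= -csqrE; ring.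
Qed.

Lemma trace_spectral2 (U V : M) (a b : 'rV[R]_n) :
  \tr (U ^t* *m rdiag a *m U *m (V ^t* *m rdiag b *m V)) =
  (\sum_i \sum_j overlap U V i j * (a 0 i * b 0 j))%:C%C.
Proof.
pose W := U *m V ^t*.
have -> : U ^t* *m rdiag a *m U *m (V ^t* *m rdiag b *m V) =
    (U ^t* *m rdiag a *m W *m rdiag b) *m V by rewrite /W !mulmxA.
have hW : V *m U ^t* = W ^t* by rewrite /W adjmxM adjmxK.
rewrite mxtrace_mulC /overlap -/W; clearbody W.
have -> : V *m (U ^t* *m rdiag a *m W *m rdiag b) = W ^t* *m (rdiag a *m W *m rdiag b).
  by rewrite -hW !mulmxA.
exact: trace_diag2.
Qed.

Lemma csqr_unitary_row (W : M) i : W \is unitarymx -> \sum_j csqr (W i j) = 1.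
Proof.
move=> /unitarymxP /(congr1 (fun A : M => A i i)); rewrite !mxE eqxx /= => WWi.
apply: (@complexI R); rewrite -sum_realC; apply: etrans WWi.
by apply: eq_bigr => j _; rewrite !mxE mulrC csqrE.
Qed.

Lemma overlap_row (U V : M) i : U \is unitarymx -> V \is unitarymx ->
  \sum_j overlap U V i j = 1.
Proof.
move=> hU hV; have hV' : V ^t* \is unitarymx by rewrite trmxC_unitary.
exact: csqr_unitary_row (mul_unitarymx hU hV').
Qed.

Lemma overlap_ge0 (U V : M) i j : 0 <= overlap U V i j.
Proof. exact: csqr_ge0. Qed.

(** In eigenbases the relative entropy is a combination, with the overlaps as weights,
    of scalar relative entropies; scalar inequalities transfer termwise. *)
Lemma qre_pd_spectral (X Y : hermmx R n) U V l m :
  spectral_dec X U l -> spectral_dec Y V m ->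
  qre_pd X Y = \sum_i \sum_j overlap U V i j * (l 0 i * (ln (l 0 i) - ln (m 0 j))).
Proof.
move=> dX dY; have [hU XU] := dX; have [hV YV] := dY.
rewrite /qre_pd (logmx_spectral dX) (logmx_spectral dY) raddfB /= ReB XU.
have [UU' U'U] := unitary_adjmx hU.
rewrite !trace_spectral2 /= -sumrB; apply: eq_bigr => i _.
have -> : \sum_j overlap U U i j * (l 0 i * (map_mx (@ln R) l) 0 j) = l 0 i * ln (l 0 i).
  rewrite (bigD1 i)//= big1 => [|j ji]; rewrite /overlap UU' !mxE.
    by rewrite eqxx /csqr /= expr0n expr1n /= !addr0 mul1r.
  by rewrite eq_sym (negbTE ji) /csqr /= expr0n /= addr0 mul0r.
rewrite -[l 0 i * ln _]mul1r -(overlap_row i hU hV) mulr_suml -sumrB.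
by apply: eq_bigr => j _; rewrite !mxE; ring.
Qed.

End Overlap.

Section ScalarIntegral.
Variable R : realType.

Lemma segment_gt0 (a b s : R) : 0 < a -> 0 < b -> 0 <= s <= 1 -> 0 < (1 - s) * a + s * b.
Proof.
move=> a0 b0 /andP[s0 s1].
have [->|sn0] := eqVneq s 0; first by rewrite subr0 mul1r mul0r addr0.
by rewrite ltr_wpDl// ?mulr_ge0 ?subr_ge0 ?(ltW a0)// mulr_gt0// lt_def sn0.
Qed.

Lemma is_derive_segment (a b s : R) :
  is_derive s 1 (fun s : R => (1 - s) * a + s * b : R^o) (b - a).
Proof.
have -> : (fun s : R => (1 - s) * a + s * b : R^o) = (fun s => a + (b - a) *: s).
  by apply/funext => t; rewrite [(b - a) *: t]mulrC; ring.
have := is_deriveD (is_derive_cst (a : R^o) (s : R^o) (1 : R^o))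
  (is_deriveZ (b - a) (is_derive_id (s : R^o) (1 : R^o))).
by rewrite add0r [_ *: 1]mulr1.
Qed.

Lemma segment_inv_continuous (a b c : R) : 0 < a -> 0 < b ->
  continuous01 (fun s => c / ((1 - s) * a + s * b)).
Proof.
move=> a0 b0 s s01; apply: cvgM; first exact: cvg_cst.
apply: cvgV; first by rewrite gt_eqF// segment_gt0.
have [/derivable1_diffP/differentiable_continuous + _] := is_derive_segment a b s.
exact.
Qed.

Lemma unit_int_ln (a b : R) : 0 < a -> 0 < b ->
  unit_int (fun s => a * (a - b) / ((1 - s) * a + s * b)) = a * (ln a - ln b).
Proof.
move=> a0 b0; pose F (s : R) := - a * ln ((1 - s) * a + s * b).
have dF (s : R) : 0 <= s <= 1 ->
    is_derive s 1 (F : R -> R^o) (a * (a - b) / ((1 - s) * a + s * b)).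
  move=> s01.
  have d1 := @is_derive1_comp R (@ln R) (fun s : R => (1 - s) * a + s * b) s _ _
    (is_derive1_ln (segment_gt0 a0 b0 s01)) (is_derive_segment a b s).
  have := is_deriveZ (- a) d1; congr (is_derive _ _ _ _).
  by rewrite [_ *: _]mulrA; ring.
rewrite (unit_int_FTC (segment_inv_continuous a0 b0) dF).
by rewrite /F subrr subr0 !mul0r !mul1r addr0 add0r; ring.
Qed.

End ScalarIntegral.

Section Relmx.
Variables (R : realType) (n : nat).
Local Notation C := R[i].
Local Notation M := 'M[C]_n.

Definition relop (s : R) (X Y Z : M) : M :=
  (1 - s)%:C%C *: (X *m Z) + s%:C%C *: (Z *m Y).

Definition relmx (s : R) (X Y : M) : 'M[C]_(n * n) :=
  (1 - s)%:C%C *: lin_mx (mulmx X) + s%:C%C *: lin_mx (mulmxr Y).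

Definition relinv (s : R) (X Y Z : M) : M := vec_mx (mxvec Z *m invmx (relmx s X Y)).

Lemma mul_relmx s X Y Z : mxvec Z *m relmx s X Y = mxvec (relop s X Y Z).
Proof. by rewrite /relmx mulmxDr -!scalemxAr !mul_vec_lin /relop linearD !linearZ. Qed.

Lemma relopK s X Y Z : relmx s X Y \in unitmx -> relinv s X Y (relop s X Y Z) = Z.
Proof. by move=> uB; rewrite /relinv -mul_relmx mulmxK// mxvecK. Qed.

Lemma relinvK s X Y Z : relmx s X Y \in unitmx -> relop s X Y (relinv s X Y Z) = Z.
Proof.
move=> uB; apply: (can_inj mxvecK); rewrite -mul_relmx /relinv vec_mxK.
by rewrite mulmxKV.
Qed.

Definition frobform (X Z : M) : R := complex.Re (\tr (Z ^t* *m X *m Z)).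

Lemma frobform_factor (X S Z : M) (d : 'rV[R]_n) : X = S ^t* *m rdiag d *m S ->
  frobform X Z = \sum_j \sum_i d 0 i * csqr ((S *m Z) i j).
Proof.
move=> ->; rewrite /frobform.
have -> : Z ^t* *m (S ^t* *m rdiag d *m S) *m Z = (S *m Z) ^t* *m rdiag d *m (S *m Z).
  by rewrite adjmxM !mulmxA.
by rewrite trace_rdiag_form.
Qed.

Lemma frobform_gt0 (X : hermmx R n) (Z : M) : pd X -> Z != 0 -> 0 < frobform X Z.
Proof.
have [U [l dX]] := spectral_exists X => /(pd_spectral dX) l0 Z0.
have [hU XU] := dX; have [UU' U'U] := unitary_adjmx hU.
have ge0 i j : 0 <= l 0 i * csqr ((U *m Z) i j) by rewrite mulr_ge0 ?csqr_ge0 ?ltW.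
rewrite (frobform_factor _ XU) lt_neqAle eq_sym sumr_ge0 ?andbT; last first.
  by move=> j _; apply: sumr_ge0.
rewrite psumr_eq0 => [|j _]; last exact: sumr_ge0.
apply: contra Z0 => /allP h; rewrite -[Z]mul1mx -U'U -mulmxA.
suff -> : U *m Z = 0 by rewrite mulmx0.
apply/matrixP => i j; rewrite [RHS]mxE; apply/eqP; rewrite -csqr_eq0.
have := h j (mem_index_enum _); rewrite /= psumr_eq0// => /allP/(_ i (mem_index_enum _)).
by rewrite /= mulf_eq0 gt_eqF.
Qed.

Definition relform (s : R) (X Y Z : M) : R :=
  (1 - s) * frobform X Z + s * frobform Y (Z ^t*).

Lemma two_sided_form (a b : C) (X Y Z : M) :
  \tr (Z ^t* *m (a *: (X *m Z) + b *: (Z *m Y))) =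
  a * \tr (Z ^t* *m X *m Z) + b * \tr ((Z ^t*) ^t* *m Y *m Z ^t*).
Proof.
rewrite adjmxK mulmxDr -!scalemxAr mxtraceD !mxtraceZ mulmxA.
by rewrite [\tr (Z ^t* *m (Z *m Y))]mxtrace_mulC.
Qed.

Lemma two_sided_conj (a b : C) (U V D1 D2 Z : M) :
  U \is unitarymx -> V \is unitarymx ->
  a *: ((U ^t* *m D1 *m U) *m (U ^t* *m Z *m V)) +
  b *: ((U ^t* *m Z *m V) *m (V ^t* *m D2 *m V)) =
  U ^t* *m (a *: (D1 *m Z) + b *: (Z *m D2)) *m V.
Proof.
move=> hU hV; rewrite mulmxDr mulmxDl -!scalemxAr -!scalemxAl !mulmxA.
by rewrite !mulmxtVK.
Qed.

Lemma conj_mulmx_left (U V D Z : M) : U \is unitarymx ->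
  (U ^t* *m D *m U) *m (U ^t* *m Z *m V) = U ^t* *m (D *m Z *m V).
Proof. by move=> hU; rewrite !mulmxA mulmxtVK. Qed.

Lemma relformE s X Y Z :
  complex.Re (\tr (Z ^t* *m relop s X Y Z)) = relform s X Y Z.
Proof.
by rewrite /relop two_sided_form ReD !ReZ.
Qed.

Lemma relform_gt0 s (X Y : hermmx R n) Z : pd X -> pd Y -> 0 <= s <= 1 -> Z != 0 ->
  0 < relform s X Y Z.
Proof.
move=> pX pY s01 Z0; apply: segment_gt0 => //; first exact: frobform_gt0.
apply: frobform_gt0 => //; apply: contra Z0 => /eqP Z0.
by rewrite -[Z]adjmxK Z0 trmx0 map_mx0.
Qed.

(** The quadratic form is positive definite, hence the kernel is trivial. *)
Lemma relmx_unit s (X Y : hermmx R n) : pd X -> pd Y -> 0 <= s <= 1 ->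
  relmx s X Y \in unitmx.
Proof.
move=> pX pY s01; rewrite -row_free_unit -kermx_eq0.
apply/eqP/row_matrixP => i; rewrite row0.
have : row i (kermx (relmx s X Y)) *m relmx s X Y = 0.
  by apply/sub_kermxP; exact: row_sub.
set v := row _ _; rewrite -[v]vec_mxK mul_relmx => BZ0.
apply/eqP; apply: contraT => v0.
have Z0 : vec_mx v != 0 by apply: contra v0 => /eqP Z0; rewrite Z0 linear0.
have := relform_gt0 pX pY s01 Z0; rewrite -relformE.
have -> : relop s X Y (vec_mx v) = 0 by apply: (can_inj mxvecK); rewrite BZ0 linear0.
by rewrite mulmx0 mxtrace0 ltxx.
Qed.

(** In eigenbases [relop] multiplies the entries by [(1 - s) l_i + s m_j]. *)
Lemma relop_diag s (W : M) (l m : 'rV[R]_n) (q : 'I_n -> 'I_n -> R) :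
  (forall i j, ((1 - s) * l 0 i + s * m 0 j) * q i j = l 0 i - m 0 j) ->
  let Z := \matrix_(i, j) (W i j * (q i j)%:C%C) in
  (1 - s)%:C%C *: (rdiag l *m Z) + s%:C%C *: (Z *m rdiag m) =
  rdiag l *m W - W *m rdiag m.
Proof.
move=> hq Z; apply/matrixP => i j.
rewrite [LHS]mxE [RHS]mxE [X in X + _]mxE [X in _ + X]mxE [X in _ = _ + X]mxE.
rewrite !mul_rdiag_mx !mul_mx_rdiag !mxE.
transitivity (W i j * (((1 - s) * l 0 i + s * m 0 j) * q i j)%:C%C).
  by rewrite !(rmorphM, rmorphD) /=; ring.
by rewrite hq rmorphB /=; ring.
Qed.

Lemma trace_diag_hadamard (W : M) (l : 'rV[R]_n) (q : 'I_n -> 'I_n -> R) :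
  \tr (rdiag l *m ((\matrix_(i, j) (W i j * (q i j)%:C%C)) *m W ^t*)) =
  (\sum_i \sum_j csqr (W i j) * (l 0 i * q i j))%:C%C.
Proof.
rewrite -sum_realC; apply: eq_bigr => i _; rewrite mul_rdiag_mx mxE -sum_realC.
rewrite mulr_sumr; apply: eq_bigr => j _; rewrite !mxE !rmorphM /= -csqrE; ring.
Qed.

Definition qre_integrand (s : R) (X Y : M) : R :=
  complex.Re (\tr (X *m relinv s X Y (X - Y))).

Lemma qre_integrand_spectral s (X Y : hermmx R n) U V l m :
  pd X -> pd Y -> 0 <= s <= 1 -> spectral_dec X U l -> spectral_dec Y V m ->
  qre_integrand s X Y = \sum_i \sum_j overlap U V i j *
     (l 0 i * (l 0 i - m 0 j) / ((1 - s) * l 0 i + s * m 0 j)).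
Proof.
move=> pX pY s01 dX dY; have [hU XU] := dX; have [hV YV] := dY.
have [UU' U'U] := unitary_adjmx hU; have [VV' V'V] := unitary_adjmx hV.
have l0 := (pd_spectral dX).1 pX; have m0 := (pd_spectral dY).1 pY.
pose W := U *m V ^t*.
pose q i j : R := (l 0 i - m 0 j) / ((1 - s) * l 0 i + s * m 0 j).
pose Z' : M := \matrix_(i, j) (W i j * (q i j)%:C%C).
pose Z := U ^t* *m Z' *m V.
have BZ : relop s X Y Z = (X : M) - Y.
  have -> : relop s X Y Z = U ^t* *m ((1 - s)%:C%C *: (rdiag l *m Z') +
      s%:C%C *: (Z' *m rdiag m)) *m V.
    by rewrite /relop {1}XU YV; exact: two_sided_conj.
  have -> : (X : M) - Y = U ^t* *m (rdiag l *m W - W *m rdiag m) *m V.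
    rewrite mulmxBr mulmxBl /W !mulmxA U'U mul1mx.
    by rewrite mulmxKtV// -XU -YV.
  rewrite -(@relop_diag s W l m q)// => i j.
  by rewrite /q mulrCA mulfV ?mulr1// gt_eqF// segment_gt0.
rewrite /qre_integrand -BZ relopK ?relmx_unit//.
have -> : (X : M) *m Z = U ^t* *m (rdiag l *m Z' *m V).
  by rewrite {1}XU /Z; exact: conj_mulmx_left.
rewrite mxtrace_mulC -!mulmxA -[V *m U ^t*]adjmxK adjmxM adjmxK.
rewrite trace_diag_hadamard /=.
apply: eq_bigr => i _; apply: eq_bigr => j _.
by rewrite /q /overlap -/W; ring.
Qed.

(** In eigenbases both sides are combinations, with the same weights, of the two sides
    of the scalar identity. *)
Lemma qre_integral (X Y : hermmx R n) : pd X -> pd Y ->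
  qre_pd X Y = unit_int (fun s => qre_integrand s X Y).
Proof.
move=> pX pY; have [U [l dX]] := spectral_exists X.
have [V [m dY]] := spectral_exists Y.
have l0 := (pd_spectral dX).1 pX; have m0 := (pd_spectral dY).1 pY.
rewrite (eq_unit_int (fun s s01 => qre_integrand_spectral pX pY s01 dX dY)).
rewrite (qre_pd_spectral dX dY).
have cF i j : continuous01 (fun s => overlap U V i j *
     (l 0 i * (l 0 i - m 0 j) / ((1 - s) * l 0 i + s * m 0 j))).
  by apply: continuous01Z; exact: segment_inv_continuous.
rewrite unit_int_sum => [|i]; last exact: continuous01_sum.
apply: eq_bigr => i _; rewrite unit_int_sum//; apply: eq_bigr => j _.
by rewrite unit_intZ ?unit_int_ln//; exact: segment_inv_continuous.
Qed.

End Relmx.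

(** * Taylor coefficients *)

Section FlatJets.
Variable R : realType.

Lemma is_derive_power (c : R) k (t : R) :
  is_derive t 1 (fun t => c / k.+1%:R * t ^+ k.+1 : R^o) (c * t ^+ k).
Proof.
have := is_deriveZ (c / k.+1%:R) (is_deriveX k.+1 (is_derive_id (t : R^o) (1 : R^o))).
congr (is_derive _ _ _ _).
  by apply/funext => u; rewrite exprfctE.
by rewrite /GRing.scale /= mulr1 mulrA divfK.
Qed.

Lemma power_lower_bound (f df : R -> R) (c d : R) k : 0 <= f 0 ->
  (forall t, 0 <= t <= d -> is_derive t 1 (f : R -> R^o) (df t)) ->
  (forall t, 0 <= t <= d -> c * t ^+ k <= df t) ->
  forall t, 0 <= t <= d -> c / k.+1%:R * t ^+ k.+1 <= f t.
Proof.
move=> f0 dF cf t /andP[t0 td].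
pose g (t : R) := f t - c / k.+1%:R * t ^+ k.+1.
have sub u : 0 <= u <= t -> 0 <= u <= d.
  by move=> /andP[-> ut]; exact: le_trans td.
have : g 0 <= g t.
  apply: (@nondecreasing_MVT R g (fun t => df t - c * t ^+ k)) => // u /sub ud.
    exact: (is_deriveB (dF u ud) (is_derive_power c k u)).
  by rewrite subr_ge0 cf.
by rewrite /g expr0n /= mulr0 subr0 => /(le_trans f0); rewrite subr_ge0.
Qed.

(** As [j < k], a lower bound of order [t ^ j] is incompatible with an upper bound of
    order [t ^ k] at small times. *)
Lemma power_contradiction (c d M : R) j k : 0 < c -> 0 < d -> (j < k)%N ->
  (forall t, 0 <= t <= d -> c * t ^+ j <= M * t ^+ k) -> False.
Proof.
move=> c0 d0 jk h.
pose t := Num.min (Num.min d 1) (c / (2 * (`|M| + 1))).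
have M1 : 0 < `|M| + 1 by rewrite ltr_wpDl.
have t0 : 0 < t by rewrite !lt_min d0 ltr01 divr_gt0// mulr_gt0.
have td : t <= d by rewrite !ge_min lexx.
have t1 : t <= 1 by rewrite !ge_min lexx orbT.
have tc : t <= c / (2 * (`|M| + 1)) by rewrite ge_min lexx orbT.
have := h t; rewrite (ltW t0) td => /(_ isT).
rewrite -(subnKC jk) addSnnS exprD mulrCA [c * _]mulrC ler_pM2l ?exprn_gt0// => cM.
have : M * t ^+ (k - j.+1).+1 <= (`|M| + 1) * t.
  apply: (@le_trans _ _ ((`|M| + 1) * t ^+ (k - j.+1).+1)).
    by rewrite ler_pM2r ?exprn_gt0// (le_trans (ler_norm M))// lerDl.
  by rewrite ler_pM2l// exprS ger_pMr// exprn_ile1// ltW.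
move: tc; rewrite ler_pdivlMr ?mulr_gt0//; move: cM; nra.
Qed.

Lemma continuous_lower (f : R -> R) : {for 0, continuous (f : R -> R^o)} -> 0 < f 0 ->
  exists2 d : R, 0 < d & forall t, 0 <= t <= d -> f 0 / 2 <= f t.
Proof.
move=> cf f0; have f20 : 0 < f 0 / 2 by rewrite divr_gt0.
have /cvgrPdist_le /(_ _ f20) [d /= d0 dH] := cf.
exists (d / 2); first by rewrite divr_gt0.
move=> t /andP[t0 td]; have := dH t; rewrite /ball_ /= sub0r normrN ger0_norm//.
have -> : t < d by lra.
by move=> /(_ isT); rewrite ler_norml => /andP[_]; lra.
Qed.

(** A positive value, bounded below near 0 and integrated [k] times, would give
    growth of order [t ^ k]. *)
Lemma flat_jet_le0 (f : nat -> R -> R) (d M : R) m k : 0 < d ->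
  (forall j t, (j < m)%N -> 0 <= t <= d -> is_derive t 1 (f j : R -> R^o) (f j.+1 t)) ->
  (forall t, 0 <= t <= d -> `|f 0%N t| <= M * t ^+ m.+1) ->
  (k <= m)%N -> {for 0, continuous (f k : R -> R^o)} ->
  (forall j, (j < k)%N -> f j 0 = 0) -> f k 0 <= 0.
Proof.
move=> d0 df small km ck fz; rewrite leNgt; apply/negP => pos.
have [d' d'0 low] := continuous_lower ck pos.
have D0 : 0 < Num.min d d' by rewrite lt_min d0.
have sub t : 0 <= t <= Num.min d d' -> 0 <= t <= d /\ 0 <= t <= d'.
  by rewrite le_min => /and3P[-> -> ->].
have grow j : (j <= k)%N -> exists2 c, 0 < c &
    forall t, 0 <= t <= Num.min d d' -> c * t ^+ j <= f (k - j)%N t.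
  elim: j => [_|j IH jk].
    exists (f k 0 / 2) => [|t /sub[_ /low]]; first by rewrite divr_gt0.
    by rewrite expr0 mulr1 subn0.
  have [c c0 cf] := IH (ltnW jk).
  exists (c / j.+1%:R) => [|t]; first by rewrite divr_gt0.
  apply: (@power_lower_bound _ (f (k - j)%N)) => [|u /sub[ud _]|]; last exact: cf.
    by rewrite fz// ltn_subrL (leq_ltn_trans _ jk).
  rewrite -(subnSK jk); apply: df => //.
  by rewrite (leq_trans _ km)// ltn_subrL (leq_ltn_trans _ jk).
have [c c0 cf] := grow k (leqnn k).
apply: (@power_contradiction c _ M k m.+1 c0 D0 km) => t tD.
apply: le_trans (cf t tD) _; rewrite subnn; have [td _] := sub t tD.
exact: le_trans (ler_norm _) (small t td).
Qed.

Lemma flat_jet (f : nat -> R -> R) (d M : R) m : 0 < d ->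
  (forall j t, (j < m)%N -> 0 <= t <= d -> is_derive t 1 (f j : R -> R^o) (f j.+1 t)) ->
  (forall t, 0 <= t <= d -> `|f 0%N t| <= M * t ^+ m.+1) ->
  {for 0, continuous (f m : R -> R^o)} -> forall k, (k <= m)%N -> f k 0 = 0.
Proof.
move=> d0 df small cm; elim/ltn_ind => k IH km.
have {}IH j : (j < k)%N -> f j 0 = 0 by move=> jk; apply: IH => //; exact/ltnW/(leq_trans jk).
have ck : {for 0, continuous (f k : R -> R^o)}.
  move: km; rewrite leq_eqVlt => /predU1P[->//|km].
  have [|/derivable1_diffP/differentiable_continuous + _] := df k 0 km; last exact.
  by rewrite lexx ltW.
pose g j t := - f j t.
apply/le_anti; rewrite (flat_jet_le0 d0 df small km ck IH) /= -oppr_le0.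
apply: (@flat_jet_le0 g d M m k) => // [j t jm td|t td||j jk].
- exact: is_deriveN (df j t jm td).
- by rewrite /g normrN small.
- exact: cvgN.
- by rewrite /g IH ?oppr0.
Qed.

End FlatJets.

Lemma is_derive_cast (R : realType) (f g : R -> R) (t d d' : R) :
  is_derive t 1 (f : R -> R^o) d -> (forall u, f u = g u) -> d = d' ->
  is_derive t 1 (g : R -> R^o) d'.
Proof. by move=> df fg <-; have -> : g = f by apply/funext. Qed.

(** Derivatives of order two and three are the coefficients of any expansion with an
    error of order four; for the integrand such an expansion is a matter of algebra. *)
Lemma taylor3_unique (R : realType) (E : normedModType R) (A : set E) (F : E -> R^o)
    (x h : E) (a0 a1 a2 a3 M : R) :
  open A -> continuously_derivable 3 A F -> A x ->
  (\forall t \near (0 : R),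
    `|F (x + t *: h) - (a0 + a1 * t + a2 * t ^+ 2 + a3 * t ^+ 3)| <= M * t ^+ 4) ->
  iter_derive 2 h F x = 2 * a2 /\ iter_derive 3 h F x = 6 * a3.
Proof.
move=> oA cF Ax tay.
have A0 : A (x + 0 *: h) by rewrite scale0r addr0.
have [d /= d0 dH] := filterI (near_line oA A0) tay.
have d20 : 0 < d / 2 by rewrite divr_gt0.
have near0 (t : R) : 0 <= t <= d / 2 -> A (x + t *: h) /\
  `|F (x + t *: h) - (a0 + a1 * t + a2 * t ^+ 2 + a3 * t ^+ 3)| <= M * t ^+ 4.
  by move=> /andP[t0 td]; apply: dH; rewrite /ball_ /= sub0r normrN ger0_norm//; lra.
have pw (c : R) k (t : R) := is_derive_power c k t.
have cst (c t : R) := is_derive_cst (c : R^o) (t : R^o) (1 : R^o).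
pose p (j : nat) (t : R) : R := match j with
  | 0 => a0 + a1 * t + a2 * t ^+ 2 + a3 * t ^+ 3
  | 1 => a1 + 2 * a2 * t + 3 * a3 * t ^+ 2
  | 2 => 2 * a2 + 6 * a3 * t
  | _ => 6 * a3 end.
have dp j (t : R) : (j < 3)%N -> is_derive t 1 (p j : R -> R^o) (p j.+1 t).
  case: j => [|[|[|//]]] _.
  - apply: (is_derive_cast (is_deriveD (cst a0 t) (is_deriveD (pw a1 0%N t)
      (is_deriveD (pw (2 * a2) 1%N t) (pw (3 * a3) 2%N t))))) => [u|]; by rewrite ?fctE /=; field.
  - apply: (is_derive_cast (is_deriveD (cst a1 t) (is_deriveD (pw (2 * a2) 0%N t)
      (pw (6 * a3) 1%N t)))) => [u|]; by rewrite ?fctE /=; field.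
  - apply: (is_derive_cast (is_deriveD (cst (2 * a2) t) (pw (6 * a3) 0%N t))) => [u|];
    by rewrite ?fctE /=; field.
pose f j t := iter_derive j h F (x + t *: h) - p j t.
have jet : forall k, (k <= 3)%N -> f k 0 = 0.
  apply: (@flat_jet R f (d / 2) M 3) => // [j t j3 td|t /near0[_]//|].
    have [At _] := near0 t td.
    exact: is_deriveB (@is_derive_iter_line R E A 3 j h F x t cF j3 At) (dp j t j3).
  apply: (@cvgB _ _ _ _ _ (fun t => iter_derive 3 h F (x + t *: h)) (fun=> 6 * a3)).
    apply: continuous_at_line; apply: (@cd_cont _ _ A 0) A0.
    exact: (@cd_iter_derive _ _ _ 3 0).
  exact: cvg_cst.
have := jet 2%N isT; have := jet 3%N isT.
rewrite /f scale0r addr0 /p mulr0 addr0 => /eqP; rewrite subr_eq0 => /eqP -> /eqP.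
by rewrite subr_eq0 => /eqP ->.
Qed.

(** * Openness of the positive definite cone and smoothness of the integrand *)

Section OpenPd.
Variables (R : realType) (n : nat).
Local Notation C := R[i].
Local Notation H := (hermmx R n).

Lemma trace_form1 m p (M : 'M[C]_(m, p)) :
  \tr (M ^t* *m M) = (\sum_j \sum_i csqr (M i j))%:C%C.
Proof.
have := trace_rdiag_form (const_mx 1) M; rewrite rdiag1 mulmx1 => ->.
congr (_%:C%C); apply: eq_bigr => j _; apply: eq_bigr => i _.
by rewrite mxE mul1r.
Qed.

Lemma csqr_unitary (U : 'M[C]_n) p (M : 'M[C]_(n, p)) : U \is unitarymx ->
  \sum_j \sum_i csqr ((U *m M) i j) = \sum_j \sum_i csqr (M i j).
Proof.
move=> hU; have [_ U'U] := unitary_adjmx hU.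
apply: (@complexI R); rewrite -!trace_form1 adjmxM.
by rewrite mulmxA -(mulmxA _ (U ^t*)) U'U mulmx1.
Qed.

Lemma spectral_sqr_sum (X : H) U l : spectral_dec X U l ->
  \sum_i l 0 i ^+ 2 = \sum_j \sum_i csqr ((X : 'M[C]_n) i j).
Proof.
move=> [hU XU]; have [UU' U'U] := unitary_adjmx hU.
apply: (@complexI R); rewrite -trace_form1 hermmxP {1}XU XU trace_spectral2 /overlap UU'.
congr (_%:C%C); apply: eq_bigr => i _; rewrite (bigD1 i)//= big1 => [|j ji].
  by rewrite !mxE eqxx /csqr /= expr0n expr1n /= !addr0 mul1r expr2.
by rewrite !mxE eq_sym (negbTE ji) /csqr /= expr0n /= addr0 mul0r.
Qed.

(** The sum of the squares of the eigenvalues is the sum of the squared moduli of the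
    entries. *)
Lemma spectral_norm_le (X : H) U l i : spectral_dec X U l ->
  `|l 0 i| <= (2 * n%:R) * `|X|.
Proof.
move=> dX.
have : l 0 i ^+ 2 <= (2 * n%:R * `|X|) ^+ 2.
  apply: (@le_trans _ _ (\sum_i l 0 i ^+ 2)).
    by rewrite (bigD1 i)//= lerDl; apply: sumr_ge0 => j _; exact: sqr_ge0.
  rewrite (spectral_sqr_sum dX).
  apply: (@le_trans _ _ (\sum_(j < n) \sum_(i < n) 2 * `|X| ^+ 2)).
    apply: ler_sum => j _; apply: ler_sum => k _.
    have [re im] := hermmx_entry_norm X k j.
    rewrite /csqr mulr_natl mulr2n lerD// -[leLHS]real_normK ?num_real//.
      by rewrite ler_pXn2r ?nnegrE.
    by rewrite ler_pXn2r ?nnegrE.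
  rewrite !sumr_const card_ord -mulrnA -[leLHS]mulr_natl !exprMn natrM.
  have : (0 : R) <= n%:R by [].
  have := sqr_ge0 (n%:R : R); have := sqr_ge0 `|X|; nra.
rewrite -[X in X <= _]real_normK ?num_real// ler_pXn2r ?nnegrE//.
Qed.

Lemma sum_csqr_unitary (U : 'M[C]_n) (v : 'cV[C]_n) : U \is unitarymx ->
  \sum_i csqr ((U *m v) i 0) = \sum_i csqr (v i 0).
Proof. by move=> hU; have := csqr_unitary v hU; rewrite !big_ord1. Qed.

(** A perturbation whose eigenvalues are below half the least eigenvalue of [X] in
    modulus preserves positivity. *)
Lemma open_pd : open [set X : H | pd X].
Proof.
rewrite openE => X /= pX; have [U [l dX]] := spectral_exists X.
have l0 := (pd_spectral dX).1 pX.
pose m := \big[Num.min/1]_i l 0 i.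
have m0 : 0 < m by rewrite /m; elim/big_ind : _ => // x y x0 y0; rewrite lt_min x0.
have ml i : m <= l 0 i by exact: bigmin_le_cond.
(* Eigenvalues of a perturbation of norm at most [e] are at most [2 n e <= m / 2]; the
   summand [1] covers [n = 0]. *)
pose e := m / (4 * (n%:R + 1)).
have n1 : 0 < (n%:R + 1 : R) by rewrite ltr_wpDl.
have e0 : 0 < e by rewrite divr_gt0// mulr_gt0.
rewrite /interior; apply/nbhs_ballP; exists e => // Y /=.
rewrite -ball_normE /= => XY v v0.
pose K : H := Y - X; have [V [k dK]] := spectral_exists K.
have kle i : `|k 0 i| <= 2 * n%:R * e.
  apply: le_trans (spectral_norm_le i dK) _; rewrite ler_wpM2l ?mulr_ge0//.
  by rewrite /K distrC ltW.
have km i : - (m / 2) <= k 0 i.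
  rewrite lerNl; apply: le_trans (ler_norm _) _; rewrite normrN.
  apply: le_trans (kle i) _.
  have -> : 2 * n%:R * e = n%:R / (n%:R + 1) * (m / 2) :> R.
    by rewrite /e; field; rewrite gt_eqF.
  by rewrite ger_pMl ?divr_gt0// ler_pdivrMr// mul1r lerDl.
have -> : quad_form Y v = quad_form X v + quad_form K v.
  have YXK : (Y : 'M[C]_n) = (X : 'M[C]_n) + (K : 'M[C]_n) by rewrite /K /= addrC subrK.
  by rewrite /quad_form YXK mulmxDr mulmxDl mxE.
have [hU XU] := dX; have [hV KV] := dK.
rewrite (quad_form_factor v XU) (quad_form_factor v KV) -rmorphD /= ltcR.
pose N := \sum_i csqr (v i 0).
have N0 : 0 < N.
  have [i vi] : exists i, v i 0 != 0.
    apply/existsP; apply: contraR v0 => /existsPn h; apply/eqP/colP => i.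
    by have := h i; rewrite negbK mxE => /eqP.
  rewrite /N (bigD1 i)//= ltr_pwDl ?sumr_ge0// => [|j _]; last exact: csqr_ge0.
  by rewrite lt_def csqr_ge0 csqr_eq0 vi.
have hX : m * N <= \sum_i l 0 i * csqr ((U *m v) i 0).
  rewrite /N -(sum_csqr_unitary v hU) mulr_sumr; apply: ler_sum => i _.
  by rewrite ler_wpM2r ?csqr_ge0.
have hK : - (m / 2) * N <= \sum_i k 0 i * csqr ((V *m v) i 0).
  rewrite /N -(sum_csqr_unitary v hV) mulr_sumr; apply: ler_sum => i _.
  by rewrite ler_wpM2r ?csqr_ge0.
have : 0 < m / 2 * N by rewrite mulr_gt0// divr_gt0.
lra.
Qed.

End OpenPd.

Section IntegrandSmooth.
Variables (R : realType) (n : nat).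
Local Notation C := R[i].
Local Notation H := (hermmx R n).
Local Notation M := 'M[C]_n.
Local Notation E2 := (H * H)%type.
Local Notation P := (R^o * (H * H))%type.

Definition pd2 : set E2 := [set w | pd w.1 /\ pd w.2].

(** The open set on which the integrand is smooth; it contains [0, 1] x [pd2]. *)
Definition relset : set P := [set p : P | \det (relmx p.1 p.2.1 p.2.2) != 0].

Lemma fst_continuous (U V : topologicalType) : continuous (@fst U V).
Proof. by move=> p; exact: cvg_fst. Qed.

Lemma snd_continuous (U V : topologicalType) : continuous (@snd U V).
Proof. by move=> p; exact: cvg_snd. Qed.

Lemma pd2_open : open pd2.
Proof.
apply: openI.
  by apply: (@open_comp _ _ (@fst H H)) (@open_pd R n) => p _; exact: fst_continuous.
by apply: (@open_comp _ _ (@snd H H)) (@open_pd R n) => p _; exact: snd_continuous.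
Qed.

Lemma cdMx_fst (A : set P) k : open A -> cdMx A k (fun p : P => (p.2.1 : M)).
Proof.
move=> oA; apply: cdMx_hermmx => // p.
exact: (@continuous_comp _ _ _ (@snd R^o E2) (@fst H H) p (@snd_continuous _ _ p) (@fst_continuous _ _ _)).
Qed.

Lemma cdMx_snd (A : set P) k : open A -> cdMx A k (fun p : P => (p.2.2 : M)).
Proof.
move=> oA; apply: cdMx_hermmx => // p.
exact: (@continuous_comp _ _ _ (@snd R^o E2) (@snd H H) p (@snd_continuous _ _ p) (@snd_continuous _ _ _)).
Qed.

Lemma cdMx_relmx (A : set P) k : open A ->
  cdMx A k (fun p : P => relmx p.1 p.2.1 p.2.2).
Proof.
move=> oA; have cX := cdMx_fst k oA; have cY := cdMx_snd k oA.
have cs : continuously_derivable k A (fun p : P => p.1 : R^o).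
  by apply: cd_linear => // p; exact: fst_continuous.
have cs' : continuously_derivable k A (fun p : P => 1 - p.1 : R^o).
  by apply: cdB => //; exact: cd_cst.
apply: cdMxD => //; apply: cdMxZ => //; try exact: cdC_real.
  by apply: (cdMx_lin_mx oA) => Z; apply: (cdMxM oA) => //; exact: cdMx_cst.
by apply: (cdMx_lin_mx oA) => Z; apply: (cdMxM oA) => //; exact: cdMx_cst.
Qed.

Lemma relset_open : open relset.
Proof.
have [cr ci] := cdC_det (@openT P) (@cdMx_relmx setT 0 (@openT P)).
have -> : relset = (fun p : P => csqr (\det (relmx p.1 p.2.1 p.2.2)) : R^o) @^-1` [set x | 0 < x].
  apply/seteqP; split => p; rewrite /relset /=.
    by move=> d0; rewrite lt_def csqr_ge0 csqr_eq0 d0.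
  by rewrite lt_def csqr_eq0 => /andP[].
apply: open_comp; last exact: open_gt.
move=> p _; have := cdD (@openT P) (cdM (@openT P) cr cr) (cdM (@openT P) ci ci).
by move=> /cd_cont => /(_ p I); rewrite /csqr.
Qed.

Lemma pd2_relset s w : 0 <= s <= 1 -> pd2 w -> relset (s, w).
Proof.
by move=> s01 [pX pY]; rewrite /relset /= -unitfE -unitmxE; exact: relmx_unit.
Qed.

Lemma cdMx_relinv k (Z : P -> M) : cdMx relset k Z ->
  cdMx relset k (fun p : P => relinv p.1 p.2.1 p.2.2 (Z p)).
Proof.
move=> cZ; have oB := relset_open.
apply: (cdMx_vec_mx oB); apply: (cdMxM oB); first exact: cdMx_mxvec.
by apply: (cdMx_invmx oB) => //; exact: cdMx_relmx.
Qed.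

Lemma cd_qre_integrand k :
  continuously_derivable k relset (fun p : P => qre_integrand p.1 p.2.1 p.2.2 : R^o).
Proof.
have oB := relset_open.
suff [] : cdC relset k (fun p : P => \tr ((p.2.1 : M) *m relinv p.1 p.2.1 p.2.2 ((p.2.1 : M) - p.2.2))) by [].
apply: (cdC_trace oB); apply: (cdMxM oB); first exact: cdMx_fst.
by apply: cdMx_relinv; apply: (cdMxB oB); [exact: cdMx_fst|exact: cdMx_snd].
Qed.

End IntegrandSmooth.

(** * Third order expansion of a matrix-fractional function *)

Section FractionalExpansion.
Variables (R : realType) (n : nat).
Local Notation C := R[i].
Local Notation M := 'M[C]_n.

Lemma adjmxZ (a : C) (A : M) : (a *: A) ^t* = a^* *: A ^t*.
Proof. by rewrite linearZ /= map_mxZ. Qed.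

Lemma adjmxD (A B : M) : (A + B) ^t* = A ^t* + B ^t*.
Proof. by rewrite linearD /= map_mxD. Qed.

Definition selfadj (N : M -> M) :=
  forall A B, \tr (A ^t* *m N B) = \tr ((N A) ^t* *m B).

(** For the pencil [Nt = N + t B], the matrix [z + t u] solves [Nt _ = Xt] up to
    an error of order [t ^+ 2], which self-adjointness squares. Thus the error term
    is of order four and the coefficient of order three involves [u] only. *)
Lemma frac_expansion (N B Nt : {linear M -> M}) (X K Xt z u e zt : M) (t : C) :
  selfadj N -> selfadj B -> selfadj Nt -> injective Nt -> t^* = t ->
  (forall Z, Nt Z = N Z + t *: B Z) -> Xt = X + t *: K ->
  X ^t* = X -> K ^t* = K ->
  N z = X -> N u = K - B z -> Nt e = B u -> Nt zt = Xt ->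
  \tr (Xt *m zt) =
    \tr (X *m z) + t * (\tr (K *m z) + \tr (X *m u)) +
    t ^+ 2 * \tr (u ^t* *m N u) + t ^+ 3 * - \tr (u ^t* *m B u) +
    t ^+ 4 * \tr (e ^t* *m B u).
Proof.
move=> sN sB sNt iNt tt NtE XtE hX hK Nz Nu Nte Ntzt.
have zte : z + t *: u = zt + t ^+ 2 *: e.
  apply: iNt; rewrite linearD [RHS]linearD !linearZ /= Nte Ntzt !NtE Nz Nu XtE.
  rewrite scalerDr scalerA -expr2 scalerBr addrA addrACA.
  by rewrite subrr addr0.
have ztE : zt = z + t *: u - t ^+ 2 *: e by rewrite zte addrK.
have hXt : Xt ^t* = Xt by rewrite XtE adjmxD adjmxZ hX hK tt.
have tr1 : \tr (Xt *m e) = \tr (zt ^t* *m B u).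
  by rewrite -{1}hXt -Nte sNt Ntzt.
have tr2 : \tr (zt ^t* *m B u) = \tr (z ^t* *m B u) + t * \tr (u ^t* *m B u)
     - t ^+ 2 * \tr (e ^t* *m B u).
  rewrite ztE -scaleNr !adjmxD !adjmxZ rmorphN rmorphXn /= tt.
  by rewrite !mulmxDl -!scalemxAl !mxtraceD !mxtraceZ mulNr.
have tr3 : \tr (K *m u) = \tr (u ^t* *m N u) + \tr (z ^t* *m B u).
  rewrite sN sB -mxtraceD -mulmxDl -adjmxD Nu subrK hK.
  by [].
rewrite ztE -scaleNr !mulmxDr !mxtraceD -!scalemxAr !mxtraceZ tr1 tr2.
rewrite XtE !mulmxDl !mxtraceD -!scalemxAl !mxtraceZ tr3.
ring.
Qed.

Lemma frac_expansion_re (N B Nt : {linear M -> M}) (X K Xt z u e zt : M) (t : R) :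
  selfadj N -> selfadj B -> selfadj Nt -> injective Nt ->
  (forall Z, Nt Z = N Z + t%:C%C *: B Z) -> Xt = X + t%:C%C *: K ->
  X ^t* = X -> K ^t* = K ->
  N z = X -> N u = K - B z -> Nt e = B u -> Nt zt = Xt ->
  complex.Re (\tr (Xt *m zt)) = complex.Re (\tr (X *m z)) +
    t * (complex.Re (\tr (K *m z)) + complex.Re (\tr (X *m u))) +
    t ^+ 2 * complex.Re (\tr (u ^t* *m N u)) - t ^+ 3 * complex.Re (\tr (u ^t* *m B u)) +
    t ^+ 4 * complex.Re (\tr (e ^t* *m B u)).
Proof.
move=> sN sB sNt iNt NtE XtE hX hK Nz Nu Nte Ntzt.
have tt : (t%:C%C : C)^* = t%:C%C by apply/CrealP; rewrite complex_real.
rewrite (frac_expansion sN sB sNt iNt tt NtE XtE hX hK Nz Nu Nte Ntzt).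
move: (\tr (X *m z)) (\tr (K *m z)) (\tr (X *m u)) (\tr (u ^t* *m N u)) => a b c d.
move: (\tr (u ^t* *m B u)) (\tr (e ^t* *m B u)) => f g.
by rewrite mulrN -mulNr -!rmorphXn -rmorphN !ReD !ReZ ReD mulNr.
Qed.

End FractionalExpansion.

Section RelopLinear.
Variables (R : realType) (n : nat).
Local Notation C := R[i].
Local Notation H := (hermmx R n).
Local Notation M := 'M[C]_n.

Lemma two_sided_linear (a b : C) (X Y : M) :
  linear (fun Z : M => a *: (X *m Z) + b *: (Z *m Y)).
Proof.
move=> c Z W; rewrite mulmxDl mulmxDr -scalemxAl -scalemxAr !scalerDr !scalerA.
by rewrite addrACA [c * a]mulrC [c * b]mulrC.
Qed.

Lemma two_sided_pencil (a b t : C) (X Y H0 K0 Z : M) :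
  a *: ((X + t *: H0) *m Z) + b *: (Z *m (Y + t *: K0)) =
  (a *: (X *m Z) + b *: (Z *m Y)) + t *: (a *: (H0 *m Z) + b *: (Z *m K0)).
Proof.
rewrite mulmxDl mulmxDr -scalemxAl -scalemxAr !scalerDr !scalerA.
by rewrite addrACA [t * a]mulrC [t * b]mulrC.
Qed.

Lemma two_sided_selfadj (a b : C) (X Y : M) : a^* = a -> b^* = b ->
  X ^t* = X -> Y ^t* = Y -> selfadj (fun Z : M => a *: (X *m Z) + b *: (Z *m Y)).
Proof.
move=> ha hb hX hY A B; rewrite adjmxD !adjmxZ ha hb !adjmxM hX hY.
rewrite mulmxDr mulmxDl -!scalemxAr -!scalemxAl !mxtraceD !mxtraceZ.
by rewrite mulmxA [A ^t* *m (B *m Y)]mulmxA [\tr (A ^t* *m B *m Y)]mxtrace_mulC [Y *m (_ *m _)]mulmxA.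
Qed.

HB.instance Definition _ s X Y :=
  GRing.isLinear.Build C M M _ (relop s X Y) (two_sided_linear (1 - s)%:C%C s%:C%C X Y).

Lemma conj_realC (a : R) : (a%:C%C : C)^* = a%:C%C.
Proof. by apply/CrealP; rewrite complex_real. Qed.

Lemma relop_selfadj s (X Y : H) : selfadj (relop s X Y).
Proof. by apply: two_sided_selfadj; rewrite ?conj_realC ?hermmxP. Qed.

Lemma relop_inj s (X Y : M) : relmx s X Y \in unitmx -> injective (relop s X Y).
Proof. by move=> uB Z W ZW; rewrite -(relopK Z uB) ZW relopK. Qed.

(** [X - Y] is, up to the factor [s], the difference of [X] and of the image of
    the identity, so the integrand is a matrix-fractional function of [X]. *)
Lemma integrand_frac s (X Y : M) : relmx s X Y \in unitmx ->
  s * qre_integrand s X Y =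
  complex.Re (\tr (X *m relinv s X Y X)) - complex.Re (\tr X).
Proof.
move=> uB; have sXY : s%:C%C *: (X - Y) = X - relop s X Y 1%:M.
  rewrite /relop mulmx1 mul1mx rmorphB /= scalerBl scale1r scalerBr.
  by rewrite opprD opprB addrA addrCA subrr addr0.
have e : s%:C%C *: relinv s X Y (X - Y) = relinv s X Y X - 1%:M.
  by apply: (relop_inj uB); rewrite linearZ [RHS]linearB /= !relinvK.
rewrite /qre_integrand -ReZ -mxtraceZ scalemxAr e mulmxBr mulmx1.
by rewrite raddfB /= ReB.
Qed.

End RelopLinear.

Section IntegrandTaylor.
Variables (R : realType) (n : nat).
Local Notation C := R[i].
Local Notation H := (hermmx R n).
Local Notation M := 'M[C]_n.
Local Notation P := (R^o * (H * H))%type.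

Lemma divided_expansion (s t A T a1 a2 a3 a4 a5 a6 a7 a8 b6 b7 : R) : s != 0 ->
  A = a1 + t * (a3 + a4) + t ^+ 2 * b6 - t ^+ 3 * b7 + t ^+ 4 * a8 ->
  T = a2 + t * a5 -> b6 = a6 -> b7 = a7 ->
  A - T = s * (s^-1 * (a1 - a2) + s^-1 * (a3 + a4 - a5) * t + s^-1 * a6 * t ^+ 2 +
     - (s^-1 * a7) * t ^+ 3 + s^-1 * a8 * t ^+ 4).
Proof. by move=> s0 -> -> -> ->; field. Qed.

Lemma frac_expansion_real s (X Y H0 K0 : H) (t : R) :
  s != 0 -> relmx s X Y \in unitmx -> relmx s (X + t *: H0) (Y + t *: K0) \in unitmx ->
  let Xt : H := X + t *: H0 in let Yt : H := Y + t *: K0 in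
  let z := relinv s X Y X in
  let u := relinv s X Y ((H0 : M) - relop s H0 K0 z) in
  let q := relop s H0 K0 u in
  qre_integrand s Xt Yt =
    s^-1 * (complex.Re (\tr ((X : M) *m z)) - complex.Re (\tr (X : M))) +
    s^-1 * (complex.Re (\tr ((H0 : M) *m z)) + complex.Re (\tr ((X : M) *m u)) - complex.Re (\tr (H0 : M))) * t +
    s^-1 * relform s X Y u * t ^+ 2 + - (s^-1 * relform s H0 K0 u) * t ^+ 3 +
    s^-1 * complex.Re (\tr ((relinv s Xt Yt q) ^t* *m q)) * t ^+ 4.
Proof.
move=> s0 uN uNt Xt Yt z u q.
apply: (mulfI s0); apply: (etrans (integrand_frac uNt)).
have XtE : (Xt : M) = (X : M) + t%:C%C *: (H0 : M) by [].
have NtE Z : relop s Xt Yt Z = relop s X Y Z + t%:C%C *: relop s H0 K0 Z.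
  exact: two_sided_pencil.
have E := @frac_expansion_re R n (relop s X Y) (relop s H0 K0) (relop s Xt Yt)
  X H0 Xt z u (relinv s Xt Yt q) (relinv s Xt Yt Xt) t
  (@relop_selfadj _ _ s X Y) (@relop_selfadj _ _ s H0 K0) (@relop_selfadj _ _ s Xt Yt)
  (relop_inj uNt) NtE XtE (hermmxP X) (hermmxP H0)
  (relinvK _ uN) (relinvK _ uN) (relinvK _ uNt) (relinvK _ uNt).
have trX : complex.Re (\tr (Xt : M)) = complex.Re (\tr (X : M)) + t * complex.Re (\tr (H0 : M)).
  by rewrite XtE mxtraceD mxtraceZ ReD ReZ.
exact: (divided_expansion s0 E trX (relformE s X Y u) (relformE s H0 K0 u)).
Qed.

Lemma relop0 (X Y Z : M) : relop 0 X Y Z = X *m Z.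
Proof. by rewrite /relop subr0 scale1r scale0r addr0. Qed.

Lemma integrand0 (X Y : M) : relmx 0 X Y \in unitmx ->
  qre_integrand 0 X Y = complex.Re (\tr (X - Y)).
Proof. by move=> uB; rewrite /qre_integrand -(relop0 X Y) relinvK. Qed.

Lemma slice_line s (w h : (H * H)%type) (t : R) :
  ((s, w) : P) + t *: ((0, h) : P) = (s, w + t *: h).
Proof. by congr pair; rewrite /= [t *: 0]mulr0 addr0. Qed.

End IntegrandTaylor.

Section IntegrandJet.
Variables (R : realType) (n : nat).
Local Notation C := R[i].
Local Notation H := (hermmx R n).
Local Notation M := 'M[C]_n.
Local Notation P := (R^o * (H * H))%type.

Let G : P -> R^o := fun p : P => qre_integrand p.1 p.2.1 p.2.2.

Lemma close_expansion (F a0 a1 a2 a3 b r t K : R) :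
  F = a0 + a1 * t + a2 * t ^+ 2 + a3 * t ^+ 3 + b * r * t ^+ 4 -> `|r| <= K ->
  `|F - (a0 + a1 * t + a2 * t ^+ 2 + a3 * t ^+ 3)| <= `|b| * K * t ^+ 4.
Proof.
have t4 : 0 <= t ^+ 4 by exact: exprn_even_ge0.
by move=> -> rK; rewrite addrC addKr normrM (ger0_norm t4) normrM !ler_wpM2r// ler_wpM2l.
Qed.

(** The matrix [u] is the coefficient of the expansion above. At [s = 0] the integrand
    is the linear function [tr (X - Y)], and both sides vanish since [0^-1 = 0]. *)
Lemma integrand_jet s (X Y H0 K0 : H) : 0 <= s <= 1 -> pd X -> pd Y ->
  exists2 u : M, iter_derive 2 ((0, (H0, K0)) : P) G (s, (X, Y)) = 2 * (s^-1 * relform s X Y u) &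
    iter_derive 3 ((0, (H0, K0)) : P) G (s, (X, Y)) = - 6 * (s^-1 * relform s H0 K0 u).
Proof.
move=> s01 pX pY.
have oB := @relset_open R n.
pose x : P := (s, (X, Y)); pose h : P := (0, (H0, K0)).
have Bx : relset x by apply: pd2_relset.
have uN : relmx s X Y \in unitmx by exact: relmx_unit.
have Bx0 : relset (x + 0 *: h) by rewrite scale0r addr0.
have nB := near_line oB Bx0.
have cG := @cd_qre_integrand R n 3.
have [s0|s0] := eqVneq s 0.
  pose a0 := complex.Re (\tr ((X : M) - Y)); pose a1 := complex.Re (\tr ((H0 : M) - K0)).
  have [|d2 d3] := @taylor3_unique R P (@relset R n) G x h a0 a1 0 0 0 oB cG Bx.
    apply: filterS nB => t Bt; rewrite mul0r /x /h slice_line s0 /G /=.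
    rewrite integrand0; last by move: Bt; rewrite /x /h slice_line s0 /relset /= -unitfE -unitmxE.
    have -> : ((X : M) + t%:C%C *: (H0 : M)) - ((Y : M) + t%:C%C *: (K0 : M)) =
      (X : M) - Y + t%:C%C *: ((H0 : M) - K0).
      by rewrite scalerBr opprD addrACA.
    rewrite mxtraceD mxtraceZ ReD ReZ -/a0 -/a1.
    by rewrite !mul0r !addr0 [t * _]mulrC subrr normr0.
  by exists 0; [rewrite d2|rewrite d3]; rewrite s0 invr0 mul0r !mulr0.
pose z := relinv s X Y X.
pose u := relinv s X Y ((H0 : M) - relop s H0 K0 z).
pose q := relop s H0 K0 u.
pose r (p : P) : R^o := complex.Re (\tr ((relinv p.1 p.2.1 p.2.2 q) ^t* *m q)).
have cr : {for x, continuous r}.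
  have [cr _] : cdC (@relset R n) 0 (fun p : P => \tr ((relinv p.1 p.2.1 p.2.2 q) ^t* *m q)).
    apply: (cdC_trace oB); apply: (cdMxM oB); last exact: cdMx_cst.
    by apply: (cdMx_adj oB); apply: cdMx_relinv; exact: cdMx_cst.
  exact: cd_cont cr Bx.
have crl : {for (0 : R), continuous (fun t : R => r (x + t *: h) : R^o)}.
  by apply: continuous_at_line; rewrite scale0r addr0.
have /cvgrPdist_le /(_ 1 ltr01) nr := crl.
pose K := `|r x| + 1.
have nK : \forall t \near (0 : R), `|r (x + t *: h)| <= K.
  apply: filterS nr => t; rewrite scale0r addr0 => rt.
  rewrite -[r (x + _)](subrK (r x)) addrC.
  by apply: le_trans (ler_normD _ _) _; rewrite lerD2l distrC.
have [|d2 d3] := @taylor3_unique R P (@relset R n) G x h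
  (s^-1 * (complex.Re (\tr ((X : M) *m z)) - complex.Re (\tr (X : M))))
  (s^-1 * (complex.Re (\tr ((H0 : M) *m z)) + complex.Re (\tr ((X : M) *m u)) - complex.Re (\tr (H0 : M))))
  (s^-1 * relform s X Y u) (- (s^-1 * relform s H0 K0 u)) (`|s^-1| * K) oB cG Bx.
  apply: filterS2 nB nK => t Bt Kt.
  have E : x + t *: h = (s, (X + t *: H0, Y + t *: K0)) by exact: slice_line.
  rewrite E in Bt Kt *.
  have uNt : relmx s (X + t *: H0) (Y + t *: K0) \in unitmx by rewrite unitmxE unitfE.
  apply: (close_expansion (frac_expansion_real s0 uN uNt)).
  exact: Kt.
exists u; first exact: d2.
by rewrite d3 mulrN mulNr.
Qed.

(** A relative bound of the pencil [(H0, K0)] by [(X, Y)] bounds the third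
    derivative of each integrand by its second derivative. *)
Lemma integrand_compatible s (X Y H0 K0 : H) (c : R) : 0 <= s <= 1 -> pd X -> pd Y ->
  (forall Z : M, `|frobform H0 Z| <= c * frobform X Z) ->
  (forall Z : M, `|frobform K0 Z| <= c * frobform Y Z) ->
  0 <= iter_derive 2 ((0, (H0, K0)) : P) G (s, (X, Y)) /\
  `|iter_derive 3 ((0, (H0, K0)) : P) G (s, (X, Y))| <=
    3 * c * iter_derive 2 ((0, (H0, K0)) : P) G (s, (X, Y)).
Proof.
move=> s01 pX pY hX hY.
have [u -> ->] := @integrand_jet s X Y H0 K0 s01 pX pY.
have /andP[s0 s1] := s01.
have s1' : 0 <= 1 - s by rewrite subr_ge0.
have f0 : 0 <= relform s X Y u.
  have [->|u0] := eqVneq u 0; last exact: ltW (relform_gt0 pX pY s01 u0).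
  by rewrite -relformE trmx0 map_mx0 mul0mx mxtrace0.
split; first by rewrite !mulr_ge0 ?invr_ge0.
rewrite !normrM normrN normr_nat ger0_norm ?invr_ge0//.
have fb : `|relform s H0 K0 u| <= c * relform s X Y u.
  rewrite /relform mulrDr; apply: le_trans (ler_normD _ _) _.
  rewrite !normrM !(ger0_norm s0) (ger0_norm s1').
  by rewrite lerD// mulrCA ler_wpM2l.
have -> : 3 * c * (2 * (s^-1 * relform s X Y u)) = 6 * (s^-1 * (c * relform s X Y u)) by ring.
by rewrite !ler_wpM2l// invr_ge0.
Qed.

End IntegrandJet.

(** * Compatibility of the relative entropy with the cones *)

Section RelativeEntropySmooth.
Variables (R : realType) (n : nat).
Local Notation C := R[i].
Local Notation H := (hermmx R n).
Local Notation M := 'M[C]_n.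
Local Notation E2 := (H * H)%type.
Local Notation P := (R^o * (H * H))%type.

Definition qre_fun : E2 -> R^o := fun w => qre_pd w.1 w.2.

Let G : P -> R^o := fun p : P => qre_integrand p.1 p.2.1 p.2.2.

Let oA := @pd2_open R n.
Let oB := @relset_open R n.

Lemma qre_funE w : pd2 w -> unit_int (fun s => G (s, w)) = qre_fun w.
Proof. by move=> [pX pY]; rewrite /qre_fun qre_integral. Qed.

Lemma cd_qre_fun k : continuously_derivable k (@pd2 R n) qre_fun.
Proof.
apply: (cd_eq oA qre_funE).
by apply: (cd_unit_int oA (@pd2_relset R n)); exact: cd_qre_integrand.
Qed.

Lemma iter_derive_qre k h x : pd2 x ->
  iter_derive k h qre_fun x = unit_int (fun s => iter_derive k ((0, h) : P) G (s, x)).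
Proof.
move=> Ax; rewrite -(@iter_derive_eq _ _ _ k _ qre_fun h x oA qre_funE Ax).
by apply: (iter_derive_unit_int _ oA oB (@pd2_relset R n)) => //; exact: cd_qre_integrand.
Qed.

(** Integration of the pointwise bound over [s]. *)
Lemma qre_compatible (X Y H0 K0 : H) (c : R) : pd X -> pd Y ->
  (forall Z : M, `|frobform H0 Z| <= c * frobform X Z) ->
  (forall Z : M, `|frobform K0 Z| <= c * frobform Y Z) ->
  0 <= iter_derive 2 ((H0, K0) : E2) qre_fun (X, Y) /\
  `|iter_derive 3 ((H0, K0) : E2) qre_fun (X, Y)| <=
    3 * c * iter_derive 2 ((H0, K0) : E2) qre_fun (X, Y).
Proof.
move=> pX pY hX hY; have Ax : pd2 ((X, Y) : E2) by [].
have key s (s01 : 0 <= s <= 1) := @integrand_compatible R n s X Y H0 K0 c s01 pX pY hX hY.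
pose g2 s := iter_derive 2 ((0, (H0, K0)) : P) G (s, (X, Y)).
pose g3 s := iter_derive 3 ((0, (H0, K0)) : P) G (s, (X, Y)).
have c2 : continuous01 g2.
  apply: (slice_continuous01 (@pd2_relset R n) _ Ax) => w.
  by apply: (@cd_cont _ _ _ 0); apply: (@cd_iter_derive _ _ _ 2 0); exact: cd_qre_integrand.
have c3 : continuous01 g3.
  apply: (slice_continuous01 (@pd2_relset R n) _ Ax) => w.
  by apply: (@cd_cont _ _ _ 0); apply: (@cd_iter_derive _ _ _ 3 0); exact: cd_qre_integrand.
have d2 := @iter_derive_qre 2 (H0, K0) (X, Y) Ax.
have d3 := @iter_derive_qre 3 (H0, K0) (X, Y) Ax.
rewrite d2 d3; exact: (unit_int_compatible c2 c3 key).
Qed.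

Lemma frobform_le (X H0 : H) (S : M) (d : 'rV[R]_n) (c : R) :
  X = S ^t* *m S :> M -> H0 = S ^t* *m rdiag d *m S :> M ->
  (forall i, `|d 0 i| <= c) -> forall Z : M, `|frobform H0 Z| <= c * frobform X Z.
Proof.
move=> XS HS dc Z.
have X1 : X = S ^t* *m rdiag (const_mx 1) *m S :> M.
  by rewrite rdiag1 mulmx1.
rewrite (frobform_factor _ X1) (frobform_factor _ HS) mulr_sumr.
apply: le_trans (ler_norm_sum _ _ _) _; apply: ler_sum => j _.
rewrite mulr_sumr; apply: le_trans (ler_norm_sum _ _ _) _; apply: ler_sum => i _.
rewrite [const_mx _ _ _]mxE mul1r normrM (ger0_norm (csqr_ge0 _)).
by rewrite ler_wpM2r ?csqr_ge0.
Qed.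

End RelativeEntropySmooth.

(** * The barrier along a line *)

Section ScalarChains.
Variable R : realType.

Lemma neg_ln_chain (q r g2 g3 : R -> R) (t : R) : 0 < q t ->
  is_derive t 1 (q : R -> R^o) (r t) ->
  is_derive t 1 (r : R -> R^o) (- g2 t) ->
  is_derive t 1 (g2 : R -> R^o) (g3 t) ->
  [/\ is_derive t 1 (fun t => - ln (q t) : R^o) (- (r t / q t)),
      is_derive t 1 (fun t => - (r t / q t) : R^o) (g2 t / q t + (r t / q t) ^+ 2) &
      is_derive t 1 (fun t => g2 t / q t + (r t / q t) ^+ 2 : R^o)
        (g3 t / q t - 3 * (r t / q t) * (g2 t / q t) - 2 * (r t / q t) ^+ 3)].
Proof.
move=> q0 dq dr dg; have qn0 : q t != 0 by rewrite gt_eqF.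
have dV := @is_deriveV R q t _ 1 qn0 dq.
have dp : is_derive t 1 (fun t => r t / q t : R^o) (- (g2 t / q t + (r t / q t) ^+ 2)).
  have := is_deriveM dr dV; congr (is_derive _ _ _ _).
  by rewrite /GRing.scale /=; field.
split.
- have := is_deriveN (@is_derive1_comp R (@ln R) q t _ _ (is_derive1_ln q0) dq).
  by congr (is_derive _ _ _ _); rewrite mulrC.
- by have := is_deriveN dp; rewrite opprK.
apply: (is_derive_cast (is_deriveD (is_deriveM dg dV) (is_deriveM dp dp))) => [u|].
  by rewrite expr2.
by rewrite /GRing.scale /=; field.
Qed.

Lemma is_derive_affine1 (a : R) (t : R) :
  is_derive t 1 (fun t => 1 + t * a : R^o) a.
Proof.
apply: (is_derive_cast (is_deriveD (is_derive_cst (1 : R^o) (t : R^o) (1 : R^o))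
  (is_deriveZ a (is_derive_id (t : R^o) (1 : R^o))))) => [u|].
  by rewrite mulrC.
by rewrite /GRing.scale /= add0r mulr1.
Qed.

Lemma ln_affine_chain (a t : R) : 0 < 1 + t * a ->
  [/\ is_derive t 1 (fun t => ln (1 + t * a) : R^o) (a / (1 + t * a)),
      is_derive t 1 (fun t => a / (1 + t * a) : R^o) (- (a / (1 + t * a)) ^+ 2) &
      is_derive t 1 (fun t => (a / (1 + t * a)) ^+ 2 : R^o)
        (- 2 * (a / (1 + t * a)) ^+ 3)].
Proof.
move=> p0; have pn0 : 1 + t * a != 0 by rewrite gt_eqF.
have d1 := is_derive_affine1 a t.
have d2 : is_derive t 1 (fun t => a / (1 + t * a) : R^o) (- (a / (1 + t * a)) ^+ 2).
  have := is_deriveZ a (@is_deriveV R (fun t => 1 + t * a) t _ 1 pn0 d1).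
  congr (is_derive _ _ _ _); rewrite /GRing.scale /=; field.
  by [].
split=> //.
  have := @is_derive1_comp R (@ln R) (fun t => 1 + t * a) t _ _ (is_derive1_ln p0) d1.
  by congr (is_derive _ _ _ _); rewrite mulrC.
apply: (is_derive_cast (is_deriveM d2 d2)) => [u|]; first by rewrite expr2.
by rewrite /GRing.scale /=; ring.
Qed.

Lemma is_derive_sum_fun n (f : 'I_n -> R -> R) (df : 'I_n -> R) (t : R) :
  (forall i, is_derive t 1 (f i : R -> R^o) (df i)) ->
  is_derive t 1 (fun t => \sum_i f i t : R^o) (\sum_i df i).
Proof.
move=> h; have := is_derive_sum h.
by congr (is_derive _ _ _ _); apply/funext => u; rewrite fct_sumE.
Qed.

Definition log_slopes n (d : 'rV[R]_n) k (t : R) : R := \sum_i (d 0 i / (1 + t * d 0 i)) ^+ k.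

Lemma log_slopes_chain n (d : 'rV[R]_n) (t : R) : (forall i, 0 < 1 + t * d 0 i) ->
  [/\ is_derive t 1 (fun t => \sum_i ln (1 + t * d 0 i) : R^o) (log_slopes d 1 t),
      is_derive t 1 (log_slopes d 1 : R -> R^o) (- log_slopes d 2 t) &
      is_derive t 1 (log_slopes d 2 : R -> R^o) (- 2 * log_slopes d 3 t)].
Proof.
move=> p0; split.
- apply: is_derive_sum_fun => i; rewrite expr1.
  by have [] := ln_affine_chain (p0 i).
- rewrite /log_slopes -sumrN; apply: is_derive_sum_fun => i.
  by under [X in is_derive _ _ X _]eq_fun do rewrite expr1; have [] := ln_affine_chain (p0 i).
- rewrite /log_slopes mulr_sumr; apply: is_derive_sum_fun => i.
  by have [] := ln_affine_chain (p0 i).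
Qed.

Lemma ln_prod n (f : 'I_n -> R) : (forall i, 0 < f i) ->
  ln (\prod_i f i) = \sum_i ln (f i).
Proof.
move=> f0; suff [] : 0 < \prod_i f i /\ ln (\prod_i f i) = \sum_i ln (f i) by [].
elim/big_ind2 : _ => [|x1 x2 y1 y2 [p1 <-] [p2 <-]|i _]; first by rewrite ln1.
  by rewrite mulr_gt0// lnM.
by [].
Qed.

(** With [m = |a| + c] and [N = a ^+ 2 + b + c ^+ 2] the left-hand side is at most
    [3 m N - m ^+ 3], whose maximum over [m >= 0] is [2 N `^ (3 / 2)]. *)
Lemma compatible_cubic (a b c g s : R) : 0 <= b -> 0 <= c ->
  `|g| <= 3 * c * b -> `|s| <= c ^+ 3 ->
  `|g - 3 * a * b - 2 * a ^+ 3 - 2 * s| <= 2 * (a ^+ 2 + b + c ^+ 2) `^ (3 / 2).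
Proof.
move=> b0 c0 gb sc.
pose N := a ^+ 2 + b + c ^+ 2; have N0 : 0 <= N by rewrite !addr_ge0 ?sqr_ge0.
have -> : N `^ (3 / 2) = Num.sqrt N ^+ 3.
  by rewrite mulrC powRrM powR12_sqrt// -[3]/(3%:R) powR_mulrn ?sqrtr_ge0.
pose y := Num.sqrt N; have y0 : 0 <= y by exact: sqrtr_ge0.
have y2 : y ^+ 2 = N by rewrite sqr_sqrtr.
pose m := `|a| + c.
have a0 : 0 <= `|a| by [].
have a2 : `|a| ^+ 2 = a ^+ 2 by rewrite real_normK ?num_real.
have a3 : `|a ^+ 3| = `|a| ^+ 3 by rewrite normrX.
apply: (@le_trans _ _ (3 * c * b + 3 * `|a| * b + 2 * `|a| ^+ 3 + 2 * c ^+ 3)).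
  apply: le_trans (ler_normB _ _) _; rewrite normrM normr_nat lerD//; last by rewrite ler_wpM2l.
  apply: le_trans (ler_normB _ _) _; rewrite normrM normr_nat a3 lerD//.
  apply: le_trans (ler_normB _ _) _; rewrite !normrM normr_nat (ger0_norm b0).
  by rewrite lerD.
have -> : 3 * c * b + 3 * `|a| * b + 2 * `|a| ^+ 3 + 2 * c ^+ 3 = 3 * m * N - m ^+ 3.
  by rewrite /m /N -a2; ring.
rewrite -/y -y2 -subr_ge0.
have -> : 2 * y ^+ 3 - (3 * m * y ^+ 2 - m ^+ 3) = (y - m) ^+ 2 * (2 * y + m) by ring.
by rewrite mulr_ge0 ?sqr_ge0// addr_ge0 ?mulr_ge0// addr_ge0.
Qed.

Lemma cube_sum_le n (d : 'I_n -> R) (c : R) : 0 <= c -> (forall i, `|d i| <= c) ->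
  `|\sum_i d i ^+ 3| <= c * \sum_i d i ^+ 2.
Proof.
move=> c0 dc; apply: le_trans (ler_norm_sum _ _ _) _; rewrite mulr_sumr.
apply: ler_sum => i _; rewrite normrX exprS -[d i ^+ 2]real_normK ?num_real//.
by rewrite ler_wpM2r ?sqr_ge0.
Qed.

End ScalarChains.

Section Barrier.
Variables (R : realType) (n : nat).
Local Notation C := R[i].
Local Notation H := (hermmx R n).
Local Notation M := 'M[C]_n.
Local Notation E2 := (H * H)%type.
Local Notation E3 := (H * H * R^o)%type.

Definition epi_int : set E3 := [set w | pd2 w.1 /\ qre_fun w.1 < w.2].

Definition rdet (X : H) : R := complex.Re (\det (X : M)).

(** The barrier as a real-valued function; outside [epi_int] its values are
    meaningless. *)
Definition barrier_re : E3 -> R^o := fun w =>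
  - ln (w.2 - qre_fun w.1) - ln (rdet w.1.1) - ln (rdet w.1.2).

Lemma rdet_gt0 X : pd X -> 0 < rdet X.
Proof.
have [U [l dX]] := spectral_exists X => /(pd_spectral dX) l0.
by rewrite /rdet (det_spectral dX) /=; apply: prodr_gt0.
Qed.

Lemma qre_pd2 (w : E2) : pd2 w -> qre w.1 w.2 = qre_fun w.
Proof. by move=> pw; rewrite /qre asboolT. Qed.

Lemma log_det_pd X : pd X -> log_det X = (ln (rdet X))%:E.
Proof. by move=> /rdet_gt0 d0; rewrite /log_det /lne leNgt d0. Qed.

Lemma qre_barrier_int w : epi_int w -> qre_barrier w = (barrier_re w)%:E.
Proof.
move=> [pw Dz]; rewrite /qre_barrier asboolT//.
have [pX pY] := pw; rewrite (log_det_pd pX) (log_det_pd pY) (qre_pd2 pw).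
by rewrite /lne leNgt subr_gt0 Dz.
Qed.

Lemma qre_barrier_out w : ~ epi_int w -> qre_barrier w = +oo%E.
Proof.
move=> nw; rewrite /qre_barrier; case: asboolP => // -[pX pY].
have pw : pd2 w.1 by [].
rewrite (log_det_pd pX) (log_det_pd pY) (qre_pd2 pw) /lne subr_le0.
by case: leP => // Dz; exfalso; apply: nw.
Qed.

Lemma dom_qre_barrier : dom (@qre_barrier R n) = epi_int.
Proof.
apply/seteqP; split => w; rewrite /dom /=; last by move=> /qre_barrier_int ->; rewrite ltry.
by apply: contraPP => /qre_barrier_out ->; rewrite ltxx.
Qed.

Lemma fst_pd2_open : open [set w : E3 | pd2 w.1].
Proof.
by apply: (@open_comp _ _ (@fst E2 R^o)) (@pd2_open R n) => p _; exact: fst_continuous.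
Qed.

Lemma cd_qre_fst k : continuously_derivable k [set w : E3 | pd2 w.1] (fun w => qre_fun w.1).
Proof.
apply: (@cd_comp_linear R E3 E2 (@pd2 R n) _ (@fst E2 R^o) k (@qre_fun R n) (@pd2_open R n) fst_pd2_open).
- by move=> p; exact: fst_continuous.
- by [].
- by [].
- exact: cd_qre_fun.
Qed.

Lemma cd_slack k : continuously_derivable k [set w : E3 | pd2 w.1] (fun w => w.2 - qre_fun w.1 : R^o).
Proof.
apply: (cdB fst_pd2_open); last exact: cd_qre_fst.
by apply: (cd_linear fst_pd2_open) => // p; exact: snd_continuous.
Qed.

Lemma epi_int_open : open epi_int.
Proof.
have -> : epi_int = [set w : E3 | pd2 w.1] `&` ((fun w : E3 => w.2 - qre_fun w.1 : R^o) @^-1` [set x | 0 < x]).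
  by apply/seteqP; split => w [pw Dw]; split => //; move: Dw; rewrite /= subr_gt0.
rewrite openE => w [pw Dw]; apply: filterI.
  exact: (open_nbhs_nbhs (conj fst_pd2_open pw)).
have c : (fun w : E3 => w.2 - qre_fun w.1 : R^o) @ w --> (w.2 - qre_fun w.1 : R^o).
  exact: cd_cont (cd_slack 0) pw.
by have := cvgr_gt _ c _ Dw; exact.
Qed.

Lemma cd_sub k (A B : set E3) (f : E3 -> R^o) : A `<=` B ->
  continuously_derivable k B f -> continuously_derivable k A f.
Proof.
move=> AB; elim: k f => [|k IH] f [cf df]; split=> //; try by move=> x /AB; exact: cf.
by move=> v; have [d1 d2] := df v; split=> [x /AB|]; [exact: d1|exact: IH].
Qed.

Lemma cd_rdet k (A : set E3) (L : E3 -> H) : open A -> continuous L ->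
  (forall x y (a : R), L (a *: x + y) = a *: L x + L y) ->
  continuously_derivable k A (fun w => rdet (L w) : R^o).
Proof.
by move=> oA cL lL; have [] := cdC_det oA (@cdMx_hermmx R n E3 A k L oA cL lL).
Qed.

Lemma cont_X : continuous (fun w : E3 => w.1.1).
Proof.
move=> p; exact: (@continuous_comp _ _ _ (@fst E2 R^o) (@fst H H) p (@fst_continuous _ _ p) (@fst_continuous _ _ _)).
Qed.

Lemma cont_Y : continuous (fun w : E3 => w.1.2).
Proof.
move=> p; exact: (@continuous_comp _ _ _ (@fst E2 R^o) (@snd H H) p (@fst_continuous _ _ p) (@snd_continuous _ _ _)).
Qed.

Lemma cd_barrier_re k : continuously_derivable k epi_int barrier_re.
Proof.
have oA := epi_int_open.
have slack : continuously_derivable k epi_int (fun w => w.2 - qre_fun w.1 : R^o).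
  by apply: (@cd_sub k _ [set w : E3 | pd2 w.1]); [move=> w []|exact: cd_slack].
apply: (cdB oA); first apply: (cdB oA).
- apply: (cdN oA); apply: (cd_ln oA) => // w [_]; by rewrite subr_gt0.
- apply: (cd_ln oA) => [w [[pX _] _]|]; first exact: rdet_gt0.
  by apply: cd_rdet => //; exact: cont_X.
- apply: (cd_ln oA) => [w [[_ pY] _]|]; first exact: rdet_gt0.
  by apply: cd_rdet => //; exact: cont_Y.
Qed.

(** Along a line the determinant of a positive definite matrix is a product of
    affine functions, with slopes the eigenvalues of [H0] relative to [X]. *)
Lemma ln_rdet_line (X H0 : H) (S : M) (d : 'rV[R]_n) (t : R) :
  S \in unitmx -> X = S ^t* *m S :> M -> H0 = S ^t* *m rdiag d *m S :> M ->
  (forall i, 0 < 1 + t * d 0 i) ->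
  ln (rdet (X + t *: H0)) = ln (csqr (\det S)) + \sum_i ln (1 + t * d 0 i).
Proof.
move=> uS XS HS p0.
have XtE : ((X + t *: H0 : H) : M) = S ^t* *m rdiag (\row_i (1 + t * d 0 i)) *m S.
  have -> : rdiag (\row_i (1 + t * d 0 i)) = 1%:M + t%:C%C *: rdiag d.
    apply/matrixP => i j; rewrite !mxE.
    by case: eqP => _; rewrite ?mulr1n ?mulr0n ?mulr0 ?addr0// rmorphD rmorphM.
  rewrite mulmxDr mulmx1 -scalemxAr mulmxDl -scalemxAl.
  by rewrite -XS -HS.
rewrite /rdet XtE det_factor /= -ln_prod// -lnM.
- by congr ln; congr (_ * _); apply: eq_bigr => i _; rewrite mxE.
- rewrite posrE lt_def csqr_ge0 csqr_eq0 andbT.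
  by rewrite -unitfE -unitmxE.
- by rewrite posrE; apply: prodr_gt0.
Qed.

End Barrier.

Section BarrierJet.
Variables (R : realType) (n : nat).
Local Notation H := (hermmx R n).
Local Notation E2 := (H * H)%type.
Local Notation E3 := (H * H * R^o)%type.

Lemma le_sqrt_sum m (d : 'I_m -> R) (s : R) i : \sum_i d i ^+ 2 <= s ->
  `|d i| <= Num.sqrt s.
Proof.
move=> ds; rewrite -sqrtr_sqr ler_wsqrtr//; apply: le_trans ds.
by rewrite (bigD1 i)//= lerDl; apply: sumr_ge0 => j _; exact: sqr_ge0.
Qed.

Lemma affine_gt0 (a c t : R) : `|a| <= c -> `|t| < (c + 1)^-1 -> 0 < 1 + t * a.
Proof.
move=> ac tc; have c0 : 0 <= c by exact: le_trans ac.
have c1 : 0 < c + 1 by rewrite ltr_wpDl.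
have : `|t * a| < 1.
  rewrite normrM; apply: (@le_lt_trans _ _ ((c + 1)^-1 * c)).
    by rewrite ler_pM// ltW.
  by rewrite mulrC ltr_pdivrMr// mul1r ltrDl.
by rewrite ltr_norml => /andP[]; lra.
Qed.

Lemma quotient_bound (p3 p2 q c : R) : 0 < q -> `|p3| <= 3 * c * p2 ->
  `|p3 / q| <= 3 * c * (p2 / q).
Proof.
by move=> q0 h; rewrite normrM normfV (gtr0_norm q0) mulrA ler_pM2r ?invr_gt0.
Qed.

Lemma third_regroup (g a b x y : R) :
  g - 3 * a * b - 2 * a ^+ 3 - 2 * x - 2 * y = g - 3 * a * b - 2 * a ^+ 3 - 2 * (x + y).
Proof. by ring. Qed.

Lemma second_regroup (a b x y c2 : R) : c2 = x + y ->
  (b + a ^+ 2) + x + y = a ^+ 2 + b + c2.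
Proof. by move=> ->; ring. Qed.

(** The second and third derivatives of the barrier along any direction: [a] and
    [b] come from the logarithm of the slack, [c] from the two determinants. *)
Lemma barrier_jet (w h : E3) : epi_int w ->
  exists a b c g s : R, [/\ 0 <= b, 0 <= c, `|g| <= 3 * c * b & `|s| <= c ^+ 3] /\
    iter_derive 2 h (@barrier_re R n) w = a ^+ 2 + b + c ^+ 2 /\
    iter_derive 3 h (@barrier_re R n) w = g - 3 * a * b - 2 * a ^+ 3 - 2 * s.
Proof.
case: w => -[X Y] z; case: h => -[H0 K0] k0 Ow.
have [[pX pY] Dz] := Ow.
have [S [d [uS XS HS]]] := simultaneous_diag H0 pX.
have [T [e [uT YT KT]]] := simultaneous_diag K0 pY.
pose c2 : R := \sum_i d 0 i ^+ 2 + \sum_i e 0 i ^+ 2.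
have c20 : 0 <= c2 by rewrite addr_ge0// sumr_ge0// => i _; exact: sqr_ge0.
pose c := Num.sqrt c2; have c0 : 0 <= c by exact: sqrtr_ge0.
have cc : c ^+ 2 = c2 by rewrite sqr_sqrtr.
have dc i : `|d 0 i| <= c.
  by apply: le_sqrt_sum; rewrite lerDl sumr_ge0// => j _; exact: sqr_ge0.
have ec i : `|e 0 i| <= c.
  by apply: le_sqrt_sum; rewrite lerDr sumr_ge0// => j _; exact: sqr_ge0.
have [hb hg] := qre_compatible pX pY (frobform_le XS HS dc) (frobform_le YT KT ec).
pose w : E3 := (X, Y, z); pose h : E3 := (H0, K0, k0).
pose x2 : E2 := (X, Y); pose h2 : E2 := (H0, K0).
have Ow0 : epi_int (w + 0 *: h) by rewrite scale0r addr0.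
have [d1 /= d10 dH] := near_line (@epi_int_open R n) Ow0.
have c1 : 0 < (c + 1)^-1 by rewrite invr_gt0 ltr_wpDl.
pose d0 := Num.min d1 (c + 1)^-1.
have d00 : 0 < d0 by rewrite lt_min d10.
have inO (t : R) : `|t| < d0 -> epi_int (w + t *: h).
  by rewrite lt_min => /andP[td _]; apply: dH; rewrite /ball_ /= sub0r normrN.
have pd_ (t : R) : `|t| < d0 -> forall i, 0 < 1 + t * d 0 i.
  by rewrite lt_min => /andP[_ td] i; exact: affine_gt0 (dc i) td.
have pe_ (t : R) : `|t| < d0 -> forall i, 0 < 1 + t * e 0 i.
  by rewrite lt_min => /andP[_ td] i; exact: affine_gt0 (ec i) td.
pose phi j (t : R) := iter_derive j h2 (@qre_fun R n) (x2 + t *: h2).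
pose q (t : R) := z + t * k0 - phi 0%N t.
pose r (t : R) := k0 - phi 1%N t.
pose f0 (t : R) := - ln (q t) - (ln (csqr (\det S)) + \sum_i ln (1 + t * d 0 i))
   - (ln (csqr (\det T)) + \sum_i ln (1 + t * e 0 i)).
pose f1 (t : R) := - (r t / q t) - log_slopes d 1 t - log_slopes e 1 t.
pose f2 (t : R) := (phi 2%N t / q t + (r t / q t) ^+ 2) + log_slopes d 2 t + log_slopes e 2 t.
pose f3 (t : R) := (phi 3%N t / q t - 3 * (r t / q t) * (phi 2%N t / q t) - 2 * (r t / q t) ^+ 3)
   - 2 * log_slopes d 3 t - 2 * log_slopes e 3 t.
have dphi j (t : R) : (j < 3)%N -> `|t| < d0 -> is_derive t 1 (phi j : R -> R^o) (phi j.+1 t).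
  move=> j3 /inO [p2 _].
  exact: (@is_derive_iter_line R E2 (@pd2 R n) 3 j h2 (@qre_fun R n) x2 t (@cd_qre_fun R n 3) j3 p2).
have q0 (t : R) : `|t| < d0 -> 0 < q t.
  by move=> /inO [_]; rewrite -subr_gt0.
have dq (t : R) : `|t| < d0 -> is_derive t 1 (q : R -> R^o) (r t).
  move=> td; apply: (is_derive_cast (is_deriveB (is_deriveD (is_derive_cst (z : R^o) (t : R^o) (1 : R^o))
    (is_deriveZ k0 (is_derive_id (t : R^o) (1 : R^o)))) (dphi 0%N t isT td))) => [u|].
    by rewrite /q mulrC.
  by rewrite add0r [_ *: 1]mulr1.
have dr (t : R) : `|t| < d0 -> is_derive t 1 (r : R -> R^o) (- phi 2%N t).
  move=> td; apply: (is_derive_cast (is_deriveB (is_derive_cst (k0 : R^o) (t : R^o) (1 : R^o)) (dphi 1%N t isT td))) => [u|].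
    by [].
  by rewrite add0r.
have ch (t : R) (td : `|t| < d0) :=
  neg_ln_chain (q0 t td) (dq t td) (dr t td) (dphi 2%N t isT td).
have cst (x t : R) := is_derive_cst (x : R^o) (t : R^o) (1 : R^o).
have e0 (t : R) : `|t| < d0 -> is_derive t 1 (f0 : R -> R^o) (f1 t).
  move=> td; have [l1 _ _] := log_slopes_chain (pd_ t td).
  have [m1 _ _] := log_slopes_chain (pe_ t td); have [n1 _ _] := ch t td.
  apply: (is_derive_cast (is_deriveB (is_deriveB n1 (is_deriveD (cst _ t) l1)) (is_deriveD (cst _ t) m1))) => [u|].
    by [].
  by rewrite !add0r.
have e1 (t : R) : `|t| < d0 -> is_derive t 1 (f1 : R -> R^o) (f2 t).
  move=> td; have [_ l1 _] := log_slopes_chain (pd_ t td).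
  have [_ m1 _] := log_slopes_chain (pe_ t td); have [_ n1 _] := ch t td.
  apply: (is_derive_cast (is_deriveB (is_deriveB n1 l1) m1)) => [u|].
    by [].
  by rewrite !opprK.
have e2 (t : R) : `|t| < d0 -> is_derive t 1 (f2 : R -> R^o) (f3 t).
  move=> td; have [_ _ l1] := log_slopes_chain (pd_ t td).
  have [_ _ m1] := log_slopes_chain (pe_ t td); have [_ _ n1] := ch t td.
  apply: (is_derive_cast (is_deriveD (is_deriveD n1 l1) m1)) => [u|].
    by [].
  by rewrite !mulNr.
pose fs (j : nat) : R -> R := match j with 0 => f0 | 1 => f1 | 2 => f2 | _ => f3 end.
have Ff (t : R) : `|t| < d0 -> @barrier_re R n (w + t *: h) = fs 0%N t.
  move=> td; rewrite /fs /f0.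
  rewrite -(ln_rdet_line uS XS HS (pd_ t td)) -(ln_rdet_line uT YT KT (pe_ t td)).
  by [].
have dfs j (t : R) : (j < 3)%N -> `|t| < d0 -> is_derive t 1 (fs j : R -> R^o) (fs j.+1 t).
  by case: j => [|[|[|//]]] _; [exact: e0|exact: e1|exact: e2].
have jets := iter_derive_of_chain d00 Ff dfs.
have q00 : 0 < q 0 by apply: q0; rewrite normr0.
have xE : x2 + 0 *: h2 = x2 by rewrite scale0r addr0.
have phi2 : phi 2%N 0 = iter_derive 2 h2 (@qre_fun R n) x2.
  exact: (congr1 (iter_derive 2 h2 (@qre_fun R n)) xE).
have phi3 : phi 3%N 0 = iter_derive 3 h2 (@qre_fun R n) x2.
  exact: (congr1 (iter_derive 3 h2 (@qre_fun R n)) xE).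
have {}hb : 0 <= phi 2%N 0 by exact: (eq_ind_r (fun a => 0 <= a) hb phi2).
have {}hg : `|phi 3%N 0| <= 3 * c * phi 2%N 0.
  apply: (eq_ind_r (fun a => `|a| <= _) _ phi3).
  exact: (eq_ind_r (fun a => _ <= 3 * c * a) hg phi2).
pose sl k := log_slopes d k 0 + log_slopes e k 0.
have slE k : sl k = \sum_i d 0 i ^+ k + \sum_i e 0 i ^+ k.
  rewrite /sl /log_slopes; congr (_ + _); apply: eq_bigr => i _;
  by rewrite mul0r addr0 divr1.
have sl2 : c ^+ 2 = sl 2%N by rewrite (slE 2%N).
have sl3 : `|sl 3%N| <= c ^+ 3.
  rewrite (slE 3%N) exprS cc mulrDr; apply: le_trans (ler_normD _ _) _.
  exact: (lerD (cube_sum_le c0 dc) (cube_sum_le c0 ec)).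
exists (r 0 / q 0), (phi 2%N 0 / q 0), c, (phi 3%N 0 / q 0), (sl 3%N).
split; first exact: (And4 (divr_ge0 hb (ltW q00)) c0 (quotient_bound q00 hg) sl3).
split; last exact: (etrans (jets 3%N isT) (third_regroup _ _ _ _ _)).
exact: (etrans (jets 2%N isT) (second_regroup _ _ sl2)).
Qed.

Lemma barrier_hessian_ge0 (w h : E3) : epi_int w -> 0 <= iter_derive 2 h (@barrier_re R n) w.
Proof.
move=> /(barrier_jet h)[a [b [c [g [s [[b0 c0 _ _] [-> _]]]]]]].
by rewrite !addr_ge0 ?sqr_ge0.
Qed.

Lemma barrier_self_concordance (w h : E3) : epi_int w ->
  `|iter_derive 3 h (@barrier_re R n) w| <=
    2 * (iter_derive 2 h (@barrier_re R n) w) `^ (3 / 2).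
Proof.
move=> /(barrier_jet h)[a [b [c [g [s [[b0 c0 gb sb] [-> ->]]]]]]].
exact: compatible_cubic.
Qed.

End BarrierJet.

(** * Convexity, homogeneity and monotonicity of the relative entropy *)

Lemma secants_convex (R : realType) (t a b f0 ft f1 : R) :
  a * (t * (1 - t)) <= b * (t * (1 - t)) -> ft - f0 = a * t -> f1 - ft = b * (1 - t) ->
  ft <= t * f1 + (1 - t) * f0.
Proof.
move=> ab fa fb; rewrite -subr_ge0.
have -> : t * f1 + (1 - t) * f0 - ft = t * (f1 - ft) - (1 - t) * (ft - f0) by ring.
by rewrite fa fb; lra.
Qed.

Lemma convex_of_hessian (R : realType) (E : normedModType R) (A : set E) (F : E -> R^o) (x y : E) :
  continuously_derivable 3 A F ->
  (forall u : R, 0 <= u <= 1 -> A (y + u *: (x - y))) ->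
  (forall z, A z -> 0 <= iter_derive 2 (x - y) F z) ->
  forall t, 0 <= t <= 1 -> F (t *: x + (1 - t) *: y) <= t * F x + (1 - t) * F y.
Proof.
move=> cF seg hess t /andP[t0 t1].
have pE (u : R) : u *: x + (1 - u) *: y = y + u *: (x - y).
  by rewrite scalerBl scale1r scalerBr addrCA addrA.
pose f j (u : R) := iter_derive j (x - y) F (y + u *: (x - y)).
have df j (u : R) : (j < 3)%N -> 0 <= u <= 1 -> is_derive u 1 (f j : R -> R^o) (f j.+1 u).
  by move=> j3 /seg Au; exact: (@is_derive_iter_line R E A 3 j (x - y) F y u cF j3 Au).
have f2 u : 0 <= u <= 1 -> 0 <= f 2%N u by move=> /seg Au; exact: hess.
have F0 : F y = f 0%N 0.
  by rewrite -[LHS]/(iter_derive 0 (x - y) F y) /f scale0r addr0.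
have F1 : F x = f 0%N 1.
  have yxE : y + 1 *: (x - y) = x by rewrite scale1r addrC subrK.
  by rewrite -[LHS]/(iter_derive 0 (x - y) F x) /f yxE.
have Ft : F (t *: x + (1 - t) *: y) = f 0%N t.
  by rewrite -[LHS]/(iter_derive 0 (x - y) F _) pE.
rewrite F0 F1 Ft; clearbody f; clear seg hess cF pE F0 F1 Ft.
have [->|tn0] := eqVneq t 0; first by rewrite mul0r subr0 mul1r add0r.
have [->|tn1] := eqVneq t 1; first by rewrite subrr mul0r mul1r addr0.
have {tn0}t0 : 0 < t by rewrite lt_def tn0.
have {tn1}t1 : t < 1 by rewrite lt_def eq_sym tn1.
have [u|a /andP[a0 at_] fa] := @MVT_closed R (f 0%N) (f 1%N) 0 t t0.
  by move=> /andP[u0 ut]; apply: df => //; rewrite u0 (le_trans ut (ltW t1)).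
have [u|b /andP[tb b1] fb] := @MVT_closed R (f 0%N) (f 1%N) t 1 t1.
  by move=> /andP[u0 ut]; apply: df => //; rewrite ut (le_trans (ltW t0) u0).
have ab : f 1%N a <= f 1%N b.
  apply: (@nondecreasing_MVT R (f 1%N) (f 2%N)) => [|u /andP[u1 u2]|u /andP[u1 u2]].
  - exact/ltW/(lt_trans at_).
  - by apply: df => //; rewrite (le_trans (ltW a0) u1) (le_trans u2 (ltW b1)).
  - by apply: f2 => //; rewrite (le_trans (ltW a0) u1) (le_trans u2 (ltW b1)).
have : f 1%N a * (t * (1 - t)) <= f 1%N b * (t * (1 - t)).
  by rewrite ler_pM2r// mulr_gt0// subr_gt0.
by rewrite subr0 in fa; move=> ab'; exact: secants_convex ab' fa fb.
Qed.

Section RelativeEntropyFacts.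
Variables (R : realType) (n : nat).
Local Notation C := R[i].
Local Notation H := (hermmx R n).
Local Notation M := 'M[C]_n.
Local Notation E2 := (H * H)%type.
Local Notation I1 := (hermmx1 R n).

Lemma quad_formD (X Y : H) v : quad_form (X + Y) v = quad_form X v + quad_form Y v.
Proof. by rewrite /quad_form /= mulmxDr mulmxDl mxE. Qed.

Lemma quad_formZ (a : R) (X : H) v : quad_form (a *: X) v = a%:C%C * quad_form X v.
Proof. by rewrite /quad_form /= -scalemxAr -scalemxAl mxE. Qed.

Lemma pd_add_psd (X Y : H) : pd X -> psd Y -> pd (X + Y).
Proof. by move=> pX pY v v0; rewrite quad_formD ltr_wpDr ?pX ?pY. Qed.

Lemma psd_add (X Y : H) : psd X -> psd Y -> psd (X + Y).
Proof. by move=> pX pY v; rewrite quad_formD addr_ge0 ?pX ?pY. Qed.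

Lemma pd_scale (a : R) (X : H) : 0 < a -> pd X -> pd (a *: X).
Proof. by move=> a0 pX v v0; rewrite quad_formZ mulr_gt0 ?pX// ltcR. Qed.

Lemma psd_scale (a : R) (X : H) : 0 <= a -> psd X -> psd (a *: X).
Proof. by move=> a0 pX v; rewrite quad_formZ mulr_ge0 ?pX// lecR. Qed.

Lemma pd2_scale (a : R) (w : E2) : 0 < a -> pd2 w -> pd2 (a *: w).
Proof.
by case: w => X Y a0 [p1 p2]; split; [exact: (pd_scale a0 p1)|exact: (pd_scale a0 p2)].
Qed.

Lemma pd2_add (x y : E2) : pd2 x -> pd2 y -> pd2 (x + y).
Proof.
case: x y => X1 X2 [Y1 Y2] [x1 x2] [y1 y2].
by split; [exact: (pd_add_psd x1 (pd_psd y1))|exact: (pd_add_psd x2 (pd_psd y2))].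
Qed.

Lemma pd2_combine (x y : E2) (t : R) : pd2 x -> pd2 y -> 0 <= t <= 1 ->
  pd2 (t *: x + (1 - t) *: y).
Proof.
move=> px py /andP[t0 t1].
have [->|tn0] := eqVneq t 0; first by rewrite scale0r add0r subr0 scale1r.
have [->|tn1] := eqVneq t 1; first by rewrite subrr scale0r addr0 scale1r.
apply: pd2_add; apply: pd2_scale => //; first by rewrite lt_def tn0.
by rewrite subr_gt0 lt_def eq_sym tn1.
Qed.

Lemma qre_hessian_ge0 (h w : E2) : pd2 w -> 0 <= iter_derive 2 h (@qre_fun R n) w.
Proof.
case: w => X Y [pX pY]; case: h => H0 K0.
have [S [d [uS XS HS]]] := simultaneous_diag H0 pX.
have [T [e [uT YT KT]]] := simultaneous_diag K0 pY.
pose c := Num.sqrt (\sum_i d 0 i ^+ 2) + Num.sqrt (\sum_i e 0 i ^+ 2).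
have dc i : `|d 0 i| <= c.
  by apply: le_trans (le_sqrt_sum i (lexx _)) _; rewrite lerDl sqrtr_ge0.
have ec i : `|e 0 i| <= c.
  by apply: le_trans (le_sqrt_sum i (lexx _)) _; rewrite lerDr sqrtr_ge0.
by have [] := qre_compatible pX pY (frobform_le XS HS dc) (frobform_le YT KT ec).
Qed.

Lemma qre_convex (x y : E2) (t : R) : pd2 x -> pd2 y -> 0 <= t <= 1 ->
  qre_fun (t *: x + (1 - t) *: y) <= t * qre_fun x + (1 - t) * qre_fun y.
Proof.
move=> px py t01.
have seg (u : R) : 0 <= u <= 1 -> pd2 (y + u *: (x - y)).
  move=> u01; have -> : y + u *: (x - y) = u *: x + (1 - u) *: y.
    by rewrite scalerBl scale1r scalerBr addrCA addrA.
  exact: pd2_combine.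
exact: (@convex_of_hessian R E2 (@pd2 R n) (@qre_fun R n) x y (@cd_qre_fun R n 3)
  seg (@qre_hessian_ge0 (x - y)) t t01).
Qed.

Lemma spectral_scale (a : R) (X : H) U l : spectral_dec X U l ->
  spectral_dec (a *: X : H) U (a *: l).
Proof.
move=> [hU XU]; split; first exact: hU.
have -> : rdiag (a *: l) = a%:C%C *: rdiag l.
  apply/matrixP => i j; rewrite !mxE; case: eqP => _; rewrite ?mulr1n ?mulr0n ?mulr0//.
  by rewrite rmorphM.
by rewrite -scalemxAr -scalemxAl -XU.
Qed.

Lemma spectral_shift (a : R) (X : H) U l : spectral_dec X U l ->
  spectral_dec (X + a *: I1 : H) U (\row_i (l 0 i + a)).
Proof.
move=> [hU XU]; split; first exact: hU.
have [_ U'U] := unitary_adjmx hU.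
have -> : rdiag (\row_i (l 0 i + a)) = rdiag l + a%:C%C *: 1%:M.
  apply/matrixP => i j; rewrite !mxE; case: eqP => _; rewrite ?mulr1n ?mulr0n ?mulr0 ?addr0//.
  by rewrite mulr1 rmorphD.
by rewrite mulmxDr mulmxDl -XU -scalemxAr mulmx1 -scalemxAl U'U.
Qed.

Lemma qre_homogeneous (a : R) (w : E2) : 0 < a -> pd2 w -> qre_fun (a *: w) = a * qre_fun w.
Proof.
case: w => X Y a0 [pX pY].
have [U [l dX]] := spectral_exists X; have [V [m dY]] := spectral_exists Y.
have l0 := (pd_spectral dX).1 pX; have m0 := (pd_spectral dY).1 pY.
rewrite /qre_fun (qre_pd_spectral (spectral_scale a dX) (spectral_scale a dY)).
rewrite (qre_pd_spectral dX dY) mulr_sumr; apply: eq_bigr => i _.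
rewrite mulr_sumr; apply: eq_bigr => j _; rewrite !mxE !lnM ?posrE//.
by ring.
Qed.

(** Convexity at the midpoint and homogeneity of degree one. *)
Lemma qre_subadditive (x y : E2) : pd2 x -> pd2 y ->
  qre_fun (x + y) <= qre_fun x + qre_fun y.
Proof.
move=> px py; have h2 : 0 < (2^-1 : R) by [].
have h01 : 0 <= (2^-1 : R) <= 1 by lra.
have two : (1 - 2^-1 : R) = 2^-1 by lra.
have E : 2^-1 *: x + (1 - 2^-1) *: y = 2^-1 *: (x + y) by rewrite two scalerDr.
have := qre_convex px py h01; rewrite E (qre_homogeneous h2 (pd2_add px py)) two.
by rewrite -mulrDr ler_pM2l.
Qed.

Lemma qre_self (X : H) : pd X -> qre_fun ((X, X) : E2) = 0.
Proof. by move=> pX; rewrite /qre_fun /qre_pd subrr mxtrace0. Qed.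

Lemma pd1 : pd I1.
Proof.
have d1 : spectral_dec I1 1%:M (const_mx 1).
  by split; [apply/unitarymxP; rewrite mul1mx trmx1 map_mx1|rewrite mulmx1 rdiag1 mulmx1 trmx1 map_mx1].
by apply/(pd_spectral d1) => i; rewrite mxE.
Qed.

Lemma spectral_trace (X : H) U l : spectral_dec X U l ->
  complex.Re (\tr (X : M)) = \sum_i l 0 i.
Proof.
move=> [hU ->]; have [UU' _] := unitary_adjmx hU.
rewrite mxtrace_mulC mulmxA UU' mul1mx.
rewrite [\tr _](_ : _ = (\sum_i l 0 i)%:C%C)//.
by rewrite -sum_realC; apply: eq_bigr => i _; rewrite !mxE eqxx mulr1n.
Qed.

Lemma overlap_sym (U V : M) i j : overlap U V i j = overlap V U j i.
Proof.
rewrite /overlap; have -> : U *m V ^t* = (V *m U ^t*) ^t* by rewrite adjmxM adjmxK.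
by rewrite !mxE /csqr; case: (\sum_k _) => a b /=; rewrite sqrrN.
Qed.

Lemma ln_diff_ge (a b : R) : 0 < a -> 0 < b -> a - b <= a * (ln a - ln b).
Proof.
move=> a0 b0; have : ln (b / a) <= b / a - 1.
  have := @le_ln1Dx R (b / a - 1); rewrite [1 + _]addrC subrK; apply.
  by rewrite ltrBrDr addNr divr_gt0.
rewrite ln_div ?posrE// -(ler_pM2l a0) mulrBr mulrBr mulr1 mulrCA mulfV ?gt_eqF//.
by rewrite mulr1 mulrBr; lra.
Qed.

(** The rows and the columns of overlaps sum to one. *)
Lemma overlap_trace_diff (X Y : H) U V l m : spectral_dec X U l -> spectral_dec Y V m ->
  \sum_i \sum_j overlap U V i j * (l 0 i - m 0 j) =
  complex.Re (\tr (X : M)) - complex.Re (\tr (Y : M)).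
Proof.
move=> dX dY; have [hU _] := dX; have [hV _] := dY.
rewrite (spectral_trace dX) (spectral_trace dY).
under eq_bigr do under eq_bigr do rewrite mulrBr.
under eq_bigr do rewrite sumrB.
rewrite sumrB; congr (_ - _).
  by apply: eq_bigr => i _; rewrite -mulr_suml overlap_row// mul1r.
rewrite exchange_big; apply: eq_bigr => j _; rewrite -mulr_suml.
by under eq_bigr do rewrite overlap_sym; rewrite overlap_row// mul1r.
Qed.

(** Klein's inequality. *)
Lemma qre_ge_trace_diff (w : E2) : pd2 w ->
  complex.Re (\tr (w.1 : M)) - complex.Re (\tr (w.2 : M)) <= qre_fun w.
Proof.
case: w => X Y [pX pY]; have [U [l dX]] := spectral_exists X.
have [V [m dY]] := spectral_exists Y.
have l0 := (pd_spectral dX).1 pX; have m0 := (pd_spectral dY).1 pY.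
rewrite /qre_fun (qre_pd_spectral dX dY) -(overlap_trace_diff dX dY).
apply: ler_sum => i _; apply: ler_sum => j _.
by rewrite ler_wpM2l ?overlap_ge0// ln_diff_ge.
Qed.

End RelativeEntropyFacts.

(** * The relative entropy at singular matrices *)

Section Shift.
Variables (R : realType) (n : nat).
Local Notation C := R[i].
Local Notation H := (hermmx R n).
Local Notation M := 'M[C]_n.
Local Notation E2 := (H * H)%type.
Local Notation I1 := (hermmx1 R n).
Implicit Types X Y : H.

Definition qre_shift X Y (e : R) : R := qre_pd (X + e *: I1) (Y + e *: I1).

Lemma pd_shift X (e : R) : psd X -> 0 < e -> pd (X + e *: I1).
Proof. by move=> pX e0; rewrite addrC; exact: (pd_add_psd (pd_scale e0 (@pd1 R n)) pX). Qed.

Lemma pd2_shift X Y (e : R) : psd X -> psd Y -> 0 < e ->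
  pd2 ((X + e *: I1, Y + e *: I1) : E2).
Proof. by move=> pX pY e0; split; exact: pd_shift. Qed.

Lemma qre_shift_le_add X Y (e d : R) : pd2 ((X + e *: I1, Y + e *: I1) : E2) -> 0 < d ->
  qre_shift X Y (e + d) <= qre_shift X Y e.
Proof.
move=> pXY d0; have pd1d := pd_scale d0 (@pd1 R n).
have := qre_subadditive pXY (conj pd1d pd1d : pd2 ((d *: I1, d *: I1) : E2)).
rewrite (qre_self pd1d) addr0.
have -> : ((X + e *: I1, Y + e *: I1) : E2) + (d *: I1, d *: I1) =
    (X + (e + d) *: I1, Y + (e + d) *: I1).
  by rewrite scalerDl; congr pair; rewrite /= addrA.
exact.
Qed.

(** Subadditivity, with [D(d 1|d 1) = 0]. *)
Lemma qre_shift_nonincreasing X Y (e d : R) : psd X -> psd Y -> 0 < e -> e <= d ->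
  qre_shift X Y d <= qre_shift X Y e.
Proof.
move=> pX pY e0; rewrite le_eqVlt => /predU1P[->//|ed].
by rewrite -(subrKC e d); apply: qre_shift_le_add; [exact: pd2_shift|rewrite subr_gt0].
Qed.

Lemma qre_shift_le_pd X Y (e : R) : pd X -> pd Y -> 0 < e ->
  qre_shift X Y e <= qre_pd X Y.
Proof.
move=> pX pY e0.
have z0 (Z : H) : Z + 0 *: I1 = Z by rewrite scale0r addr0.
have -> : qre_pd X Y = qre_shift X Y 0 by rewrite /qre_shift !z0.
by rewrite -[e]add0r; apply: qre_shift_le_add; rewrite ?z0.
Qed.

Lemma qre_shift_spectral X Y U V l m (e : R) : psd X -> psd Y -> 0 < e ->
  spectral_dec X U l -> spectral_dec Y V m ->
  qre_shift X Y e =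
  \sum_i \sum_j overlap U V i j * ((l 0 i + e) * (ln (l 0 i + e) - ln (m 0 j + e))).
Proof.
move=> pX pY e0 dX dY.
rewrite /qre_shift (qre_pd_spectral (spectral_shift e dX) (spectral_shift e dY)).
by apply: eq_bigr => i _; apply: eq_bigr => j _; rewrite !mxE.
Qed.

Lemma abs_cont_spectral X Y U V l m : spectral_dec X U l -> spectral_dec Y V m ->
  abs_cont X Y <-> forall i j, m 0 j = 0 -> l 0 i != 0 -> overlap U V i j = 0.
Proof.
move=> [hU XU] [hV YV].
have [UU' U'U] := unitary_adjmx hU; have [VV' V'V] := unitary_adjmx hV.
split=> [ac i j mj li|ov v Yv].
  have : (X : M) *m (V ^t* *m delta_mx j 0 : 'cV_n) = 0.
    apply: ac; rewrite YV -!mulmxA [V *m _]mulmxA VV' mul1mx.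
    suff -> : rdiag m *m delta_mx j 0 = 0 :> 'cV[C]_n by rewrite mulmx0.
    apply/matrixP => a b; rewrite mul_rdiag_mx !mxE.
    by case: eqP => [->|_]; rewrite ?mj ?mul0r ?mulr0.
  move=> /(congr1 (fun v : 'cV_n => (U *m v) i 0)).
  rewrite mulmx0 XU !mulmxA UU' mul1mx -!mulmxA mul_rdiag_mx mulmxA.
  rewrite [RHS]mxE => /eqP; rewrite mulf_eq0.
  have -> : ((l 0 i)%:C%C == 0 :> C) = false.
    by apply/negbTE; rewrite -[X in _ != X]/((0 : R)%:C%C) (inj_eq (@complexI R)).
  rewrite /= -colE mxE => /eqP UVij.
  by rewrite /overlap UVij /csqr /= expr0n /= addr0.
pose y := V *m v; have vy : v = V ^t* *m y by rewrite /y mulmxA V'V mul1mx.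
have my j : m 0 j = 0 \/ y j 0 = 0.
  have : (V *m ((Y : M) *m v)) j 0 = 0 by rewrite Yv mulmx0 mxE.
  rewrite YV !mulmxA VV' mul1mx -mulmxA -/y mul_rdiag_mx => /eqP.
  rewrite mulf_eq0 => /orP[/eqP mj|/eqP]; [left|by right].
  exact: (@complexI R).
rewrite XU vy -!mulmxA.
suff -> : rdiag l *m (U *m (V ^t* *m y)) = 0 by rewrite mulmx0.
apply/colP => i; rewrite mul_rdiag_mx mulmxA [RHS]mxE.
have [->|li] := eqVneq (l 0 i) 0; first by rewrite mul0r.
rewrite [X in _ * X]mxE big1 ?mulr0// => j _.
case: (my j) => [mj|->]; last by rewrite mulr0.
have /eqP := ov i j mj li; rewrite csqr_eq0 => /eqP ->; by rewrite mul0r.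
Qed.

(** An eigenvector of [Y] for the eigenvalue 0 that is not orthogonal to an eigenvector
    of [X] for a positive eigenvalue [l] contributes, up to a positive weight, about
    [- l ln e], while all the other terms stay bounded below. *)
Lemma abs_cont_of_bounded X Y (K : R) : psd X -> psd Y ->
  (forall e, 0 < e <= 1 -> qre_shift X Y e <= K) -> abs_cont X Y.
Proof.
move=> pX pY hK; have [U [l dX]] := spectral_exists X.
have [V [m dY]] := spectral_exists Y.
have l0 := (psd_spectral dX).1 pX; have m0 := (psd_spectral dY).1 pY.
apply/(abs_cont_spectral dX dY) => i j mj li.
have lp : 0 < l 0 i by rewrite lt_def li l0.
apply/eqP; apply: contraT => ov0.
have ovp : 0 < overlap U V i j by rewrite lt_def ov0 overlap_ge0.
pose B := \sum_a \sum_b overlap U V a b * (l 0 a - m 0 b).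
pose D := overlap U V i j * l 0 i.
have D0 : 0 < D by rewrite mulr_gt0.
have lower e : 0 < e <= 1 -> B - D + D * (ln (l 0 i) - ln e) <= K.
  move=> /andP[e0 e1]; apply: le_trans (hK e _); last by rewrite e0.
  rewrite (qre_shift_spectral pX pY e0 dX dY).
  pose g a b := overlap U V a b * (l 0 a - m 0 b).
  pose f a b := overlap U V a b * ((l 0 a + e) * (ln (l 0 a + e) - ln (m 0 b + e))).
  have gf a b : g a b <= f a b.
    rewrite /g /f ler_wpM2l ?overlap_ge0//.
    have -> : l 0 a - m 0 b = (l 0 a + e) - (m 0 b + e) by ring.
    by apply: ln_diff_ge; rewrite ltr_wpDl.
  have gij : g i j = D by rewrite /g mj subr0.
  have fij : D * (ln (l 0 i) - ln e) <= f i j.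
    rewrite /f /D -mulrA ler_wpM2l ?overlap_ge0// mj add0r.
    have lnl : ln (l 0 i) <= ln (l 0 i + e) by rewrite ler_ln ?posrE ?addr_gt0// lerDl ltW.
    have lee : ln e <= ln (l 0 i + e) by rewrite ler_ln ?posrE ?addr_gt0// lerDr ltW.
    apply: (@le_trans _ _ (l 0 i * (ln (l 0 i + e) - ln e))).
      by rewrite ler_pM2l// lerB.
    by rewrite ler_wpM2r ?subr_ge0// lerDl ltW.
  have : f i j - g i j <= \sum_a \sum_b f a b - B.
    rewrite /B -sumrB (bigD1 i)//= -sumrB (bigD1 j)//= -addrA lerDl.
    rewrite addr_ge0//; first by apply: sumr_ge0 => b _; rewrite subr_ge0 gf.
    by apply: sumr_ge0 => a _; rewrite -sumrB; apply: sumr_ge0 => b _; rewrite subr_ge0 gf.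
  by rewrite gij; move: fij; rewrite -/f; clear -R; lra.
pose Q := K - B + D - D * ln (l 0 i).
(* For [e = exp (- T)] the unbounded term exceeds what [K] allows. *)
pose T := `|Q| / D + 1.
have T0 : 0 <= T by rewrite addr_ge0// divr_ge0// ltW.
have := lower (expR (- T)); rewrite expR_gt0 expR_le1 oppr_le0 T0 => /(_ isT).
rewrite expRK opprK => low.
have : D * T = `|Q| + D by rewrite /T; field; rewrite gt_eqF.
have := ler_norm Q; move: low D0; rewrite /Q; clear -R; lra.
Qed.

(** The only terms that could blow up have a zero eigenvalue of [Y] and a positive
    eigenvalue of [X], and their weight is zero. *)
Lemma bounded_of_abs_cont X Y : psd X -> psd Y -> abs_cont X Y ->
  exists K, forall e, 0 < e <= 1 -> qre_shift X Y e <= K.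
Proof.
move=> pX pY; have [U [l dX]] := spectral_exists X.
have [V [m dY]] := spectral_exists Y.
have l0 := (psd_spectral dX).1 pX; have m0 := (psd_spectral dY).1 pY.
move=> /(abs_cont_spectral dX dY) ac.
exists (\sum_i \sum_j overlap U V i j * ((l 0 i + 1) * `|ln (l 0 i + 1) - ln (m 0 j)|)).
move=> e /andP[e0 e1]; rewrite (qre_shift_spectral pX pY e0 dX dY).
apply: ler_sum => i _; apply: ler_sum => j _.
have l1 : 0 <= l 0 i + 1 by rewrite addr_ge0.
have [mj|mj] := eqVneq (m 0 j) 0.
  have [li|li] := eqVneq (l 0 i) 0; last by rewrite (ac i j mj li) !mul0r.
  by rewrite li mj !add0r subrr mulr0 mulr0 mulr_ge0 ?overlap_ge0 ?mulr_ge0.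
have mp : 0 < m 0 j by rewrite lt_def mj m0.
rewrite ler_wpM2l ?overlap_ge0//.
have le0 : 0 < l 0 i + e by rewrite ltr_wpDl.
apply: (@le_trans _ _ ((l 0 i + e) * `|ln (l 0 i + 1) - ln (m 0 j)|)).
  rewrite ler_pM2l//; apply: le_trans (ler_norm _); apply: lerB.
    by rewrite ler_ln ?posrE// ?lerD2l// ltr_wpDl.
  by rewrite ler_ln ?posrE// ?addr_gt0// lerDl ltW.
by rewrite ler_wpM2r// lerD2l.
Qed.

Lemma qre_shift_cvg X Y : psd X -> psd Y -> abs_cont X Y ->
  qre_shift X Y e @[e --> (0 : R)^'+] --> qre X Y.
Proof.
move=> pX pY ac; have [K hK] := bounded_of_abs_cont pX pY ac.
rewrite /qre; case: asboolP => [[pdX pdY]|_].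
  apply: cvg_at_right_filter.
  have cl : {for (0 : R), continuous (fun e : R => @qre_fun R n ((X, Y) + e *: (I1, I1)) : R^o)}.
    apply: continuous_at_line; rewrite scale0r addr0.
    exact: (@cd_cont _ _ (@pd2 R n) 0 _ _ (@cd_qre_fun R n 0)).
  by move: cl; rewrite /prop_for /continuous_at scale0r addr0; exact.
have := @nonincreasing_at_right_cvgr R (qre_shift X Y) 0 (BRight 1).
rewrite bnd_simp ltr01 => /(_ isT) h.
apply/cvg_ex; eexists; apply: h.
  move=> e d /[!in_itv]/= /andP[e0 _] /andP[d0 _] ed.
  exact: qre_shift_nonincreasing.
exists K => _ [e + <-]; rewrite /= in_itv /=; exact: hK.
Qed.

Lemma qre_shift_le_qre X Y (e : R) : psd X -> psd Y -> abs_cont X Y -> 0 < e ->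
  qre_shift X Y e <= qre X Y.
Proof.
move=> pX pY ac e0; apply: cvgr_to_ge (qre_shift_cvg pX pY ac) _.
apply: filterS2 (nbhs_right_gt 0) (nbhs_right_le e0) => d d0 de.
exact: qre_shift_nonincreasing.
Qed.

Lemma qre_le_of_shift X Y (z : R) : psd X -> psd Y -> abs_cont X Y ->
  (forall e, 0 < e -> qre_shift X Y e <= z) -> qre X Y <= z.
Proof.
move=> pX pY ac hz; apply: cvgr_to_le (qre_shift_cvg pX pY ac) _.
by apply: filterS (nbhs_right_gt 0) => d d0; exact: hz.
Qed.

End Shift.

(** * The epigraph as the closure of the domain of the barrier *)

Lemma closure_ge0 (R : realType) (T : topologicalType) (S : set T) (f : T -> R^o) (p : T) :
  closure S p -> {for p, continuous f} -> (forall x, S x -> 0 <= f x) -> 0 <= f p.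
Proof.
move=> clS cf fS; rewrite leNgt; apply/negP => fp.
have c : f @ p --> (f p : R^o) by exact: cf.
have neg : nbhs p [set x | f x < 0] by have := cvgr_lt _ c _ fp; exact.
have [x [/fS fx /= xneg]] := clS _ neg.
by move: xneg; rewrite ltNge fx.
Qed.

Section Epigraph.
Variables (R : realType) (n : nat).
Local Notation C := R[i].
Local Notation H := (hermmx R n).
Local Notation M := 'M[C]_n.
Local Notation E2 := (H * H)%type.
Local Notation E3 := (H * H * R^o)%type.
Local Notation I1 := (hermmx1 R n).

Lemma psdP (X : H) : psd X <-> forall v, 0 <= complex.Re (quad_form X v).
Proof.
have [U [l [hU XU]]] := spectral_exists X.
split=> h v; have := h v; rewrite (quad_form_factor v XU) /=; first by rewrite lecR.
by rewrite lecR.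
Qed.

Lemma Re_continuous (E : normedModType R) (f : E -> C) :
  cdC [set: E] 0 f -> continuous (fun w => complex.Re (f w) : R^o).
Proof. by move=> [cr _] w; exact: cd_cont cr I. Qed.

Lemma closure_psd (E : normedModType R) (S : set E) (L : E -> H) p :
  continuous L -> (forall x y (a : R), L (a *: x + y) = a *: L x + L y) ->
  closure S p -> (forall x, S x -> psd (L x)) -> psd (L p).
Proof.
move=> cL lL clS hS; apply/psdP => v.
have oT : open [set: E] by exact: openT.
have c : continuous (fun w : E => complex.Re (quad_form (L w) v) : R^o).
  apply: Re_continuous.
  have cX := @cdMx_hermmx R n E [set: E] 0 L oT cL lL.
  have cq : cdMx [set: E] 0 (fun w => v ^t* *m (L w : M) *m v).
    apply: (cdMxM oT); last exact: cdMx_cst.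
    by apply: (cdMxM oT) => //; exact: cdMx_cst.
  exact: cq 0 0.
by apply: (closure_ge0 clS (c p)) => x /hS /psdP; exact.
Qed.

(** The limit that defines the relative entropy is a supremum by monotonicity, and
    absolute continuity amounts to its finiteness. The resulting conditions involve
    positive definite matrices only, and are closed and stable under convex
    combinations. *)
Lemma qre_epiP (w : E3) : qre_epi w <->
  [/\ psd w.1.1, psd w.1.2 & forall e, 0 < e -> qre_shift w.1.1 w.1.2 e <= w.2].
Proof.
case: w => -[X Y] z; split=> [[/= pX pY ac qz]|[/= pX pY hz]].
  apply: (And3 pX pY) => e e0.
  exact: (le_trans (qre_shift_le_qre pX pY ac e0) qz).
have hK e : 0 < e <= 1 -> qre_shift X Y e <= z by move=> /andP[e0 _]; exact: hz.
have ac := abs_cont_of_bounded pX pY hK.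
exact: (And4 pX pY ac (qre_le_of_shift pX pY ac hz)).
Qed.

(** The point is the limit of its translates by [(d 1, d 1, d)]. *)
Lemma qre_epi_sub_closure : @qre_epi R n `<=` closure (@epi_int R n).
Proof.
move=> w /qre_epiP; case: w => -[X Y] z [/= pX pY hz] B nB.
pose w : E3 := (X, Y, z); pose h : E3 := (I1, I1, 1 : R^o).
have c := @continuous_line R E3 w h 0.
have [d /= d0 dH] : \forall t \near (0 : R), B (w + t *: h).
  by apply: c; rewrite scale0r addr0.
have d2 : 0 < d / 2 by rewrite divr_gt0.
exists (w + (d / 2) *: h); split; last first.
  by apply: dH; rewrite /ball_ /= sub0r normrN gtr0_norm//; lra.
split; first exact: (pd2_shift pX pY d2).
have := hz (d / 2) d2 => /le_lt_trans; apply.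
by rewrite /= ltrDl [_ *: _]mulr1.
Qed.

(** For a fixed shift the inequality holds on the domain by monotonicity, and passes
    to the limit as the shifted matrices stay positive definite. *)
Lemma closure_sub_qre_epi : closure (@epi_int R n) `<=` @qre_epi R n.
Proof.
move=> w clw; apply/qre_epiP.
have pX : psd w.1.1.
  apply: (@closure_psd E3 _ (fun w : E3 => w.1.1) w (@cont_X R n) _ clw) => // x [[p1 _] _].
  exact: (pd_psd p1).
have pY : psd w.1.2.
  apply: (@closure_psd E3 _ (fun w : E3 => w.1.2) w (@cont_Y R n) _ clw) => // x [[_ p2] _].
  exact: (pd_psd p2).
apply: (And3 pX pY) => e e0; rewrite -subr_ge0.
pose f (x : E3) : R^o := x.2 - qre_fun (x.1 + e *: ((I1, I1) : E2)).
apply: (@closure_ge0 R E3 _ f w clw).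
  apply: cvgB; first exact: snd_continuous.
  have c1 : {for w, continuous (fun x : E3 => x.1 + e *: ((I1, I1) : E2))}.
    by apply: cvgD; [exact: fst_continuous|exact: cvg_cst].
  apply: (continuous_comp c1); apply: (cd_cont (@cd_qre_fun R n 0)).
  exact: (pd2_shift pX pY e0).
move=> x [[p1 p2] Dz]; rewrite subr_ge0.
exact: (le_trans (qre_shift_le_pd p1 p2 e0) (ltW Dz)).
Qed.

Lemma closure_epi_int : closure (@epi_int R n) = @qre_epi R n.
Proof.
by apply/seteqP; split; [exact: closure_sub_qre_epi|exact: qre_epi_sub_closure].
Qed.

Lemma epi_int_combine (x y : E3) (t : R) : epi_int x -> epi_int y -> 0 <= t <= 1 ->
  epi_int (t *: x + (1 - t) *: y).
Proof.
case: x y => x1 x2 [y1 y2] [/= px xz] [/= py yz] t01; split; first exact: pd2_combine.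
apply: le_lt_trans (qre_convex px py t01) _; have /andP[t0 t1] := t01.
have t1' : 0 <= 1 - t by rewrite subr_ge0.
have [->|tn0] := eqVneq t 0.
  by rewrite /= [_ *: x2]mul0r mul0r !add0r !subr0 [_ *: y2]mul1r mul1r.
rewrite /= ltr_leD//; first by rewrite ltr_pM2l// lt_def tn0.
by rewrite ler_wpM2l// ltW.
Qed.

End Epigraph.

(** * The barrier property *)

Lemma product_of_logs (R : realType) (a b c t : R) : 0 < a -> 0 < b -> 0 < c ->
  (- ln a - ln b - ln c <= t -> expR (- t) <= a * b * c) /\
  (expR (- t) <= a * b * c -> - ln a - ln b - ln c <= t).
Proof.
move=> a0 b0 c0; have abc : 0 < a * b * c by rewrite !mulr_gt0.
have lnE : ln (a * b * c) = ln a + ln b + ln c by rewrite !lnM ?posrE ?mulr_gt0.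
rewrite -{1 2}(lnK abc) !ler_expR lnE; split; lra.
Qed.

Section BarrierProperty.
Variables (R : realType) (n : nat).
Local Notation C := R[i].
Local Notation H := (hermmx R n).
Local Notation M := 'M[C]_n.
Local Notation E2 := (H * H)%type.
Local Notation E3 := (H * H * R^o)%type.
Local Notation E4 := (H * H * R^o * R^o)%type.
Local Notation barrier := (@qre_barrier R n).

Definition rtrace (X : H) : R := complex.Re (\tr (X : M)).

Lemma rdet_continuous (L : E3 -> H) : continuous L ->
  (forall x y (a : R), L (a *: x + y) = a *: L x + L y) ->
  continuous (fun w => rdet (L w) : R^o).
Proof.
move=> cL lL w; have oT : open [set: E3] by exact: openT.
exact: (cd_cont (@cd_rdet R n 0 [set: E3] L oT cL lL) I).
Qed.

Lemma rtrace_continuous (L : E3 -> H) : continuous L ->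
  (forall x y (a : R), L (a *: x + y) = a *: L x + L y) ->
  continuous (fun w => rtrace (L w) : R^o).
Proof.
move=> cL lL; have oT : open [set: E3] by exact: openT.
exact: (Re_continuous (cdC_trace oT (@cdMx_hermmx R n E3 [set: E3] 0 L oT cL lL))).
Qed.

Lemma pd_of_psd_det (X : H) : psd X -> rdet X != 0 -> pd X.
Proof.
have [U [l dX]] := spectral_exists X => /(psd_spectral dX) l0.
rewrite /rdet (det_spectral dX) /= => /prodf_neq0 ln0.
by apply/(pd_spectral dX) => i; rewrite lt_def l0 ln0.
Qed.

(** A form of the inequality without logarithms, which passes to the limit when a
    determinant tends to zero. *)
Lemma epigraph_barrierP (p : E4) : epigraph barrier p <->
  epi_int p.1 /\ expR (- p.2) <= (p.1.2 - qre_fun p.1.1) * rdet p.1.1.1 * rdet p.1.1.2.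
Proof.
rewrite /epigraph /=; split=> [h|[Op h]].
  have Op : epi_int p.1.
    by move: h; apply: contraPP => /qre_barrier_out ->; rewrite leye_eq.
  split; first exact: Op.
  move: h; rewrite (qre_barrier_int Op) lee_fin => h.
  have [[pX pY] Dz] := Op.
  have s0 : 0 < p.1.2 - qre_fun p.1.1 by rewrite subr_gt0.
  have dX := rdet_gt0 pX; have dY := rdet_gt0 pY.
  exact: (product_of_logs _ s0 dX dY).1 h.
have [[pX pY] Dz] := Op; rewrite (qre_barrier_int Op) lee_fin.
have s0 : 0 < p.1.2 - qre_fun p.1.1 by rewrite subr_gt0.
exact: (product_of_logs _ s0 (rdet_gt0 pX) (rdet_gt0 pY)).2 h.
Qed.

(** The relative entropy is not continuous up to the boundary, so the limit is taken
    twice. With the trace difference, which is continuous and smaller, in its place,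
    the limit of the inequality shows that both determinants are positive at the limit
    point; there the relative entropy is continuous, and the limit of the inequality
    itself can be taken. *)
Lemma epigraph_barrier_closed : closed (epigraph barrier).
Proof.
move=> p clp.
have cfst : {for p, continuous (@fst E3 R^o)} by exact: fst_continuous.
have pX : psd p.1.1.1.
  apply: (@closure_psd R n E4 _ (fun p : E4 => p.1.1.1) p _ _ clp) => //.
    move=> q; exact: (@continuous_comp _ _ _ (@fst E3 R^o) (fun w : E3 => w.1.1) q (@fst_continuous _ _ q) (@cont_X R n q.1)).
  by move=> q /epigraph_barrierP[[[p1 _] _] _]; exact: (pd_psd p1).
have pY : psd p.1.1.2.
  apply: (@closure_psd R n E4 _ (fun p : E4 => p.1.1.2) p _ _ clp) => //.
    move=> q; exact: (@continuous_comp _ _ _ (@fst E3 R^o) (fun w : E3 => w.1.2) q (@fst_continuous _ _ q) (@cont_Y R n q.1)).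
  by move=> q /epigraph_barrierP[[[_ p2] _] _]; exact: (pd_psd p2).
have cdX : {for p, continuous (fun p : E4 => rdet p.1.1.1 : R^o)}.
  exact: (@continuous_comp _ _ _ (@fst E3 R^o) (fun w : E3 => rdet w.1.1 : R^o) p cfst (@rdet_continuous _ (@cont_X R n) (fun _ _ _ => erefl) p.1)).
have cdY : {for p, continuous (fun p : E4 => rdet p.1.1.2 : R^o)}.
  exact: (@continuous_comp _ _ _ (@fst E3 R^o) (fun w : E3 => rdet w.1.2 : R^o) p cfst (@rdet_continuous _ (@cont_Y R n) (fun _ _ _ => erefl) p.1)).
have ctX : {for p, continuous (fun p : E4 => rtrace p.1.1.1 : R^o)}.
  exact: (@continuous_comp _ _ _ (@fst E3 R^o) (fun w : E3 => rtrace w.1.1 : R^o) p cfst (@rtrace_continuous _ (@cont_X R n) (fun _ _ _ => erefl) p.1)).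
have ctY : {for p, continuous (fun p : E4 => rtrace p.1.1.2 : R^o)}.
  exact: (@continuous_comp _ _ _ (@fst E3 R^o) (fun w : E3 => rtrace w.1.2 : R^o) p cfst (@rtrace_continuous _ (@cont_Y R n) (fun _ _ _ => erefl) p.1)).
have cz : {for p, continuous (fun p : E4 => p.1.2 : R^o)}.
  exact: (@continuous_comp _ _ _ (@fst E3 R^o) (@snd E2 R^o) p cfst (@snd_continuous _ _ p.1)).
have ce : {for p, continuous (fun p : E4 => expR (- p.2) : R^o)}.
  apply: (@continuous_comp _ _ _ (fun p : E4 => - p.2 : R^o) (fun x : R^o => expR x : R^o)).
    by apply: cvgN; exact: snd_continuous.
  exact: continuous_expR.
pose chi (p : E4) : R^o := (p.1.2 - (rtrace p.1.1.1 - rtrace p.1.1.2)) * rdet p.1.1.1 * rdet p.1.1.2 - expR (- p.2).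
have chi0 : 0 <= chi p.
  apply: (@closure_ge0 R E4 _ chi p clp).
    apply: cvgB; last exact: ce.
    apply: cvgM; last exact: cdY.
    apply: cvgM; last exact: cdX.
    by apply: cvgB; [exact: cz|apply: cvgB; [exact: ctX|exact: ctY]].
  move=> q /epigraph_barrierP[[pq Dz] hq]; rewrite subr_ge0; apply: (le_trans hq).
  have [qX qY] := pq.
  have dX := rdet_gt0 qX; have dY := rdet_gt0 qY.
  rewrite ler_pM2r// ler_pM2r// lerB//; exact: (qre_ge_trace_diff pq).
have [dX dY] : rdet p.1.1.1 != 0 /\ rdet p.1.1.2 != 0.
  move: chi0; rewrite subr_ge0 => /(lt_le_trans (expR_gt0 _)) pos.
  by split; apply: contraTneq pos => ->; rewrite ?mulr0 ?mul0r ltxx.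
have pdX := pd_of_psd_det pX dX; have pdY := pd_of_psd_det pY dY.
have pp : pd2 p.1.1 := conj pdX pdY.
pose psi (p : E4) : R^o := (p.1.2 - qre_fun p.1.1) * rdet p.1.1.1 * rdet p.1.1.2 - expR (- p.2).
have psi0 : 0 <= psi p.
  apply: (@closure_ge0 R E4 _ psi p clp).
    apply: cvgB; last exact: ce.
    apply: cvgM; last exact: cdY.
    apply: cvgM; last exact: cdX.
    apply: cvgB; first exact: cz.
    apply: (@continuous_comp _ _ _ (@fst E3 R^o) (fun w : E3 => qre_fun w.1 : R^o)); first exact: cfst.
    exact: (cd_cont (@cd_qre_fst R n 0) pp).
  by move=> q /epigraph_barrierP[_ hq]; rewrite subr_ge0.
apply/epigraph_barrierP; move: psi0; rewrite subr_ge0 => h.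
split; last exact: h.
split; first exact: pp.
rewrite -subr_gt0; have := lt_le_trans (expR_gt0 _) h.
by rewrite (pmulr_lgt0 _ (rdet_gt0 pdY)) (pmulr_lgt0 _ (rdet_gt0 pdX)).
Qed.

End BarrierProperty.

Section LogHomogeneousBarrier.
Variables (R : realType) (n : nat).
Local Notation H := (hermmx R n).
Local Notation E2 := (H * H)%type.
Local Notation E3 := (H * H * R^o)%type.
Local Notation barrier := (@qre_barrier R n).

Lemma fine_barrier (w : E3) : epi_int w -> barrier_re w = fine (barrier w).
Proof. by move=> /qre_barrier_int ->. Qed.

Lemma barrier_neq_ninfty (w : E3) : barrier w != -oo%E.
Proof.
have [Ow|nO] := pselect (epi_int w); first by rewrite (qre_barrier_int Ow).
by rewrite (qre_barrier_out nO).
Qed.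

Lemma barrier_re_convex (x y : E3) (t : R) : epi_int x -> epi_int y -> 0 <= t <= 1 ->
  barrier_re (t *: x + (1 - t) *: y) <= t * barrier_re x + (1 - t) * barrier_re y.
Proof.
move=> Ox Oy t01.
have seg (u : R) : 0 <= u <= 1 -> epi_int (y + u *: (x - y)).
  move=> u01; have -> : y + u *: (x - y) = u *: x + (1 - u) *: y.
    by rewrite scalerBl scale1r scalerBr addrCA addrA.
  exact: epi_int_combine.
exact: (@convex_of_hessian R E3 (@epi_int R n) (@barrier_re R n) x y (@cd_barrier_re R n 3)
  seg (fun z => @barrier_hessian_ge0 R n z (x - y)) t t01).
Qed.

Lemma barrier_convex : convex_ereal barrier.
Proof.
split=> [w|x y t t01]; first exact: barrier_neq_ninfty.
have [->|tn0] := eqVneq t 0.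
  by rewrite scale0r add0r subr0 scale1r mul0e add0e mul1e.
have [->|tn1] := eqVneq t 1.
  by rewrite subrr scale0r addr0 scale1r mul0e adde0 mul1e.
have /andP[t0 t1] := t01.
have tp : 0 < t by rewrite lt_def tn0.
have tp' : 0 < 1 - t by rewrite subr_gt0 lt_def eq_sym tn1.
have [Ox|nOx] := pselect (epi_int x); last first.
  rewrite (qre_barrier_out nOx) gt0_muley ?lte_fin// addye ?leey//.
  have [Oy|nOy] := pselect (epi_int y); first by rewrite (qre_barrier_int Oy).
  by rewrite (qre_barrier_out nOy) gt0_muley ?lte_fin.
have [Oy|nOy] := pselect (epi_int y); last first.
  by rewrite (qre_barrier_out nOy) (qre_barrier_int Ox) gt0_muley ?lte_fin// addey// leey.
rewrite (qre_barrier_int Ox) (qre_barrier_int Oy).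
rewrite (qre_barrier_int (epi_int_combine Ox Oy t01)) -!EFinM -EFinD lee_fin.
exact: barrier_re_convex.
Qed.

Lemma barrier_dom_open : open (dom barrier).
Proof. by rewrite dom_qre_barrier; exact: epi_int_open. Qed.

Lemma Dk_barrier k (w h : E3) : epi_int w ->
  Dk k barrier w h = iter_derive k h (@barrier_re R n) w.
Proof.
move=> Ow; rewrite (Dk_line _ _ barrier_dom_open); last by rewrite dom_qre_barrier.
apply/esym; apply: (@iter_derive_eq R E3 (@epi_int R n)) => //; first exact: epi_int_open.
exact: fine_barrier.
Qed.

Lemma barrier_self_concordant : self_concordant barrier.
Proof.
split.
- exact: barrier_convex.
- exact: barrier_dom_open.
- exact: epigraph_barrier_closed.
- rewrite dom_qre_barrier; apply: (cd_eq (@epi_int_open R n) (@fine_barrier)).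
  exact: cd_barrier_re.
- move=> w h; rewrite dom_qre_barrier => Ow.
  rewrite (Dk_barrier 3 h Ow) (Dk_barrier 2 h Ow).
  exact: barrier_self_concordance.
Qed.

Lemma convex_setP (E : normedModType R) (A : set E) :
  (forall (x y : E) (t : R), A x -> A y -> 0 <= t <= 1 -> A (t *: x + (1 - t) *: y)) ->
  convex_set A.
Proof.
move=> h x y l; rewrite !inE => Ax Ay; apply: (h x y l%:num Ax Ay).
by apply/andP; split.
Qed.

Lemma qre_shift_combine (X Y X' Y' : H) (t e : R) : psd X -> psd Y -> psd X' -> psd Y' ->
  0 < e -> 0 <= t <= 1 ->
  qre_shift (t *: X + (1 - t) *: X') (t *: Y + (1 - t) *: Y') e <=
  t * qre_shift X Y e + (1 - t) * qre_shift X' Y' e.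
Proof.
move=> pX pY pX' pY' e0 t01.
have := qre_convex (pd2_shift pX pY e0) (pd2_shift pX' pY' e0) t01.
have shiftE (Z Z' : H) : t *: (Z + e *: hermmx1 R n) + (1 - t) *: (Z' + e *: hermmx1 R n) =
    (t *: Z + (1 - t) *: Z') + e *: hermmx1 R n.
  rewrite !scalerDr addrACA -scalerDl (_ : t + (1 - t) = 1) ?scale1r//.
  by rewrite addrC subrK.
have -> : t *: ((X + e *: hermmx1 R n, Y + e *: hermmx1 R n) : E2) +
   (1 - t) *: ((X' + e *: hermmx1 R n, Y' + e *: hermmx1 R n) : E2) =
   ((t *: X + (1 - t) *: X') + e *: hermmx1 R n, (t *: Y + (1 - t) *: Y') + e *: hermmx1 R n).
  by rewrite -!shiftE.
exact.
Qed.

Lemma qre_epi_convex : convex_set (@qre_epi R n).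
Proof.
apply: convex_setP => -[[X Y] z] [[X' Y'] z'] t /qre_epiP[/= pX pY hz] /qre_epiP[/= pX' pY' hz'] t01.
have /andP[t0 t1] := t01; have t1' : 0 <= 1 - t by rewrite subr_ge0.
apply/qre_epiP; apply: And3.
- exact: (psd_add (psd_scale t0 pX) (psd_scale t1' pX')).
- exact: (psd_add (psd_scale t0 pY) (psd_scale t1' pY')).
move=> e e0; apply: (le_trans (qre_shift_combine pX pY pX' pY' e0 t01)).
exact: (lerD (ler_wpM2l t0 (hz e e0)) (ler_wpM2l t1' (hz' e e0))).
Qed.

Lemma qre_barrier_scb : self_concordant_barrier barrier (@qre_epi R n).
Proof.
split.
- by rewrite -closure_epi_int; exact: closed_closure.
- exact: qre_epi_convex.
- exact: barrier_self_concordant.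
- by rewrite dom_qre_barrier; exact: closure_epi_int.
Qed.

Lemma rdet_scale (a : R) (X : H) : rdet (a *: X) = a ^+ n * rdet X.
Proof. by rewrite /rdet /= detZ -rmorphXn ReZ. Qed.

Lemma epi_int_scale (a : R) (w : E3) : 0 < a -> epi_int w -> epi_int (a *: w).
Proof.
case: w => x z a0 [/= px Dz]; split; first exact: (pd2_scale a0 px).
by rewrite (qre_homogeneous a0 px) /= ltr_pM2l.
Qed.

Lemma barrier_re_scale (a : R) (w : E3) : 0 < a -> epi_int w ->
  barrier_re (a *: w) = barrier_re w - (2 * n + 1)%:R * ln a.
Proof.
case: w => -[X Y] z a0 [/= px Dz]; have [pX pY] := px.
rewrite /barrier_re (qre_homogeneous a0 px) !rdet_scale /=.
have -> : a *: z - a * qre_fun (X, Y) = a * (z - qre_fun (X, Y)) by rewrite mulrBr.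
have an : 0 < a ^+ n by rewrite exprn_gt0.
rewrite !lnM ?posrE ?subr_gt0 ?(rdet_gt0 pX) ?(rdet_gt0 pY)// lnXn//.
by rewrite natrD natrM -mulr_natl; ring.
Qed.

Lemma qre_barrier_log_homogeneous : log_homogeneous barrier (2 * n + 1)%:R.
Proof.
split; first split.
- by rewrite dom_qre_barrier; apply: convex_setP => x y t; exact: epi_int_combine.
- by move=> w a; rewrite dom_qre_barrier => Ow a0; exact: epi_int_scale.
- move=> w a; rewrite dom_qre_barrier => Ow a0.
  rewrite (qre_barrier_int Ow) (qre_barrier_int (epi_int_scale a0 Ow)).
  by rewrite (barrier_re_scale a0 Ow) EFinB.
Qed.

End LogHomogeneousBarrier.

(** * Optimality of the parameter *)

(** An open convex set contains the interior of its closure. Prolong the segment from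
    [c] to [x] slightly beyond [x], to [x'] in the closure; points of the set close to
    [x'] are mapped close to [c] by the affine map [f], and [x] lies on the
    segment between such a point and its image. *)
Lemma open_convex_interior_closure (R : realType) (E : normedModType R) (A : set E) (c x : E) :
  open A -> (forall u v (t : R), A u -> A v -> 0 <= t <= 1 -> A (t *: u + (1 - t) *: v)) ->
  A c -> nbhs x (closure A) -> A x.
Proof.
move=> oA cA Ac nx.
have cl := @continuous_line R E x (x - c) 0.
have [d /= d0 dH] : \forall t \near (0 : R), closure A (x + t *: (x - c)).
  by apply: cl; rewrite scale0r addr0.
pose u := d / 2; have u0 : 0 < u by rewrite divr_gt0.
have un0 : u != 0 by rewrite gt_eqF.
pose x' := x + u *: (x - c).
have clx' : closure A x'.
  by apply: dH; rewrite /ball_ /= sub0r normrN gtr0_norm// /u; lra.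
pose f (y : E) := c + u^-1 *: (x' - y).
have cf : {for x', continuous f}.
  apply: cvgD; first exact: cvg_cst.
  by apply: cvgZl_tmp; apply: cvgB; [exact: cvg_cst|exact: cvg_id].
have nf : nbhs x' (f @^-1` A).
  by apply: cf; rewrite /f subrr scaler0 addr0; exact: open_nbhs_nbhs.
have [y [Ay Afy]] := clx' _ nf.
pose t := (1 + u)^-1.
have u1 : 0 < 1 + u by rewrite addr_gt0.
have t01 : 0 <= t <= 1.
  by rewrite invr_ge0 (ltW u1) /= invf_le1// lerDl ltW.
have := cA y (f y) t Ay Afy t01; congr A.
have tE : 1 - t = t * u by rewrite /t; field; rewrite gt_eqF.
have yE : y + u *: f y = (1 + u) *: x.
  rewrite /f scalerDr scalerA mulfV// scale1r addrCA [y + _]addrC subrK.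
  rewrite /x' scalerBr addrCA [u *: c + _]addrC subrK.
  by rewrite scalerDl scale1r.
by rewrite tE -scalerA -scalerDr yE scalerA mulVf ?scale1r// gt_eqF.
Qed.

Section DiagonalPoints.
Variables (R : realType) (n : nat).
Local Notation C := R[i].
Local Notation H := (hermmx R n).
Local Notation M := 'M[C]_n.
Local Notation E3 := (H * H * R^o)%type.

Fact rdiag_hermitian (l : 'rV[R]_n) : rdiag l \in @hermitian_pred R n.
Proof. by rewrite hermitian_predE adjmx_rdiag. Qed.

Definition hdiag (l : 'rV[R]_n) : H := HermMx (rdiag_hermitian l).

Lemma hdiagD (l m : 'rV[R]_n) (t : R) : hdiag (l + t *: m) = hdiag l + t *: hdiag m.
Proof.
apply: val_inj; apply/matrixP => i j; rewrite /= !mxE.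
by case: eqP => _; rewrite ?mulr1n ?mulr0n ?mulr0 ?addr0// rmorphD rmorphM.
Qed.

Lemma spectral_hdiag (l : 'rV[R]_n) : spectral_dec (hdiag l) 1%:M l.
Proof.
have e1 : (1%:M : M) ^t* = 1%:M by rewrite trmx1 map_mx1.
split; first by apply/unitarymxP; rewrite e1 mulmx1.
by rewrite e1 mul1mx mulmx1.
Qed.

Lemma pd_hdiag (l : 'rV[R]_n) : pd (hdiag l) <-> forall i, 0 < l 0 i.
Proof. exact: pd_spectral (spectral_hdiag l). Qed.

Lemma psd_hdiag (l : 'rV[R]_n) : psd (hdiag l) <-> forall i, 0 <= l 0 i.
Proof. exact: psd_spectral (spectral_hdiag l). Qed.

Lemma qre_hdiag (l m : 'rV[R]_n) :
  qre_pd (hdiag l) (hdiag m) = \sum_i l 0 i * (ln (l 0 i) - ln (m 0 i)).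
Proof.
rewrite (qre_pd_spectral (spectral_hdiag l) (spectral_hdiag m)).
apply: eq_bigr => i _.
have ov j : overlap (1%:M : M) 1%:M i j = (i == j)%:R.
  rewrite /overlap trmx1 map_mx1 mulmx1 mxE.
  by case: eqP => _; rewrite /csqr /= ?expr0n ?expr1n /= ?addr0.
rewrite (bigD1 i)//= big1 => [|j ji]; first by rewrite ov eqxx mul1r addr0.
by rewrite ov eq_sym (negbTE ji) mul0r.
Qed.

Definition diag_pt (l m : 'rV[R]_n) (z : R) : E3 := (hdiag l, hdiag m, z : R^o).

Lemma diag_ptD (l m l' m' : 'rV[R]_n) (z z' t : R) :
  diag_pt l m z + t *: diag_pt l' m' z' = diag_pt (l + t *: l') (m + t *: m') (z + t * z').
Proof. by rewrite /diag_pt !hdiagD. Qed.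

Lemma epi_int_diag_pt (l m : 'rV[R]_n) (z : R) : (forall i, 0 < l 0 i) -> (forall i, 0 < m 0 i) ->
  \sum_i l 0 i * (ln (l 0 i) - ln (m 0 i)) < z -> epi_int (diag_pt l m z).
Proof.
move=> /pd_hdiag pl /pd_hdiag pm Dz; split; first exact: (conj pl pm).
by rewrite /qre_fun qre_hdiag.
Qed.

Definition base_pt (z : R) : E3 := diag_pt (const_mx 1) (const_mx 1) z.
Definition dir_z : E3 := diag_pt 0 0 1.
Definition dir_y (i : 'I_n) : E3 := diag_pt 0 (delta_mx 0 i) 0.
Definition dir_xy (L : R) (i : 'I_n) : E3 := diag_pt (delta_mx 0 i) (expR (- L) *: delta_mx 0 i) L.

Lemma hdiag0 : hdiag 0 = 0.
Proof.
by apply: val_inj; apply/matrixP => i j; rewrite /= !mxE; case: eqP => _; rewrite ?mulr0n ?mulr1n.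
Qed.

Lemma diag_pt_sum (I : Type) (r : seq I) (F G : I -> 'rV[R]_n) (k : I -> R) :
  \sum_(i <- r) diag_pt (F i) (G i) (k i) =
  diag_pt (\sum_(i <- r) F i) (\sum_(i <- r) G i) (\sum_(i <- r) k i).
Proof.
elim: r => [|i r IH]; first by rewrite !big_nil /diag_pt hdiag0.
rewrite !big_cons IH -[X in diag_pt (F i) _ _ + X]scale1r diag_ptD.
by rewrite !scale1r mul1r.
Qed.

Lemma recession_z (z t : R) : 0 < z -> 0 <= t -> epi_int (base_pt z + t *: dir_z).
Proof.
move=> z0 t0; rewrite diag_ptD !scaler0 !addr0.
apply: epi_int_diag_pt => [i|i|]; rewrite ?mxE//.
rewrite big1 => [|i _]; last by rewrite !mxE subrr mulr0.
by rewrite mulr1 ltr_wpDr.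
Qed.

Lemma recession_y (z t : R) i : 0 < z -> 0 <= t -> epi_int (base_pt z + t *: dir_y i).
Proof.
move=> z0 t0; rewrite diag_ptD scaler0 addr0 mulr0 addr0.
have pos j : 1 <= 1 + t * (j == i)%:R :> R by rewrite lerDl mulr_ge0.
apply: epi_int_diag_pt => [j|j|]; rewrite ?mxE//; first exact: lt_le_trans (pos j).
apply: le_lt_trans z0; rewrite -oppr_ge0 -sumrN; apply: sumr_ge0 => j _.
by rewrite !mxE eqxx /= mul1r ln1 sub0r opprK ln_ge0.
Qed.

(** The relative entropy of [E_i] and [e^-L E_i] is [L]: the direction lies in the
    boundary of the epigraph, which is a closed convex cone. *)
Lemma recession_xy (L z t : R) i : 0 < z -> 0 <= L -> 0 <= t ->
  epi_int (base_pt z + t *: dir_xy L i).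
Proof.
move=> z0 L0 t0; rewrite diag_ptD.
have pos (a : R) j : 0 <= a -> 0 < 1 + a * (j == i)%:R by move=> a0; rewrite ltr_pwDl// mulr_ge0.
pose k := expR (- L); have k0 : 0 < k by exact: expR_gt0.
apply: epi_int_diag_pt => [j|j|]; rewrite ?mxE ?eqxx /=.
- exact: pos.
- by rewrite mulrA; apply: pos; rewrite mulr_ge0// ltW.
rewrite (bigD1 i)//= big1 => [|j ji]; last first.
  by rewrite !mxE eqxx /= (negbTE ji) !mulr0 addr0 subrr mulr0.
rewrite addr0 !mxE !eqxx /= !mulr1 -/k.
apply: (@le_lt_trans _ _ (t * L)); last by rewrite ltrDr.
pose a := 1 + t; pose b := 1 + t * k; pose r := b / a.
have a0 : 0 < a by rewrite ltr_pwDl.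
have b0 : 0 < b by rewrite ltr_pwDl// mulr_ge0// ltW.
have r0 : 0 < r by rewrite divr_gt0.
(* Convexity of [x ln x], with the tangents at [1] and at [k] and the weights [1] and
   [t]: the lower bounds add up to [a r - b = 0]. *)
have h1 := ln_diff_ge r0 ltr01; have h2 := ln_diff_ge r0 k0.
rewrite ln1 in h1; rewrite (expRK (- L)) opprK in h2.
have lnr : ln r = ln b - ln a by rewrite ln_div ?posrE.
have ar : a * r = b by rewrite /r mulrCA mulfV ?mulr1// gt_eqF.
have h2t := ler_wpM2l t0 h2.
have : 0 <= r * (a * ln r + t * L).
  have -> : r * (a * ln r + t * L) = r * (ln r - 0) + t * (r * (ln r + L)) by rewrite /a; ring.
  apply: le_trans (lerD h1 h2t).
  have -> : r - 1 + t * (r - k) = a * r - b by rewrite /a /b; ring.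
  by rewrite ar subrr.
rewrite pmulr_rge0// lnr => fin; rewrite -subr_ge0.
by have -> : t * L - a * (ln a - ln b) = a * (ln b - ln a) + t * L by ring.
Qed.

Lemma not_epi_neg_x (l m : 'rV[R]_n) (z : R) i : l 0 i < 0 -> ~ qre_epi (diag_pt l m z).
Proof. by move=> li [/psd_hdiag/(_ i)]; rewrite leNgt li. Qed.

Lemma not_epi_neg_y (l m : 'rV[R]_n) (z : R) i : m 0 i < 0 -> ~ qre_epi (diag_pt l m z).
Proof. by move=> mi [_ /psd_hdiag/(_ i)]; rewrite leNgt mi. Qed.

Lemma not_epi_neg_z (l : 'rV[R]_n) (z : R) : (forall i, 0 < l 0 i) -> z < 0 ->
  ~ qre_epi (diag_pt l l z).
Proof.
move=> /pd_hdiag pl z0 [/= _ _ _]; rewrite (@qre_pd2 R n (hdiag l, hdiag l) (conj pl pl)).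
by rewrite (qre_self pl) leNgt z0.
Qed.

(** The base point is a sum, with nonnegative coefficients for suitable [z] and [L], of
    [2 n + 1] directions of recession. *)
Lemma base_pt_decomposition (z L : R) :
  base_pt z = (z - n%:R * L) *: dir_z + (\sum_i (1 - expR (- L)) *: dir_y i + \sum_i dir_xy L i).
Proof.
have dZ (c a : R) (l m : 'rV[R]_n) : c *: diag_pt l m a = diag_pt (c *: l) (c *: m) (c * a).
  have := diag_ptD 0 0 l m 0 a c; rewrite !add0r => <-.
  by rewrite /diag_pt hdiag0 add0r.
have sum1 : \sum_(i < n) delta_mx 0 i = const_mx 1 :> 'rV[R]_n.
  apply/rowP => j; rewrite summxE mxE (bigD1 j)//= big1 => [|i ij].
    by rewrite mxE !eqxx addr0.
  by rewrite mxE eqxx /= eq_sym (negbTE ij).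
under eq_bigr do rewrite /dir_y dZ.
rewrite /dir_z dZ /dir_xy !diag_pt_sum -!scaler_sumr !sum1.
rewrite -[X in _ + (_ + X)]scale1r diag_ptD -[X in _ + X]scale1r diag_ptD /base_pt.
rewrite !scale1r !scaler0 !mul1r !mulr1 !add0r.
have s0 (V : nmodType) : \sum_(i < n) (0 : V) = 0 by rewrite big1.
congr diag_pt; first by rewrite s0 scaler0 add0r.
  by rewrite -scalerDl subrK scale1r.
by rewrite s0 scaler0 add0r sumr_const card_ord -[L *+ n]mulr_natl subrK.
Qed.

End DiagonalPoints.

Section Optimality.
Variables (R : realType) (n : nat).
Local Notation H := (hermmx R n).
Local Notation E3 := (H * H * R^o)%type.
Variables (g : E3 -> \bar R) (nu : R).
Hypotheses (gb : self_concordant_barrier g (@qre_epi R n)) (par : has_parameter g nu).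

Let sc : self_concordant g. Proof. by case: gb. Qed.

Let oA : open (dom g). Proof. by case: sc. Qed.

Let clA : closure (dom g) = @qre_epi R n. Proof. by case: gb. Qed.

Let F : E3 -> R^o := fun x => fine (g x).

Let base_epi (z : R) : 0 < z -> epi_int (base_pt n z).
Proof.
move=> z0; have := recession_z n z0 (lexx 0).
by rewrite scale0r addr0.
Qed.

(** The domain of [g] is open and convex, and its closure contains [epi_int]. *)
Lemma epi_int_sub_dom : @epi_int R n `<=` dom g.
Proof.
have [c Ac] : exists c, dom g c.
  have : closure (dom g) (base_pt n 1).
    by rewrite clA -closure_epi_int; apply: subset_closure; exact: base_epi.
  by move=> /(_ setT filterT)[c [Ac _]]; exists c.
move=> x Ox; apply: (open_convex_interior_closure oA _ Ac) => [u v t|].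
  exact: (dom_segment sc).
rewrite clA -closure_epi_int.
have := open_nbhs_nbhs (conj (@epi_int_open R n) Ox).
by apply: filterS; exact: subset_closure.
Qed.

Lemma exit_direction (x p : E3) (b : R) :
  (forall b', b < b' -> ~ qre_epi (x - b' *: p)) -> ~ dom g (x - b *: p).
Proof.
move=> h; rewrite -scaleNr => Ab; have [d d0 dH] := open_dom_line sc Ab.
have bd : b < b + d / 2 by rewrite ltrDl divr_gt0.
apply: (h _ bd); rewrite -clA; apply: subset_closure; rewrite -scaleNr; apply: dH.
rewrite opprK addrA addNr add0r gtr0_norm; lra.
Qed.

Let cF : continuously_derivable 3 (dom g) F. Proof. by case: sc. Qed.

Lemma slope_bound (z b : R) (p : E3) : 0 < b ->
  (forall t, 0 <= t -> epi_int (base_pt n z + t *: p)) ->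
  (forall b', b < b' -> ~ qre_epi (base_pt n z - b' *: p)) ->
  b^-1 <= - iter_derive 1 p F (base_pt n z).
Proof.
move=> b0 rec ex; rewrite lerNr.
apply: (recession_gradient_le_inv sc par b0); last exact: exit_direction.
by move=> t t0; apply: epi_int_sub_dom; exact: rec.
Qed.

Lemma optimality_estimate (z L T : R) : 0 < z -> 0 <= L -> n%:R * L <= z -> 0 < T < 1 ->
  T * ((z - n%:R * L) / z + n%:R * (1 - expR (- L)) + n%:R) <= nu.
Proof.
move=> z0 L0 Lz /andP[T0 T1].
pose x := base_pt n z.
have Ax : dom g x by apply: epi_int_sub_dom; exact: base_epi.
pose D p := - iter_derive 1 p F x.
have c1 : continuously_derivable 1 (dom g) F by exact: cdW (cdW cF).
have DD p q : D (p + q) = D p + D q.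
  by rewrite /D (iter_derive1D oA p q c1 Ax) opprD.
have DZ a p : D (a *: p) = a * D p.
  by rewrite /D (iter_derive1Z p a c1 Ax) mulrN.
have Dsum (G : 'I_n -> E3) : D (\sum_i G i) = \sum_i D (G i).
  elim/big_rec2 : _ => [|i u v _ <-]; last exact: DD.
  by rewrite -(scale0r (0 : E3)) DZ mul0r.
have up : T * D x <= nu.
  have := @gradient_le_parameter R E3 g nu sc par x (- x) T T0.
  rewrite /D -scaleN1r (iter_derive1Z x (-1) c1 Ax) mulN1r; apply.
  move=> t /andP[t0 tT]; apply: epi_int_sub_dom; rewrite scaleN1r scalerN.
  have -> : x - t *: x = (1 - t) *: x by rewrite scalerBl scale1r.
  by apply: epi_int_scale; [rewrite subr_gt0; exact: le_lt_trans tT T1|exact: base_epi].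
apply: le_trans up; rewrite ler_pM2l//.
have Dz : z^-1 <= D (dir_z R n).
  apply: slope_bound => // [t t0|b' bz]; first exact: recession_z.
  rewrite -scaleNr diag_ptD !scaler0 !addr0; apply: not_epi_neg_z => [i|]; first by rewrite mxE.
  by rewrite mulr1 subr_lt0.
have Dy i : 1 <= D (dir_y R i).
  rewrite -[leLHS]invr1; apply: slope_bound => // [t t0|b' b1]; first exact: recession_y.
  rewrite -scaleNr diag_ptD; apply: (@not_epi_neg_y _ _ _ _ _ i).
  by rewrite !mxE !eqxx mulr1 subr_lt0.
have Dxy i : 1 <= D (dir_xy L i).
  rewrite -[leLHS]invr1; apply: slope_bound => // [t t0|b' b1]; first exact: recession_xy.
  rewrite -scaleNr diag_ptD; apply: (@not_epi_neg_x _ _ _ _ _ i).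
  by rewrite !mxE !eqxx mulr1 subr_lt0.
rewrite {1}/x (base_pt_decomposition n z L) !DD DZ !Dsum -addrA.
have k1 : 0 <= 1 - expR (- L) by rewrite subr_ge0 expR_le1 oppr_le0.
apply: lerD; first by rewrite ler_wpM2l// subr_ge0.
have sumc (c : R) : n%:R * c = \sum_(i < n) c by rewrite sumr_const card_ord mulr_natl.
apply: lerD.
  rewrite sumc; apply: ler_sum => i _; rewrite DZ -[leLHS]mulr1.
  by rewrite ler_wpM2l.
by rewrite -[n%:R]mulr1 sumc; apply: ler_sum => i _; exact: Dxy.
Qed.

(** If [nu < 2 n + 1], the estimate with [T = 1 - e], [L = 1 / e] and [z] large enough
    for [n L / z <= e] bounds [nu] below by [(1 - e) ^ 2 (2 n + 1)], since
    [exp (- 1 / e) <= e]. The choice of [e] makes this a contradiction. *)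
Lemma parameter_ge : (2 * n + 1)%:R <= nu.
Proof.
set c : R := (2 * n + 1)%:R.
have c1 : 1 <= c by rewrite /c ler1n addn1.
have nu0 : 0 <= nu.
  by apply: (parameter_ge0 sc par (x := base_pt n 1)); apply: epi_int_sub_dom; exact: base_epi.
rewrite leNgt; apply/negP => nuc.
pose e := (c - nu) / (4 * c).
have c0 : 0 < c by lra.
have e0 : 0 < e by rewrite divr_gt0 ?subr_gt0 ?mulr_gt0.
have e1 : e < 1 by rewrite ltr_pdivrMr ?mulr_gt0//; lra.
pose L := e^-1; pose z := n%:R * L / e + 1.
have L0 : 0 < L by rewrite invr_gt0.
have nL : 0 <= n%:R * L by rewrite mulr_ge0// ltW.
have nLe : n%:R * L <= n%:R * L / e by rewrite ler_peMr// invf_ge1// ltW.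
have z0 : 0 < z by rewrite ltr_wpDl// divr_ge0// ltW.
have T01 : 0 < 1 - e < 1 by apply/andP; split; lra.
have nLz : n%:R * L <= z by rewrite /z; lra.
have est := optimality_estimate z0 (ltW L0) nLz T01.
have h1 : 1 - e <= (z - n%:R * L) / z.
  rewrite ler_pdivlMr// mulrBl mul1r lerD2l lerN2.
  by rewrite /z mulrDr mulr1 mulrCA mulfV ?gt_eqF// mulr1 lerDl ltW.
have h2 : expR (- L) <= e.
  rewrite expRN -[leRHS]invrK lef_pV2 ?posrE ?expR_gt0//.
  by apply: le_trans (expR_ge1Dx L); rewrite -/L; lra.
have n0 : (0 : R) <= n%:R by [].
have cE : c = 2 * n%:R + 1 by rewrite /c natrD natrM.
have low : (1 - e) * c <= (z - n%:R * L) / z + n%:R * (1 - expR (- L)) + n%:R.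
  have : n%:R * (1 - e) <= n%:R * (1 - expR (- L)) by rewrite ler_wpM2l// lerD2l lerN2.
  have : n%:R * (1 - e) <= n%:R by rewrite -[leRHS]mulr1 ler_wpM2l// gerBl ltW.
  by move: h1; rewrite cE; lra.
have : (1 - e) * ((1 - e) * c) <= nu.
  by apply: le_trans est; rewrite ler_pM2l//; lra.
have ec : e * c = (c - nu) / 4 by rewrite /e; field; rewrite gt_eqF.
have -> : (1 - e) * ((1 - e) * c) = c - 2 * (e * c) + e * (e * c) by ring.
have := mulr_ge0 (ltW e0) (mulr_ge0 (ltW e0) (ltW c0)).
rewrite ec; lra.
Qed.

End Optimality.

Unset Implicit Arguments.

Theorem corollary1p7 (R : realType) (n : nat) :
  log_homogeneous_barrier (@qre_barrier R n) (2 * n + 1)%:R (@qre_epi R n) /\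
  (forall (g : hermmx R n * hermmx R n * R^o -> \bar R) (nu : R),
     self_concordant_barrier g (@qre_epi R n) -> has_parameter g nu ->
     (2 * n + 1)%:R <= nu).
Proof.
split; last exact: parameter_ge.
by split; [exact: qre_barrier_scb|exact: qre_barrier_log_homogeneous].
Qed.
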